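(* There exists an algorithm that, given any clustered graph $C(G,T)$ whose underlying graph $G$ is planar and has $n$ vertices, computes a $\langle 0,\beta,0\rangle$-drawing of $C(G,T)$ with $\beta\in O(n^3)$. If $C(G,T)$ is flat, the computed drawing has $\beta\in O(n^2)$.
   Context: A clustered graph $C(G,T)$ consists of a graph $G$ and a rooted tree $T$ whose leaves are exactly the vertices of $G$; each internal node $\mu$ of $T$ is a cluster, identified with the set of leaves of its subtree. $C(G,T)$ is flat if no cluster other than the root contains another cluster (i.e., $T$ has height two). A drawing of $C(G,T)$ maps vertices to distinct points, edges to open curves between their endpoints, and each cluster $\mu$ to a simple closed region $R(\mu)$ containing all and only the vertices of $\mu$, with $R(\nu)\supseteq R(\mu)$ whenever $\mu$ is a descendant of $\nu$. Intersections among curves (edges and region boundaries) are isolated points, no three curves meet at a point, and two curves alternate around each intersection point. Edge-edge crossings are crossings between two edges; an edge crossing the boundary of $R(\mu)$ exactly $k$ times contributes $\lfloor k/2\rfloor$ edge-region crossings; for clusters $\mu,\nu$ neither an ancestor of the other, the number of region-region crossings is the number of connected components of $R(\mu)\setminus R(\nu)$ minus one. An $\langle\alpha,\beta,\gamma\rangle$-drawing has exactly $\alpha$ edge-edge, $\beta$ edge-region and $\gamma$ region-region crossings. $n$ is the number of vertices of $G$. *)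

(* Defs.v *)
From HB Require Import structures.
From mathcomp Require Import all_boot all_order all_algebra.

Set Implicit Arguments.
Unset Strict Implicit.
Unset Printing Implicit Defensive.

(* The nodes of the tree T are 'I_n + 'I_m: the n vertices of G and the m     *)
(* internal nodes. The function par gives the parent of a node, None for the  *)
(* root; as parents are internal nodes, the vertices are leaves.              *)
Definition up n m (par : 'I_n + 'I_m -> option 'I_m) : rel ('I_n + 'I_m) :=
  fun x y => if y is inr mu then par x == Some mu else false.

Definition descends n m (par : 'I_n + 'I_m -> option 'I_m) x (mu : 'I_m) :=
  connect (up par) x (inr mu).

Definition tree_cluster n m (par : 'I_n + 'I_m -> option 'I_m) (mu : 'I_m) :
    {set 'I_n} :=
  [set v | descends par (inl v) mu].

(* par_child: every internal node has a child, so the leaves of T are exactly *)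
(* the vertices. cluster_inj: a cluster is identified with its set of         *)
(* vertices. Without cluster_inj, chains of nodes with a single child would   *)
(* make the number of clusters unbounded in terms of n.                       *)
Record clustered_graph := ClusteredGraph {
  nv : nat;
  ni : nat;
  adj : rel 'I_nv;
  par : 'I_nv + 'I_ni -> option 'I_ni;
  adj_sym : symmetric adj;
  adj_irr : irreflexive adj;
  par_root : exists2 r, par r = None & forall x, connect (up par) x r;
  par_child : forall mu, exists x, par x = Some mu;
  cluster_inj : injective (tree_cluster par)
}.

Definition cluster_of (C : clustered_graph) (mu : 'I_(ni C)) :
    {set 'I_(nv C)} :=
  tree_cluster (@par C) mu.

Definition ancestor (C : clustered_graph) (nu mu : 'I_(ni C)) : bool :=
  descends (@par C) (inr mu) nu.

Definition flat (C : clustered_graph) : Prop :=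
  forall mu nu : 'I_(ni C),
    nu != mu -> cluster_of nu \subset cluster_of mu -> par (inr mu) = None.

(* Each undirected edge is listed once. *)
Definition edges n (a : rel 'I_n) : {set 'I_n * 'I_n} :=
  [set e : 'I_n * 'I_n | (e.1 < e.2) && a e.1 e.2].

(* Kleene's partial recursive functions. *)
Inductive recfun : Type :=
| RZero
| RSucc
| RProj of nat
| RComp of recfun & seq recfun
| RPrim of recfun & recfun
| RMin of recfun.

Inductive reval : recfun -> seq nat -> nat -> Prop :=
| EvZero xs : reval RZero xs 0
| EvSucc x xs : reval RSucc (x :: xs) x.+1
| EvProj i xs : i < size xs -> reval (RProj i) xs (nth 0 xs i)
| EvComp f gs xs ys y :
    revals gs xs ys -> reval f ys y -> reval (RComp f gs) xs y
| EvPrim0 f g xs y : reval f xs y -> reval (RPrim f g) (0 :: xs) y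
| EvPrimS f g k xs y z :
    reval (RPrim f g) (k :: xs) y -> reval g [:: k, y & xs] z ->
    reval (RPrim f g) (k.+1 :: xs) z
| EvMin f xs k (h : nat -> nat) :
    (forall i, i < k -> reval f (i :: xs) (h i).+1) ->
    reval f (k :: xs) 0 -> reval (RMin f) xs k
with revals : seq recfun -> seq nat -> seq nat -> Prop :=
| EvNil xs : revals [::] xs [::]
| EvCons g gs xs y ys :
    reval g xs y -> revals gs xs ys -> revals (g :: gs) xs (y :: ys).

(* The input of an algorithm: n, m, the adjacency matrix of G row by row, and *)
(* the parents of the vertices, then of the internal nodes.                   *)
Definition cg_code (C : clustered_graph) : nat :=
  pickle (nv C, ni C,
          [seq adj u v | u <- enum 'I_(nv C), v <- enum 'I_(nv C)],
          [seq omap val (par (inl v)) | v <- enum 'I_(nv C)],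
          [seq omap val (par (inr mu)) | mu <- enum 'I_(ni C)]).

(* The output of an algorithm: the points of the vertices, for each edge the  *)
(* points of a polygonal chain, for each cluster the corners of a polygon.    *)
(* The values of pl_edge on pairs that are not in edges are ignored.          *)
Record pl_drawing n m := PLDrawing {
  pl_pos : 'I_n -> rat * rat;
  pl_edge : 'I_n -> 'I_n -> seq (rat * rat);
  pl_region : 'I_m -> seq (rat * rat)
}.

Definition pl_code n m (P : pl_drawing n m) : nat :=
  pickle ([seq pl_pos P v | v <- enum 'I_n],
          [seq pl_edge P u v | u <- enum 'I_n, v <- enum 'I_n],
          [seq pl_region P mu | mu <- enum 'I_m]).

From mathcomp Require Import finmap all_classical all_reals all_analysis.
Import Order.TTheory GRing.Theory Num.Theory.
Import numFieldNormedType.Exports.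

Local Open Scope classical_set_scope.
Local Open Scope ring_scope.

Notation plane R := (R * R)%type (only parsing).

Definition is_arc (R : realType) (A : set (plane R)) (p q : plane R) : Prop :=
  exists g : R -> plane R,
    [/\ {within `[0, 1], continuous g}, {in `[0, 1] &, injective g},
        g 0 = p, g 1 = q & A = g @` `[0, 1]].

Definition is_closed_curve (R : realType) (A : set (plane R)) : Prop :=
  exists g : R -> plane R,
    [/\ {within `[0, 1], continuous g}, {in `[0, 1[ &, injective g},
        g 0 = g 1 & A = g @` `[0, 1]].

Definition bnd (R : realType) (S : set (plane R)) : set (plane R) :=
  closure S `\` interior S.

(* The closure of a bounded connected open set bounded by a Jordan curve.     *)
Definition simple_closed_region (R : realType) (S : set (plane R)) : Prop :=
  [/\ compact S, closure (interior S) = S, connected (interior S)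
    & is_closed_curve (bnd S)].

(* Around p, the four branches of A and B alternate: a homeomorphism from a   *)
(* neighbourhood of p onto an open set takes A to the x-axis and B to the     *)
(* y-axis.                                                                    *)
Definition alternate (R : realType) (A B : set (plane R)) (p : plane R) :
    Prop :=
  exists (U : set (plane R)) (h k : plane R -> plane R),
    [/\ open U /\ U p,
        {within U, continuous h},
        open (h @` U) /\ {within h @` U, continuous k},
        (forall x, U x -> k (h x) = x)
      & forall x, U x -> (A x <-> (h x).2 = 0) /\ (B x <-> (h x).1 = 0)].

(* Is 0 if A is infinite. *)
Definition ncard (T : choiceType) (A : set T) : nat := #|` fset_set A|%fset.

Definition components (T : topologicalType) (A : set T) : set (set T) :=
  [set connected_component A x | x in A].

Definition graph_drawing (R : realType) n (a : rel 'I_n)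
    (pos : 'I_n -> plane R) (ec : 'I_n * 'I_n -> set (plane R)) : Prop :=
  [/\ injective pos,
      (forall e, e \in edges a -> is_arc (ec e) (pos e.1) (pos e.2))
    & forall e v, e \in edges a -> ec e (pos v) -> v = e.1 \/ v = e.2].

Definition planar (R : realType) n (a : rel 'I_n) : Prop :=
  exists (pos : 'I_n -> plane R) (ec : 'I_n * 'I_n -> set (plane R)),
    graph_drawing a pos ec /\
    forall e f, e \in edges a -> f \in edges a -> e != f ->
      ec e `&` ec f `<=`
      [set pos e.1; pos e.2] `&` [set pos f.1; pos f.2].

Record drawing (R : realType) (C : clustered_graph) := Drawing {
  pos : 'I_(nv C) -> plane R;
  ecurve : 'I_(nv C) * 'I_(nv C) -> set (plane R);
  region : 'I_(ni C) -> set (plane R)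
}.

Section Drawings.
Variables (R : realType) (C : clustered_graph) (D : drawing R C).

(* inl e is the curve of the edge e, inr mu is the boundary of R(mu). *)
Definition is_curve (k : 'I_(nv C) * 'I_(nv C) + 'I_(ni C)) : bool :=
  if k is inl e then e \in edges (@adj C) else true.

Definition curve (k : 'I_(nv C) * 'I_(nv C) + 'I_(ni C)) : set (plane R) :=
  match k with inl e => ecurve D e | inr mu => bnd (region D mu) end.

Definition endpoints (k : 'I_(nv C) * 'I_(nv C) + 'I_(ni C)) :
    set (plane R) :=
  if k is inl e then [set pos D e.1; pos D e.2] else set0.

Definition crossings (k l : 'I_(nv C) * 'I_(nv C) + 'I_(ni C)) :
    set (plane R) :=
  (curve k `&` curve l) `\` (endpoints k `&` endpoints l).

(* The curves are compact, so that their intersection points are isolated if  *)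
(* and only if there are finitely many of them.                               *)
Record is_drawing : Prop := IsDrawing {
  drawing_graph : graph_drawing (@adj C) (pos D) (ecurve D);
  drawing_region : forall mu, simple_closed_region (region D mu);
  drawing_cluster : forall mu v, region D mu (pos D v) <-> v \in cluster_of mu;
  drawing_nested : forall mu nu,
    ancestor nu mu -> region D mu `<=` region D nu;
  drawing_isolated : forall k l, is_curve k -> is_curve l -> k != l ->
    finite_set (curve k `&` curve l);
  drawing_alternate : forall k l, is_curve k -> is_curve l -> k != l ->
    forall p, crossings k l p -> alternate (curve k) (curve l) p;
  drawing_no_three : forall j k l,
    is_curve j -> is_curve k -> is_curve l -> j != k -> k != l -> j != l ->
    forall p, crossings j k p -> ~ curve l p
}.

Definition edge_edge_crossings : nat :=
  (\sum_(e in edges (@adj C))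
    \sum_(f in edges (@adj C) | enum_rank e < enum_rank f)
      ncard (crossings (inl e) (inl f)))%N.

Definition edge_region_crossings : nat :=
  (\sum_(e in edges (@adj C)) \sum_(mu < ni C)
    (ncard (crossings (inl e) (inr mu)))./2)%N.

(* In a drawing the number of components of R(mu) \ R(nu) is finite, and is   *)
(* the same for (mu, nu) and (nu, mu): each unordered pair is counted once.   *)
Definition region_region_crossings : nat :=
  (\sum_(mu < ni C)
    \sum_(nu < ni C | [&& mu < nu, ~~ ancestor mu nu & ~~ ancestor nu mu])
      (ncard (components (region D mu `\` region D nu))).-1)%N.

Definition abc_drawing (alpha beta gamma : nat) : Prop :=
  [/\ is_drawing, edge_edge_crossings = alpha, edge_region_crossings = beta
    & region_region_crossings = gamma].

End Drawings.

Definition qpoint (R : realType) (p : rat * rat) : plane R :=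
  (ratr p.1, ratr p.2).

Definition segment (R : realType) (p q : plane R) : set (plane R) :=
  [set ((1 - t) * p.1 + t * q.1, (1 - t) * p.2 + t * q.2) | t in `[0, 1]].

Definition chain (R : realType) (s : seq (rat * rat)) : set (plane R) :=
  [set x | exists2 pq, pq \in zip s (behead s)
                     & segment (qpoint R pq.1) (qpoint R pq.2) x].

Arguments chain : clear implicits.

Definition polygon (R : realType) (s : seq (rat * rat)) : set (plane R) :=
  chain R (rcons s (head (0, 0) s)).

Arguments polygon : clear implicits.

Definition pl_represents (R : realType) (C : clustered_graph)
    (P : pl_drawing (nv C) (ni C)) (D : drawing R C) : Prop :=
  [/\ forall v, pos D v = qpoint R (pl_pos P v),
      forall e, e \in edges (@adj C) ->
        ecurve D e = chain R (pl_edge P e.1 e.2)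
    & forall mu, bnd (region D mu) = polygon R (pl_region P mu)].

(* Main.v *)
Require Import Defs.
From mathcomp Require Import all_boot all_order all_algebra.
From mathcomp Require Import zify lra.

(**
The algorithm rests on a combinatorial certificate of planarity: a linear order
of the darts (u, v), u adjacent to v, in which no two vertices and no two edges
alternate.  Such an order exists for every planar graph: a fine grid of cells
has one, obtained by sweeping the grid, the graph is a minor of a fine enough
grid, and contracting an edge transforms an order by rerouting the sweep line
around the edge.  By the Davenport-Schinzel bound the existence of the order
also gives a linear bound on the number of edges.

A certificate can be found by unbounded search, and it can be drawn with the
vertices in any prescribed left-to-right order on the x-axis.  Every dart
becomes a strand that runs from the right end of the picture to the left end at
a height given by its position in the order, turns back, and reaches its vertex;
the vertices are avoided by shifting the heights, the turns at the left are
nested since no two vertices alternate, the turns at the right, which join the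
two darts of an edge, are nested since no two edges alternate.

If the vertices are ordered so that every cluster is contiguous, then the
clusters can be drawn as thin rectangles around the x-axis, nested or disjoint.
The vertical sides are never crossed, and each of the four strands of an edge
crosses a horizontal side of the rectangle of a cluster mu at most once in each
of |mu| gaps between consecutive vertices; so an edge crosses it at most 8|mu|
times.  The sum of |mu| over all clusters is at most n(n + 1), since the clusters
containing a given vertex form a chain, and it is at most 2n in a flat
clustered graph.
*)

Set Implicit Arguments.
Unset Strict Implicit.
Unset Printing Implicit Defensive.

(** * Words without alternations *)

Section Noncrossing.
Variable T : eqType.
Implicit Types (s t : seq T) (a b : T).

(** [nc] is the Davenport-Schinzel condition of order two, with immediate repetitions allowed; read
    cyclically, it says that a partition of points on a circle is noncrossing. Two such conditions
    on one word describe a planar map drawn on the two discs bounded by a closed curve. From there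
    on planarity is handled combinatorially: topology only proves that some certificate exists, so
    that the search ends, while the search itself sees nothing but the coded input and checks
    bounded quantifiers. The order of the vertices on the x-axis is free because the heights of the
    strands carry the planar structure. Sliding a vertex along the axis only changes the abscissa at
    which it separates the strands above it from those below it. This decouples the drawing of the
    graph from the order that the clusters impose. All coordinates are integers, since the code of a
    rational number is that of its reduced fraction and no gcd should have to be computed. *)

Definition nc s := forall a b, subseq [:: a; b; a; b] s -> a = b.

Lemma subseq_cat_split s1 s2 t : subseq t (s1 ++ s2) ->
  exists t1 t2, [/\ t = t1 ++ t2, subseq t1 s1 & subseq t2 s2].
Proof.
case/subseqP=> m sz_m ->; exists (mask (take (size s1) m) s1).
exists (mask (drop (size s1) m) s2); rewrite !mask_subseq; split=> //.
rewrite -{1}(cat_take_drop (size s1) m) mask_cat // size_take sz_m size_cat.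
by case: ltnP => //; lia.
Qed.

Lemma subseq4_cat s1 s2 a b c d : subseq [:: a; b; c; d] (s1 ++ s2) ->
  [\/ subseq [:: a; b; c; d] s2,
      subseq [:: a] s1 /\ subseq [:: b; c; d] s2,
      subseq [:: a; b] s1 /\ subseq [:: c; d] s2 |
      subseq [:: a; b; c] s1 /\ subseq [:: d] s2 \/
      subseq [:: a; b; c; d] s1].
Proof.
case/subseq_cat_split=> t1 [t2 [Et s1t s2t]].
case: t1 Et s1t => [|x1 [|x2 [|x3 [|x4 [|x5 t1]]]]] //=.
- by move=> Et _; constructor 1; rewrite Et.
- by case=> -> -> s1t; constructor 2.
- by case=> -> -> -> s1t; constructor 3.
- by case=> -> -> -> -> s1t; constructor 4; left.
- by case=> -> -> -> -> _ s1t; constructor 4; right.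
Qed.

Lemma nc_subseq s t : subseq s t -> nc t -> nc s.
Proof. by move=> st nct a b /subseq_trans/(_ st)/nct. Qed.

(** A rotation turns a pattern [a b a b] into itself or into [b a b a]. So the condition concerns
    the cyclic word, and the closed curve can be cut wherever it is convenient. *)
Lemma nc_rot s1 s2 : nc (s1 ++ s2) -> nc (s2 ++ s1).
Proof.
move=> nc12 a b /subseq4_cat[st|[s1t s2t]|[s1t s2t]|[[s1t s2t]|st]].
- exact/nc12/(subseq_trans st)/prefix_subseq.
- by apply/esym/nc12; rewrite -[[:: b; a; b; a]]/([:: b; a; b] ++ [:: a]) cat_subseq.
- by apply/nc12; rewrite -[[:: a; b; a; b]]/([:: a; b] ++ [:: a; b]) cat_subseq.
- by apply/esym/nc12; rewrite -[[:: b; a; b; a]]/([:: b] ++ [:: a; b; a]) cat_subseq.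
- exact/nc12/(subseq_trans st)/suffix_subseq.
Qed.

Lemma mem_subseq4 s a b c d : subseq [:: a; b; c; d] s ->
  [/\ a \in s, b \in s, c \in s & d \in s].
Proof. by move/mem_subseq=> sub; split; apply: sub; rewrite !inE eqxx ?orbT. Qed.

Lemma mem_subseq3 s a b c : subseq [:: a; b; c] s ->
  [/\ a \in s, b \in s & c \in s].
Proof. by move/mem_subseq=> sub; split; apply: sub; rewrite !inE eqxx ?orbT. Qed.

Lemma mem_subseq2 s a b : subseq [:: a; b] s -> a \in s /\ b \in s.
Proof. by move/mem_subseq=> sub; split; apply: sub; rewrite !inE eqxx ?orbT. Qed.

Lemma nc_cat s1 s2 :
  nc s1 -> nc s2 -> (forall x, x \in s1 -> x \in s2 -> False) -> nc (s1 ++ s2).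
Proof.
move=> nc1 nc2 dis a b /subseq4_cat[st|[s1t s2t]|[s1t s2t]|[[s1t s2t]|st]].
- exact: nc2.
- rewrite sub1seq in s1t; have [_ as2 _] := mem_subseq3 s2t.
  by case: (dis a).
- by have [a1 _] := mem_subseq2 s1t; have [a2 _] := mem_subseq2 s2t; case: (dis a).
- rewrite sub1seq in s2t; have [_ bs1 _] := mem_subseq3 s1t.
  by case: (dis b).
- exact: nc1.
Qed.

(** After a rotation the inserted block stands at the end, where [nc_cat] applies. *)
Lemma nc_nest s1 s2 s3 : nc (s1 ++ s3) -> nc s2 ->
  (forall x, x \in s1 ++ s3 -> x \in s2 -> False) -> nc (s1 ++ s2 ++ s3).
Proof.
move=> nc13 nc2 dis; rewrite catA; apply/nc_rot; rewrite catA.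
by apply: nc_cat => //; [apply: nc_rot | move=> x; rewrite mem_cat orbC -mem_cat => /dis].
Qed.

Lemma nc_rcons_fresh s x : nc s -> x \notin s -> nc (rcons s x).
Proof.
move=> ncs xs; rewrite -cats1; apply: nc_cat => // [a b /size_subseq //|y ys].
by rewrite inE => /eqP yx; rewrite -yx ys in xs.
Qed.

(** The two adjacent copies of [x] cannot both take part in an alternation, so the new one can be
    replaced by the old one. *)
Lemma nc_rcons_last s x : nc (rcons s x) -> nc (rcons (rcons s x) x).
Proof.
move=> ncs a b; rewrite -cats1 => /subseq4_cat[|[_]|[_]|[[s1t s2t]|st]]; last exact: ncs.
- by move/size_subseq.
- by move/size_subseq.
- by move/size_subseq.
rewrite sub1seq inE in s2t; rewrite (eqP s2t) in s1t *.
rewrite -cats1 in s1t; case/subseq_cat_split: s1t => t1 [t2 [Et s1t s2t']].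
have [t20|t2x] : t2 = [::] \/ t2 = [:: x].
- case: t2 s2t' {Et} => [|y [|z t]] s2t'; first by left.
    by right; move: s2t'; rewrite sub1seq inE => /eqP->.
  by have := size_subseq s2t'.
- apply: ncs; rewrite -cats1 -[[:: a; _; _; _]]/([:: a; x; a] ++ [:: x]).
  by apply: cat_subseq => //; rewrite Et t20 cats0.
- by case: t1 Et {s1t} => [|?[|?[|?[|? ?]]]]; rewrite t2x //= => -[_ _ ->].
Qed.

Lemma nc_cons_rcons x s : nc s -> x \notin s -> nc (x :: rcons s x).
Proof.
move=> ncs xs; rewrite -cats1 -[x :: _]/([:: x] ++ (s ++ [:: x])).
apply: nc_nest => // [a b /size_subseq //|y]; rewrite !inE orbb => /eqP-> xs'.
by rewrite xs' in xs.
Qed.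

Lemma mem_first a s : a \in s ->
  exists s1 s2, s = s1 ++ a :: s2 /\ a \notin s1.
Proof.
elim: s => //= x s IHs; have [->|ax] := eqVneq a x; first by exists [::], s.
rewrite inE (negbTE ax) => /IHs[s1 [s2 [-> as1]]].
by exists (x :: s1), s2; rewrite inE (negbTE ax).
Qed.

(** The Davenport-Schinzel bound. If the first letter [a] recurs, the word is [a s1 a s2] with [s1]
    free of [a]; the alphabets of [s1] and [a s2] are disjoint, and the two bounds with the leading
    [a] add up to 1 + (2i - 1) + (2j - 1) = 2(i + j) - 1. Otherwise [a] costs one letter of the
    alphabet and one position. *)
Lemma nc_size s : nc s -> sorted (fun x y => x != y) s ->
  size s <= (size (undup s)).*2.-1.
Proof.
move: {2}(size s) (leqnn (size s)) => m; elim: m s => [|m IHm] [|a s] //.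
move=> szs nca srt; have {}szs : size s <= m by [].
have [as_|as_] := boolP (a \in s); last first.
  have ncs : nc s by apply: nc_subseq nca; apply: subseq_cons.
  have := IHm s szs ncs (path_sorted srt).
  rewrite /= (negbTE as_) /=; case: s {IHm szs nca srt as_ ncs} => //= x s.
  by case: ifP => /=; lia.
have [s1 [s2 [Es as1]]] := mem_first as_; subst s.
have /and3P[srt1 lst srt2] : [&& path (fun x y => x != y) a s1, last a s1 != a
    & path (fun x y => x != y) a s2] by move: srt; rewrite /= cat_path.
have nz : 0 < size s1 by case: (s1) lst => //=; rewrite eqxx.
(* A common letter would alternate with [a]: leading [a], letter in [s1], second [a], letter in
   [s2]. *)
have dis x : x \in s1 -> x \in a :: s2 -> False.
  move=> x1; rewrite inE => /predU1P[xa|x2]; first by rewrite -xa x1 in as1.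
  have := nca a x; rewrite /= eqxx => ax; rewrite ax ?x1 // in as1.
  rewrite -[[:: x; a; x]]/([:: x] ++ [:: a; x]); apply: cat_subseq.
    by rewrite sub1seq.
  by rewrite /= eqxx sub1seq.
have nc1 : nc s1 by apply: nc_subseq nca; rewrite -cat_cons -cat_rcons; apply: subseq_trans (prefix_subseq _ _); rewrite -cats1; apply: subseq_trans (prefix_subseq _ _); apply: subseq_cons.
have nc2 : nc (a :: s2) by apply: nc_subseq nca; rewrite -cat_cons; exact: suffix_subseq.
have undup_gt0 x t : x \in t -> 0 < size (undup t).
  by rewrite -mem_undup; case: (undup t).
have {nz}: 0 < size (undup s1).
  by case: (s1) nz => // x t _; apply: (undup_gt0 x); rewrite mem_head.
rewrite size_cat /= in szs.
have sz1 : size s1 <= m by lia.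
have sz2 : size (a :: s2) <= m by rewrite /=; lia.
have := IHm s1 sz1 nc1 (path_sorted srt1); have := IHm (a :: s2) sz2 nc2 srt2.
have -> : undup (a :: s1 ++ a :: s2) = undup (s1 ++ a :: s2).
  by rewrite /= mem_cat mem_head orbT.
rewrite undup_cat size_cat.
have /all_filterP -> : all (fun x => x \notin a :: s2) (undup s1).
  by apply/allP=> x; rewrite mem_undup => x1; apply/negP => /(dis x x1).
have := undup_gt0 a (a :: s2) (mem_head _ _).
rewrite -[size (a :: s1 ++ _)]/(size (s1 ++ a :: s2)).+1 size_cat.
move: (size (undup (a :: s2))) (size (a :: s2)) (size s1) (size (undup s1)) => *.
lia.
Qed.

End Noncrossing.

Lemma nc_map_inj (T U : eqType) (f : T -> U) (s : seq T) :
  {in s &, injective f} -> nc s -> nc (map f s).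
Proof.
move=> injf ncs a b /subseqP[m sz_m Em]; have Es := map_mask f m s.
rewrite -Em in Es; have : subseq (mask m s) s by exact: mask_subseq.
case: (mask m s) Es => [|x [|y [|z [|t [|? ?]]]]] //= [Ea Eb Ea' Eb'] sub.
have [xs ys zs ts] := mem_subseq4 sub.
have xz : x = z by apply: injf => //; rewrite Ea Ea'.
have yt : y = t by apply: injf => //; rewrite Eb Eb'.
by rewrite -Ea -Eb (ncs x y) // {2}xz {2}yt.
Qed.

(** The cut is made right after the last [u], so [Y] is empty or ends with [u]. The last clause is
    the form used later: a letter of [Y] that occurs again further on alternates with [u]. *)
Lemma split_last_in (T : eqType) (u : T) (A : seq T) : exists Y Z,
  [/\ A = Y ++ Z, u \notin Z & forall b, b \in Y -> b = u \/ subseq [:: b; u] Y].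
Proof.
elim/last_ind: A => [|A x [Y [Z [-> uZ uY]]]]; first by exists [::], [::].
have [->|xu] := eqVneq x u.
  exists (rcons (Y ++ Z) u), [::]; rewrite cats0; split=> // b.
  rewrite mem_rcons inE => /predU1P[->|bYZ]; [by left | right].
  by rewrite -cats1 -[[:: b; u]]/([:: b] ++ [:: u]) cat_subseq // sub1seq.
exists Y, (rcons Z x); rewrite rcons_cat; split=> //.
by rewrite mem_rcons inE negb_or eq_sym xu.
Qed.

Lemma split_first_in (T : eqType) (u : T) (A : seq T) : exists Z X,
  [/\ A = Z ++ X, u \notin Z & forall b, b \in X -> b = u \/ subseq [:: u; b] X].
Proof.
have [Y [Z [EA uZ uY]]] := split_last_in u (rev A).
exists (rev Z), (rev Y); split; last first.
- move=> b; rewrite mem_rev => /uY[->|]; [by left | right].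
  by rewrite -[[:: u; b]]/(rev [:: b; u]) subseq_rev.
- by rewrite mem_rev.
- by rewrite -rev_cat -EA revK.
Qed.

(** * Words as planar maps, and the contraction of an edge *)

Section Words.
Variables T K : eqType.
Implicit Types (w : seq (T * K)) (u v : T) (k : K).

(* A word encodes a planar map: cutting the sphere along a closed curve, the  *)
(* positions with first component u are tied together on one side into the    *)
(* vertex u, the two positions with second component k are joined on the      *)
(* other side by the edge k.                                                  *)
Definition word w :=
  [/\ nc (map fst w), nc (map snd w) & forall k, count_mem k (map snd w) <= 2].

Lemma word_filter p w : word w -> word (filter p w).
Proof.
have sub (U : eqType) (f : T * K -> U) :
    subseq (map f (filter p w)) (map f w) by rewrite map_subseq ?filter_subseq.
case=> nc1 nc2 cnt; split; [exact: nc_subseq nc1 | exact: nc_subseq nc2 |].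
by move=> k; apply: leq_trans (cnt k); apply: leq_count_subseq.
Qed.

Lemma map_cat_split (A : seq (T * K)) (y z : seq T) : map fst A = y ++ z ->
  exists Y Z, [/\ A = Y ++ Z, map fst Y = y & map fst Z = z].
Proof.
move=> EA; exists (take (size y) A), (drop (size y) A).
by rewrite cat_take_drop map_take map_drop EA take_size_cat // drop_size_cat.
Qed.

(* The closed curve is rerouted around the two sides of the edge k. *)
Lemma nc_contract_fst (u v : T) (y z z' x : seq T) : u != v ->
  nc (u :: y ++ z ++ v :: z' ++ x) -> u \notin z -> u \notin z' ->
  (forall b, b \in y -> b = u \/ subseq [:: b; u] y) ->
  (forall b, b \in x -> b = u \/ subseq [:: u; b] x) ->
  nc [seq if t == v then u else t | t <- y ++ x ++ z' ++ z].
Proof.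
move=> uv ncw uz uz' uy ux.
(* A letter [b] of [y] lies between the leading [u] and a later [u] of [y], so another [b] between
   [z] and [z'] would complete [u b u b]. A letter of [x] is preceded by a [u] in [x], and the same
   pattern arises with the leading [u]. *)
have dis b : b \in y ++ x -> b \in v :: z' ++ z -> b = u.
  move=> byx bz; have {}bz : b \in z ++ v :: z'.
    by move: bz; rewrite !(mem_cat, inE); do !case: (_ \in _); case: (_ == _).
  move: byx; rewrite mem_cat => /orP[/uy|/ux] [//|sub]; apply/esym/ncw.
    rewrite /= eqxx -[[:: b; u; b]]/([:: b; u] ++ [:: b]) cat_subseq // sub1seq.
    by move: bz; rewrite !(mem_cat, inE); do !case: (_ \in _); case: (_ == _).
  rewrite /= eqxx -[[:: b; u; b]]/([:: b] ++ [:: u; b]).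
  apply: (@subseq_trans _ (z ++ v :: z' ++ x)); last exact: suffix_subseq.
  by rewrite -cat_cons catA cat_subseq // sub1seq.
have ncP : nc (u :: y ++ x).
  apply: nc_subseq ncw; rewrite /= eqxx; apply: cat_subseq => //.
  by rewrite -cat_cons catA suffix_subseq.
have ncQ : nc (z' ++ rcons z v).
  apply: nc_rot; rewrite cat_rcons; apply: nc_subseq ncw.
  apply: subseq_trans (subseq_cons _ _); apply: subseq_trans (suffix_subseq y _).
  by rewrite -cat_cons catA prefix_subseq.
have vP : v \notin y ++ x.
  by apply: contra uv => /dis -> //; rewrite mem_head.
have uQ : u \notin z' ++ z by rewrite mem_cat negb_or uz uz'.
set f := (fun t => _).
have fP : map f (y ++ x) = y ++ x.
  by apply: map_id_in => t tP; rewrite /f; case: eqP tP vP => // -> ->.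
have fQ b : b \in map f (z' ++ z) -> b \in y ++ x -> b = u.
  case/mapP=> t tQ; rewrite /f; case: eqP => // _ -> tP.
  by apply: dis tP _; rewrite inE tQ orbT.
have ncfQ : nc (map f (z' ++ z)).
  apply: nc_map_inj; last by apply: nc_subseq ncQ; rewrite -cats1 catA prefix_subseq.
  move=> s t sQ tQ; rewrite /f; case: (eqVneq s v) => [->|_]; case: (eqVneq t v) => [->|_] //.
    by move=> ut; rewrite ut tQ in uQ.
  by move=> us; rewrite -us sQ in uQ.
rewrite catA map_cat fP => a b.
case/subseq4_cat => [|[aP sub]|[/mem_subseq2[aP bP] /mem_subseq2[aQ bQ]]|[[sub bQ]|sub]].
- exact: ncfQ.
- rewrite sub1seq in aP; have [_ aQ _] := mem_subseq3 sub.
  (* Here [u] is in the first half and [b u b] in the second. As [u] does not occur in [z' ++ z],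
     this middle letter is a renamed [v], and the [v] that ends [rcons z v] completes an alternation
     of [b] and [v]. *)
  have au := fQ _ aQ aP; subst a; apply/eqP/negPn/negP=> ub.
  move/subseqP: sub => [m szm Em]; have Es := map_mask f m (z' ++ z).
  rewrite -Em in Es; have : subseq (mask m (z' ++ z)) (z' ++ z) by exact: mask_subseq.
  case: (mask m _) Es => [|t1 [|t2 [|t3 []]]] //= [E1 E2 E3] sub.
  have [t1Q t2Q t3Q] := mem_subseq3 sub.
  have t2v : t2 = v.
    by move: E2; rewrite /f; case: eqP => // _ t2u; rewrite -t2u t2Q in uQ.
  have t1b : t1 = b.
    by move: E1; rewrite /f; case: eqP => // _ ub'; rewrite ub' eqxx in ub.
  have t3b : t3 = b.
    by move: E3; rewrite /f; case: eqP => // _ ub'; rewrite ub' eqxx in ub.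
  rewrite t1b t2v t3b in sub; have bv : b = v.
    apply: ncQ; rewrite -cats1 catA -[[:: b; v; b; v]]/([:: b; v; b] ++ [:: v]).
    exact: cat_subseq.
  by move: E1; rewrite t1b /f bv eqxx => ub'; rewrite ub' eqxx in uv.
- by rewrite (fQ a) // (fQ b).
- rewrite sub1seq in bQ; have [_ bP _] := mem_subseq3 sub.
  by have bu := fQ _ bQ bP; subst b; apply/esym/ncP; rewrite /= eqxx.
- by apply: ncP; apply: subseq_trans sub (subseq_cons _ _).
Qed.

(** An edge occurring on both sides of the second [k] would alternate with [k]. So the two stretches
    have disjoint alphabets, and the rotated second one nests inside the first. *)
Lemma nc_contract_snd (k : K) (y z z' x : seq K) :
  nc (k :: y ++ z ++ k :: z' ++ x) -> k \notin y ++ z -> k \notin z' ++ x ->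
  nc (y ++ x ++ z' ++ z).
Proof.
move=> ncw kyz kzx; rewrite (catA x); apply: nc_nest.
- apply: nc_subseq ncw; rewrite catA; apply: subseq_trans (subseq_cons _ _).
  exact: prefix_subseq.
- apply: nc_rot; apply: nc_subseq ncw; rewrite catA.
  apply: subseq_trans (subseq_cons _ _); apply: subseq_trans (suffix_subseq _ _).
  exact: subseq_cons.
- move=> b b1; rewrite mem_cat orbC -mem_cat => b2; move/negP: kyz; apply.
  suff -> : k = b by []; apply: ncw; rewrite /= eqxx catA.
  rewrite -[[:: b; k; b]]/([:: b] ++ [:: k; b]) cat_subseq ?sub1seq //.
  by rewrite /= eqxx sub1seq.
Qed.

(** A rotation puts [(u, k)] in front; the other end of [k] then separates the rest into [A] and
    [C]. [A] is cut after its last [u], [C] before its first [u], and the four pieces are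
    reassembled in the order [Y X Z' Z]. Edges parallel to [k] survive as loops. *)
Lemma contract w u v k :
  word w -> (u, k) \in w -> (v, k) \in w -> u != v ->
  exists w', [/\ word w',
    forall x j, (x, j) \in w -> j != k -> (if x == v then u else x, j) \in w' &
    forall p, p \in w' ->
      exists2 q, q \in w & p = (if q.1 == v then u else q.1, q.2)].
Proof.
move=> ww uk vk uv; have [r [ww' mr perm_r]] : exists r, [/\ word ((u, k) :: r),
    (u, k) :: r =i w & perm_eq ((u, k) :: r) w].
  case/splitPr: uk ww {vk} => w1 w2 [nc1 nc2 cnt]; exists (w2 ++ w1).
  have pe : perm_eq ((u, k) :: w2 ++ w1) (w1 ++ (u, k) :: w2).
    by rewrite -cat_cons perm_catC.
  split=> //; last exact: perm_mem.
  split.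
  - by rewrite -cat_cons map_cat; apply: nc_rot; rewrite -map_cat.
  - by rewrite -cat_cons map_cat; apply: nc_rot; rewrite -map_cat.
  - by move=> j; rewrite (permP (perm_map snd pe)).
have {}vk : (v, k) \in r.
  by move: vk; rewrite -mr inE xpair_eqE eq_sym (negbTE uv).
case/splitPr: vk ww' mr perm_r => A C ww' mr perm_r.
have [y [z [EA uz uy]]] := split_last_in u (map fst A).
have [Y [Z [EA' EY EZ]]] := map_cat_split EA.
have [z' [x [EC uz' ux]]] := split_first_in u (map fst C).
have [Z' [X [EC' EZ' EX]]] := map_cat_split EC.
have pe : perm_eq (A ++ C) (Y ++ X ++ Z' ++ Z).
  by rewrite EA' EC' -catA perm_cat2l perm_sym catA perm_catC perm_cat2l perm_catC.
case: ww'; rewrite /= !map_cat /= => nc1 nc2 cnt.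
(* The two removed positions exhaust the at most two occurrences of [k]. *)
have kAC : k \notin map snd (A ++ C).
  have := cnt k; rewrite /= count_cat /= !eqxx map_cat mem_cat negb_or.
  by rewrite -!has_pred1 !has_count; lia.
exists [seq (if q.1 == v then u else q.1, q.2) | q <- Y ++ X ++ Z' ++ Z]; split.
- split.
  + rewrite -map_comp -[fst \o _]/((fun t => if t == v then u else t) \o fst).
    rewrite map_comp !map_cat EX EY EZ EZ' -!map_cat; apply: nc_contract_fst => //.
    by move: nc1; rewrite EA EC -catA.
  + rewrite -map_comp -[snd \o _]/(snd : T * K -> K) !map_cat.
    move: nc2 kAC; rewrite EA' EC' !map_cat -!catA => nc2.
    rewrite !mem_cat !negb_or => /and4P[kY kZ kZ' kX].
    by apply: (nc_contract_snd nc2); rewrite mem_cat negb_or; apply/andP.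
  + move=> j; rewrite -map_comp -[snd \o _]/(snd : T * K -> K).
    rewrite -(permP (perm_map snd pe)) map_cat count_cat.
    by have := cnt j; rewrite /= count_cat /=; lia.
- move=> t j; rewrite -mr !(mem_cat, inE) => tj jk.
  apply/mapP; exists (t, j) => //; rewrite -(perm_mem pe).
  move: tj; rewrite !xpair_eqE (negbTE jk) !andbF /= => /orP[]; by rewrite mem_cat => ->; rewrite ?orbT.
- move=> p /mapP[q qw ->]; exists q => //; rewrite -mr !(mem_cat, inE).
  by move: qw; rewrite -(perm_mem pe) mem_cat => /orP[]->; rewrite ?orbT.
Qed.
End Words.

Lemma nc_map_eq (T U V : eqType) (f : T -> U) (g : T -> V) (s : seq T) :
  {in s &, forall x y, g x = g y <-> f x = f y} -> nc (map f s) -> nc (map g s).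
Proof.
move=> fg ncf a b /subseqP[m sz_m Em]; have Es := map_mask g m s.
rewrite -Em in Es; have := mask_subseq m s.
case: (mask m s) Es => [|x [|y [|z [|t [|? ?]]]]] //= [Ea Eb Ea' Eb'] sub.
have [xs ys zs ts] := mem_subseq4 sub.
have xz : f x = f z by apply/fg => //; rewrite Ea Ea'.
have yt : f y = f t by apply/fg => //; rewrite Eb Eb'.
rewrite -Ea -Eb; apply/fg => //; apply: ncf.
by rewrite {2}xz {2}yt -[[:: f x; f y; f z; f t]]/(map f [:: x; y; z; t]) map_subseq.
Qed.

(** * Minors of words *)

Section Minor.
Variables T K : eqType.
Implicit Types (w : seq (T * K)) (k : K).

Lemma word_two w x y z k : word w -> (x, k) \in w -> (y, k) \in w ->
  (z, k) \in w -> x != y -> z = x \/ z = y.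
Proof.
case=> _ _ /(_ k); rewrite count_map => cnt xk yk zk xy.
have [->|zx] := eqVneq z x; first by left.
have [->|zy] := eqVneq z y; first by right.
have uq : uniq [:: (x, k); (y, k); (z, k)].
  by rewrite /= !inE !xpair_eqE eqxx !andbT negb_or xy ![_ == z]eq_sym zx zy.
suff: size [:: (x, k); (y, k); (z, k)] <= 2 by [].
apply: leq_trans cnt; rewrite -size_filter; apply: uniq_leq_size => // p.
by rewrite !inE mem_filter /= => /or3P[]/eqP->; rewrite /= eqxx ?xk ?yk ?zk.
Qed.

(** [psi] composes the renamings of successive contractions. An edge is contracted only if its ends
    differ and have the same label; hence renaming preserves labels, and an edge between different
    labels never disappears. *)
Lemma contract_all (V : eqType) (lab : T -> V) (ks : seq K) w : word w ->
  exists w' (psi : T -> T), [/\ word w', forall x, lab (psi x) = lab x,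
    forall x y k, (x, k) \in w -> (y, k) \in w -> lab x <> lab y ->
      (psi x, k) \in w' /\ (psi y, k) \in w',
    forall x y k, k \in ks -> (x, k) \in w -> (y, k) \in w -> lab x = lab y ->
      psi x = psi y &
    forall p, p \in w' -> exists2 q, q \in w & p = (psi q.1, q.2)].
Proof.
elim: ks w => [|k ks IHks] w ww.
  by exists w, id; split=> // -[x k] xw; exists (x, k).
case: (boolP (has (fun p => has (fun q =>
    [&& p.2 == k, q.2 == k, p.1 != q.1 & lab p.1 == lab q.1]) w) w)); last first.
  move=> nh; have [w' [psi [ww' lpsi surv merg org]]] := IHks _ ww.
  exists w', psi; split=> // x y j; rewrite inE => /predU1P[->|]; last exact: merg.
  move=> xk yk lxy; apply: congr1; apply/eqP/negPn/negP=> xy; case/negP: nh.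
  by apply/hasP; exists (x, k) => //; apply/hasP; exists (y, k); rewrite //= !eqxx xy lxy eqxx.
case/hasP=> -[u j] uk /hasP[[v j'] vk] /= /and4P[/eqP ? /eqP ? uv /eqP luv]; subst j j'.
have [w1 [ww1 surv1 org1]] := contract ww uk vk uv.
have [w' [psi [ww' lpsi surv merg org]]] := IHks _ ww1.
pose phi x := if x == v then u else x.
have lphi x : lab (phi x) = lab x by rewrite /phi; case: eqP => // ->.
exists w', (psi \o phi); split=> //=.
- by move=> x; rewrite lpsi lphi.
- move=> x y j xj yj lxy.
  have jk : j != k.
    apply/eqP=> jk; rewrite jk in xj yj.
    by case: (word_two ww uk vk xj uv) lxy => ->; case: (word_two ww uk vk yj uv) => ->; rewrite ?luv.
  by apply: surv; rewrite ?lphi //; apply: surv1.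
- move=> x y j; rewrite inE => /orP[/eqP->|jks] xj yj lxy.
    congr psi; rewrite /phi; case: (word_two ww uk vk xj uv) => ->;
    by case: (word_two ww uk vk yj uv) => ->; rewrite ?eqxx ?(negbTE uv).
  have [jk|jk] := eqVneq j k; last by apply: (merg _ _ j); rewrite ?lphi //; apply: surv1.
  subst j; congr psi; rewrite /phi; case: (word_two ww uk vk xj uv) => ->;
  by case: (word_two ww uk vk yj uv) => ->; rewrite ?eqxx ?(negbTE uv).
- move=> p /org[q /org1[r rw ->] ->]; by exists r.
Qed.

(** The second hypothesis says that the label classes are connected: a function that agrees on the
    two ends of every inner edge is constant on each class. This form applies directly to the
    renaming made by the contractions. *)
Lemma minor_word (V : eqType) (lab : T -> V) w : word w ->
  (forall psi : T -> T,
    (forall x y k, (x, k) \in w -> (y, k) \in w -> lab x = lab y ->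
      psi x = psi y) ->
    forall x y, x \in map fst w -> y \in map fst w -> lab x = lab y ->
      psi x = psi y) ->
  exists w' : seq (V * K), word w' /\
    forall x y k, (x, k) \in w -> (y, k) \in w -> lab x <> lab y ->
      (lab x, k) \in w' /\ (lab y, k) \in w'.
Proof.
move=> ww conn; have [w' [psi [ww' lpsi surv merg org]]] :=
  contract_all lab (map snd w) ww.
have {}conn x y : x \in map fst w -> y \in map fst w -> lab x = lab y -> psi x = psi y.
  apply: conn => a b k ak bk; apply: (merg _ _ k) => //.
  by apply/mapP; exists (a, k).
exists [seq (lab p.1, p.2) | p <- w']; split; last first.
  move=> x y k xk yk lxy; have [xk' yk'] := surv x y k xk yk lxy.
  by split; apply/mapP; [exists (psi x, k) | exists (psi y, k)]; rewrite //= lpsi.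
case: ww' => nc1 nc2 cnt; split.
- rewrite -map_comp -[fst \o _]/(lab \o fst) map_comp; apply: nc_map_inj nc1.
  move=> x y /mapP[p /org[q qw ->] ->] /mapP[p' /org[q' qw' ->] ->] /=.
  by rewrite !lpsi; apply: conn; apply: map_f.
- by rewrite -map_comp -[snd \o _]/(snd : T * K -> K).
- by move=> k; rewrite -map_comp -[snd \o _]/(snd : T * K -> K).
Qed.
End Minor.

(** * From words to orders of the darts *)

Definition edge_of (d : nat * nat) := (minn d.1 d.2, maxn d.1 d.2).

Definition dart_order (adj : rel nat) (wd : seq (nat * nat)) :=
  [/\ uniq wd, forall d, (d \in wd) = adj d.1 d.2, nc (map fst wd)
    & nc (map edge_of wd)].

Lemma edge_of_eq a b c d : (edge_of (a, b) = edge_of (c, d)) <->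
  (a = c /\ b = d) \/ (a = d /\ b = c).
Proof.
rewrite /edge_of /=; split; first by case; lia.
by case=> -[-> ->] //; rewrite minnC maxnC.
Qed.

Lemma map_pmap_subseq (S U V : eqType) (g : S -> option U) (f : S -> V)
    (h : U -> V) (s : seq S) :
  (forall p d, g p = Some d -> h d = f p) -> subseq (map h (pmap g s)) (map f s).
Proof.
move=> gh; elim: s => //= p s IHs; case Ep: (g p) => [d|] /=.
  by rewrite (gh _ _ Ep) eqxx.
exact: subseq_trans IHs (subseq_cons _ _).
Qed.

(** The word may contain parallel edges, loops and edges foreign to the graph. One key is selected
    for each edge of the graph and all other positions are dropped, which preserves [nc]. *)
Lemma word_dart_order (K : eqType) (adj : rel nat) (D : seq (nat * nat))
    (w : seq (nat * K)) :
  symmetric adj -> irreflexive adj -> (forall d, (d \in D) = adj d.1 d.2) ->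
  word w ->
  (forall u v, adj u v -> exists k, (u, k) \in w /\ (v, k) \in w) ->
  exists wd, dart_order adj wd.
Proof.
move=> adjC adjI DE ww real; have [nc1 nc2 cnt] := ww.
have [D0|[u0 [v0 uv0]]] : D = [::] \/ exists u v, adj u v.
  case: D DE => [|[u v] D] DE; first by left.
  by right; exists u, v; rewrite -(DE (u, v)) mem_head.
  exists [::]; split=> //; try by move=> a b /size_subseq.
  by move=> d; rewrite -DE D0.
have [k0 _] := real _ _ uv0.
(* The first common key in the order of [w]. The choice is symmetric in the two ends, so both darts
   of an edge receive the same key; the default [k0] is harmless, as a common key exists for every
   edge. *)
pose kof (d : nat * nat) :=
  head k0 [seq k <- map snd w | ((d.1, k) \in w) && ((d.2, k) \in w)].
have kofP d : adj d.1 d.2 -> (d.1, kof d) \in w /\ (d.2, kof d) \in w.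
  move=> /real[k [k1 k2]]; rewrite /kof.
  have : k \in [seq k <- map snd w | ((d.1, k) \in w) && ((d.2, k) \in w)].
    by rewrite mem_filter k1 k2; apply/mapP; exists (d.1, k).
  set ks := filter _ _; have : all (fun k => ((d.1, k) \in w) && ((d.2, k) \in w)) ks.
    by apply/allP=> j; rewrite mem_filter => /andP[].
  by case: ks => //= j js /andP[/andP[]].
have kofC u v : kof (u, v) = kof (v, u).
  by rewrite /kof /=; congr head; apply: eq_filter => k; rewrite andbC.
have adjn u v : adj u v -> u != v by case: eqP => // ->; rewrite adjI.
(* A key occurs at most twice, so it determines the pair of vertices that it joins. *)
have kof_inj d e : adj d.1 d.2 -> adj e.1 e.2 -> kof d = kof e ->
    edge_of d = edge_of e.
  case: d e => a b [c d] /= ab cd Ek; apply/edge_of_eq.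
  have [/= ka kb] := kofP (a, b) ab; have [/= kc kd] := kofP (c, d) cd.
  rewrite -Ek in kc kd; have := adjn _ _ cd; have ab' := adjn _ _ ab.
  case: (word_two ww ka kb kc ab') => ->; case: (word_two ww ka kb kd ab') => ->;
  by rewrite ?eqxx // => _; ((by left) || (by right)).
pose g (p : nat * K) := ohead [seq d <- D | (d.1 == p.1) && (kof d == p.2)].
have gP p d : g p = Some d -> [/\ adj d.1 d.2, d.1 = p.1 & kof d = p.2].
  rewrite /g; set ds := filter _ _.
  have : all (fun d => [&& (d.1 == p.1), (kof d == p.2) & d \in D]) ds.
    by apply/allP=> j; rewrite mem_filter -andbA.
  by case: ds => //= e es /andP[/and3P[/eqP e1 /eqP e2 eD] _] [<-]; rewrite -DE.
have gD d : adj d.1 d.2 -> g (d.1, kof d) = Some d.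
  move=> ad; have : d \in [seq e <- D | (e.1 == d.1) && (kof e == kof d)].
    by rewrite mem_filter !eqxx DE.
  case Eg : (g (d.1, kof d)) => [e|]; last first.
    by move: Eg; rewrite /g /=; case: (filter _ _).
  move=> _; have [/= ae e1 ke] := gP _ _ Eg.
  congr Some; case: d e ad ae e1 ke {Eg} => [a b] [c d] /= ab cd E1 ke.
  have /edge_of_eq[[-> ->]//|[Ec Ed]] := kof_inj (c, d) (a, b) cd ab ke.
  by move: (adjn _ _ ab); rewrite -E1 Ec eqxx.
have memwd d : (d \in pmap g w) = adj d.1 d.2.
  rewrite mem_pmap; apply/mapP/idP => [[p pw /esym/gP[]] //|ad].
  by exists (d.1, kof d); [case: (kofP d ad) | rewrite gD].
exists (undup (pmap g w)); split.
- exact: undup_uniq.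
- by move=> d; rewrite mem_undup.
- apply: nc_subseq nc1; apply: (@subseq_trans _ (map fst (pmap g w))).
    by rewrite map_subseq ?undup_subseq.
  by apply: map_pmap_subseq => p d /gP[].
- apply: (@nc_map_eq _ _ _ kof).
    move=> [a b] [c d]; rewrite !mem_undup !memwd /= => ab cd; split.
      by move/edge_of_eq=> [[-> ->]//|[-> ->]]; rewrite kofC.
    exact: kof_inj.
  apply: nc_subseq nc2; apply: (@subseq_trans _ (map kof (pmap g w))).
    by rewrite map_subseq ?undup_subseq.
  by apply: map_pmap_subseq => p d /gP[].
Qed.

Lemma iota0S m : iota 0 m.+1 = iota 0 m ++ [:: m].
Proof. by rewrite -addn1 iotaD. Qed.

(** * The word of a sweep over the grid *)

Section Grid.
Local Notation cell := (nat * nat)%type.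
Local Notation gedge := (bool * (nat * nat))%type.

(** The edges are the sides of the cells: [(true, (x, y))] is the lower side of the cell [(x, y)]
    and [(false, (x, y))] its left side. The sweep climbs a column past the lower, left and upper
    side of each cell and descends past the right sides. *)
Definition g_asc x m : seq (cell * gedge) := flatten
  [seq [:: ((x, y), (true, (x, y))); ((x, y), (false, (x, y)));
           ((x, y), (true, (x, y.+1)))] | y <- iota 0 m].
Definition g_desc x m : seq (cell * gedge) :=
  rev [seq ((x, y), (false, (x.+1, y))) | y <- iota 0 m].
Definition grid x m := flatten [seq g_asc i m ++ g_desc i m | i <- iota 0 x].

Lemma g_ascS x m : g_asc x m.+1 = g_asc x m ++
  [:: ((x, m), (true, (x, m))); ((x, m), (false, (x, m)));
      ((x, m), (true, (x, m.+1)))].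
Proof. by rewrite /g_asc iota0S map_cat flatten_cat. Qed.

Lemma g_descS x m : g_desc x m.+1 = ((x, m), (false, (x.+1, m))) :: g_desc x m.
Proof. by rewrite /g_desc iota0S map_cat rev_cat. Qed.

Lemma gridS x m : grid x.+1 m = grid x m ++ g_asc x m ++ g_desc x m.
Proof. by rewrite /grid iota0S map_cat flatten_cat /= cats0. Qed.

Lemma g_asc_mem x m p : p \in g_asc x m -> exists2 y, y < m &
  p \in [:: ((x, y), (true, (x, y))); ((x, y), (false, (x, y)));
           ((x, y), (true, (x, y.+1)))].
Proof. by case/flatten_mapP=> y; rewrite mem_iota => /andP[_ ym] pin; exists y. Qed.

Lemma g_desc_mem x m p : p \in g_desc x m -> exists2 y, y < m &
  p = ((x, y), (false, (x.+1, y))).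
Proof. by rewrite mem_rev => /mapP[y]; rewrite mem_iota => /andP[_ ym] ->; exists y. Qed.

Lemma grid_nc_fst x m : nc (map fst (grid x m)).
Proof.
elim: x => [|x IHx]; first by move=> a b /size_subseq.
rewrite gridS map_cat; apply: nc_cat => //.
- elim: m {IHx} => [|m IHm]; first by move=> a b /size_subseq.
  rewrite g_ascS g_descS -catA map_cat.
  rewrite -[_ ++ _ :: g_desc x m]/(([:: ((x, m), (true, (x, m)));
    ((x, m), (false, (x, m))); ((x, m), (true, (x, m.+1)));
    ((x, m), (false, (x.+1, m)))] : seq (cell * gedge)) ++ g_desc x m).
  rewrite (map_cat fst _ (g_desc x m)); apply: nc_nest.
  + by rewrite -map_cat.
  + by move=> a b /mem_subseq4[]; rewrite !inE !orbb => /eqP-> /eqP->.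
  + move=> c; rewrite -map_cat => /mapP[p]; rewrite mem_cat => pin ->; rewrite !inE !orbb => /eqP Ep.
    case/orP: pin => [/g_asc_mem[y ym]|/g_desc_mem[y ym Ep']].
      by rewrite !inE => /or3P[]/eqP Ep'; move: Ep ym; rewrite Ep' /= => -[->]; rewrite ltnn.
    by move: Ep ym; rewrite Ep' /= => -[->]; rewrite ltnn.
- move=> c /mapP[p /flatten_mapP[i]]; rewrite mem_iota add0n => /= ix pin -> /mapP[q qin Eq].
  have p1 : p.1.1 = i.
    by move: pin; rewrite mem_cat => /orP[/g_asc_mem[y _]|/g_desc_mem[y _ ->]] //; rewrite !inE => /or3P[]/eqP->.
  have q1 : q.1.1 = x.
    by move: qin; rewrite mem_cat => /orP[/g_asc_mem[y _]|/g_desc_mem[y _ ->]] //; rewrite !inE => /or3P[]/eqP->.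
  by move: ix; rewrite -p1 Eq q1 ltnn.
Qed.

(** The sides met while descending one column and climbing the next. They all have first index
    [x.+1], so different valleys share no edge and can be treated separately. *)
Definition valley x m : seq gedge := map snd (g_desc x m ++ g_asc x.+1 m).

Lemma valleyS x m : valley x m.+1 =
  rcons ((false, (x.+1, m)) :: rcons (rcons (valley x m) (true, (x.+1, m)))
    (false, (x.+1, m))) (true, (x.+1, m.+1)).
Proof. by rewrite /valley g_ascS g_descS !map_cat /= -!cats1 -!catA. Qed.

Lemma valley_mem x m k : k \in valley x m ->
  k.2.1 = x.+1 /\ (if k.1 then k.2.2 <= m else k.2.2 < m).
Proof.
case/mapP=> p pin ->; move: pin; rewrite mem_cat.
case/orP=> [/g_desc_mem[y ym ->] //|/g_asc_mem[y ym]].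
by rewrite !inE => /or3P[]/eqP-> //=; split=> //; apply: ltnW.
Qed.

Lemma valley_last x m : exists s, valley x m.+1 = rcons s (true, (x.+1, m.+1)).
Proof. by rewrite valleyS; eexists. Qed.

(** A further row first doubles the last letter, the horizontal side between the rows, then encloses
    everything between two copies of a new vertical side, and finally appends a new letter. *)
Lemma valley_nc x m : nc (valley x m).
Proof.
elim: m => [|m IHm]; first by move=> a b /size_subseq.
rewrite valleyS; apply: nc_rcons_fresh; last first.
  apply/negP; rewrite !(inE, mem_rcons).
  by case/or4P=> [/eqP|/eqP|/eqP[]|/valley_mem[_ /=]] //; lia.
apply: nc_cons_rcons; last first.
  apply/negP; rewrite mem_rcons inE => /orP[/eqP//|/valley_mem[_ /=]].
  by rewrite ltnn.
case: m IHm => [_|m]; first by move=> a b /size_subseq.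
by have [s ->] := valley_last x m; apply: nc_rcons_last.
Qed.

(** The top side needs the sharper bound 1, because the next row adds its second occurrence. *)
Lemma valley_count x m k :
  count_mem k (valley x m) <= (if k == (true, (x.+1, m)) then 1 else 2).
Proof.
elim: m k => [|m IHm] k; first by case: ifP.
rewrite valleyS -!cats1 /= !count_cat /= !addn0.
have cnt0 j : j \notin valley x m -> count_mem j (valley x m) = 0.
  by rewrite -has_pred1 has_count; lia.
have := IHm k; have [->|kh] := eqVneq k (false, (x.+1, m)).
  move=> _; rewrite !xpair_eqE /= cnt0 //.
  by apply/negP => /valley_mem[_ /=]; rewrite ltnn.
have [->|kv] := eqVneq k (true, (x.+1, m)).
  have -> : ((true, (x.+1, m.+1)) == (true, (x.+1, m))) = false.
    by apply/eqP=> -[]; lia.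
  by case: eqP => [[]|_] /=; lia.
have [->|_] := eqVneq k (true, (x.+1, m.+1)); last by rewrite /=; lia.
rewrite cnt0 //; apply/negP => /valley_mem[_ /=]; by rewrite ltnn.
Qed.

Lemma grid_snd_mem x m p : p \in grid x m ++ g_asc x m -> p.2.2.1 <= x.
Proof.
rewrite mem_cat => /orP[/flatten_mapP[i]|/g_asc_mem[y _]]; last first.
  by rewrite !inE => /or3P[]/eqP->.
rewrite mem_iota add0n mem_cat => /= ix /orP[/g_asc_mem[y _]|/g_desc_mem[y _ ->]//].
by rewrite !inE => /or3P[]/eqP->; apply: ltnW.
Qed.

Lemma grid_word x m : word (grid x m).
Proof.
split; first exact: grid_nc_fst.
(* The extra ascent completes the last valley, so that each induction step adds one whole valley. *)
- suff ncx : nc (map snd (grid x m ++ g_asc x m)).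
    by apply: nc_subseq ncx; rewrite map_subseq ?prefix_subseq.
  elim: x => [|x IHx].
    (* The first ascent follows no descent. It is a translate of the ascent of column 1, which is
       the second half of a valley. *)
    have := @valley_nc 0 m; rewrite /valley map_cat => nc0.
    have {nc0} : nc (map snd (g_asc 1 m)) by apply: nc_subseq nc0; apply: suffix_subseq.
    rewrite cat0s.
    have -> : map snd (g_asc 1 m) =
        [seq (p.1, (p.2.1.+1, p.2.2)) | p <- map snd (g_asc 0 m)].
      rewrite /g_asc !map_flatten -!map_comp; congr flatten; exact: eq_map.
    move=> nc1; have : nc (map id (map snd (g_asc 0 m))); last by rewrite map_id.
    apply: nc_map_eq nc1 => -[b [i j]] [b' [i' j']] _ _ /=; split=> [[-> -> ->]//|].
    by case=> -> -> ->.
  rewrite gridS -catA -catA (catA (g_asc _ _)) -catA (catA (grid _ _)) map_cat.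
  rewrite -/(valley x m); apply: nc_cat => // [|k /mapP[p /grid_snd_mem px ->]].
    exact: valley_nc.
  by case/valley_mem=> E _; rewrite E ltnn in px.
- move=> k; suff: count_mem k (map snd (grid x m ++ g_asc x m)) <= 2.
    by rewrite map_cat count_cat => /(leq_trans (leq_addr _ _)).
  elim: x => [|x IHx].
    rewrite cat0s; have := valley_count 0 m (k.1, (k.2.1.+1, k.2.2)).
    rewrite /valley map_cat count_cat.
    have -> : map snd (g_asc 1 m) =
        [seq (p.1, (p.2.1.+1, p.2.2)) | p <- map snd (g_asc 0 m)].
      rewrite /g_asc !map_flatten -!map_comp; congr flatten; exact: eq_map.
    rewrite (count_map _ _ (map snd _)) => cnt.
    suff -> : count_mem k (map snd (g_asc 0 m)) =
       count (preim (fun p : gedge => (p.1, (p.2.1.+1, p.2.2)))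
         (pred1 (k.1, (k.2.1.+1, k.2.2)))) (map snd (g_asc 0 m)).
      by apply: leq_trans (leq_trans (leq_addl _ _) cnt) _; case: ifP.
    by apply: eq_count => -[b [i j]] /=; case: k {cnt} => b' [i' j'] /=; rewrite !xpair_eqE eqSS.
  rewrite gridS -catA -catA (catA (g_asc _ _)) -catA (catA (grid _ _)) map_cat.
  rewrite -/(valley x m) count_cat.
  have [kx|kx] := leqP k.2.1 x.
    suff -> : count_mem k (valley x m) = 0 by rewrite addn0.
    apply/eqP; rewrite -leqn0 leqNgt -has_count has_pred1.
    by apply/negP=> /valley_mem[E _]; rewrite E ltnn in kx.
  have -> : count_mem k (map snd (grid x m ++ g_asc x m)) = 0.
    apply/eqP; rewrite -leqn0 leqNgt -has_count has_pred1.
    by apply/negP=> /mapP[p /grid_snd_mem px Ek]; rewrite Ek ltnNge px in kx.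
  by apply: leq_trans (valley_count _ _ _) _; case: ifP.
Qed.

Lemma mem_grid x m i j : i < x -> j < m ->
  [/\ ((i, j), (true, (i, j))) \in grid x m, ((i, j), (false, (i, j))) \in grid x m,
      ((i, j), (true, (i, j.+1))) \in grid x m &
      ((i, j), (false, (i.+1, j))) \in grid x m].
Proof.
move=> ix jm.
have sub p : p \in g_asc i m ++ g_desc i m -> p \in grid x m.
  by move=> pin; apply/flatten_mapP; exists i; rewrite // mem_iota.
have asc p : p \in [:: ((i, j), (true, (i, j))); ((i, j), (false, (i, j)));
    ((i, j), (true, (i, j.+1)))] -> p \in grid x m.
  move=> pin; apply: sub; rewrite mem_cat; apply/orP; left.
  by apply/flatten_mapP; exists j; rewrite // mem_iota.
split; try by apply: asc; rewrite !inE eqxx ?orbT.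
apply: sub; rewrite mem_cat mem_rev; apply/orP; right.
by apply/mapP; exists j; rewrite // mem_iota.
Qed.
End Grid.

(** * The linear bound on the number of edges *)

Lemma chords_size (a b : nat) (S : seq (nat * nat)) : a < b -> uniq S ->
  (forall p, p \in S -> [&& a <= p.1, p.1 < p.2 & p.2 <= b]) ->
  (forall p q, p \in S -> q \in S -> ~~ [&& p.1 < q.1, q.1 < p.2 & p.2 < q.2]) ->
  size S <= (b - a).*2.-1.
Proof.
move: {2}(b - a) (leqnn (b - a)) => k; elim: k a b S => [|k IHk] a b S.
  by move=> ba0 ab; lia.
move=> bak ab uS rS ncS; have [ba|ba] := leqP b a.+1.
  have -> : b - a = 1 by lia.
  apply: (@leq_trans (size [:: (a, b)])) => //; apply: uniq_leq_size => // -[i j].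
  by move=> /rS /= ij; rewrite inE; apply/eqP; congr pair; lia.
(* [m'] is the farthest partner of [a] below [b], or [a.+1] if there is none. Apart from [(a, b)] no
   chord passes over [m'], so the bounds for the two sides give 1 + (2(m' - a) - 1) + (2(b - m') -
   1) = 2(b - a) - 1. *)
pose P (p : nat * nat) := (p.1 == a) && (p.2 < b).
pose m := \max_(p <- S | P p) p.2; pose m' := maxn a.+1 m.
have mb : m < b.
  by rewrite /m; elim/big_ind: _ => [|x y xb yb|p /andP[]//]; rewrite ?gtn_max; lia.
have Pm p : p \in S -> p.1 = a -> p.2 < b -> p.2 <= m'.
  move=> pS p1 p2; rewrite leq_max; apply/orP; right.
  by apply: (leq_bigmax_seq (F := fun p => p.2)); rewrite // /P p1 eqxx.
have m'S : m' = a.+1 \/ (a, m') \in S.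
  have [mS|m0] : (exists2 p, p \in S & P p /\ p.2 = m) \/ m = 0.
    rewrite /m; elim: (S) => [|p s IHs]; first by right; rewrite big_nil.
    rewrite big_cons; case: ifP => Pp; last first.
      by case: IHs => [[q qs Pq]|]; [left; exists q; rewrite // inE qs orbT | right].
    set M := bigop _ _ _ in IHs *; case: (leqP p.2 M) => pM; last first.
      by left; exists p; rewrite ?mem_head //; split=> //; lia.
    case: IHs => [[q qs [Pq Eq]]|M0]; first by left; exists q; rewrite ?inE ?qs ?orbT //; split=> //; lia.
    by right.
  - case: mS => -[i j] ijS [/andP[/= /eqP ia jb] Ej]; subst i j.
    by have /= := rS _ ijS => am; right; rewrite /m' (maxn_idPr _) //; lia.
  - by left; rewrite /m' m0; lia.
have am' : a < m' < b by rewrite /m' leq_max gtn_max; lia.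
have cov p : p \in S -> [|| p == (a, b), p.2 <= m' | m' <= p.1].
  move=> pS; have rp := rS _ pS; apply/negPn/negP; rewrite !negb_or -!ltnNge => /and3P[pab m2 m1].
  have [p1a|p1a] := eqVneq p.1 a.
    have [p2b|p2b] := ltnP p.2 b; first by have := Pm _ pS p1a p2b; lia.
    by case/eqP: pab; case: (p) p1a p2b rp => i j /= -> *; congr pair; lia.
  case: m'S => [m'a|m'S]; first by lia.
  have /negP[] := ncS _ _ m'S pS; rewrite /= m1 m2 ltn_neqAle eq_sym p1a.
  by case/and3P: rp => ->.
pose S1 := filter (fun p => p.2 <= m') S; pose S2 := filter (fun p => m' <= p.1) S.
have szS : size S <= 1 + size S1 + size S2.
  apply: (@leq_trans (count_mem (a, b) S + size S1 + size S2)); last first.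
    by rewrite !leq_add2r (count_uniq_mem _ uS) leq_b1.
  rewrite !size_filter; elim: (S) cov => //= p t IHt cov.
  have /IHt : forall q, q \in t -> [|| q == (a, b), q.2 <= m' | m' <= q.1].
    by move=> q qt; apply: cov; rewrite inE qt orbT.
  by have := cov p (mem_head _ _); case: (_ == _); case: (_ <= m'); case: (m' <= _) => //=; lia.
have sz1 : size S1 <= (m' - a).*2.-1.
  apply: IHk; rewrite ?filter_uniq //; try lia.
    by move=> p; rewrite mem_filter => /andP[p0 /rS/and3P[p1 p2 p3]]; apply/and3P.
  by move=> p q; rewrite !mem_filter => /andP[_ pS] /andP[_ qS]; apply: ncS.
have sz2 : size S2 <= (b - m').*2.-1.
  apply: IHk; rewrite ?filter_uniq //; try lia.
    by move=> p; rewrite mem_filter => /andP[p0 /rS/and3P[p1 p2 p3]]; apply/and3P.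
  by move=> p q; rewrite !mem_filter => /andP[_ pS] /andP[_ qS]; apply: ncS.
lia.
Qed.

Section Runs.
Variable T : eqType.

Fixpoint norep (x : T) (s : seq T) :=
  if s is y :: s' then if x == y then norep y s' else y :: norep y s' else [::].

Lemma norep_path x s : path (fun x y => x != y) x (norep x s).
Proof. by elim: s x => //= y s IHs x; case: eqVneq => [->|xy] //=; rewrite xy IHs. Qed.

Lemma norep_subseq x s : subseq (norep x s) s.
Proof.
elim: s x => //= y s IHs x; case: eqVneq => _ /=; last by rewrite eqxx.
by apply: subseq_trans (IHs _) (subseq_cons _ _).
Qed.

(** The index of the maximal run of equal letters that contains the position [i]. *)
Definition rank (x0 : T) (s : seq T) i :=
  count (fun j => nth x0 s j != nth x0 s j.+1) (iota 0 i).

Lemma rank_le x0 s i j : i <= j -> rank x0 s i <= rank x0 s j.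
Proof. by move=> ij; rewrite /rank -(subnKC ij) iotaD count_cat leq_addr. Qed.

Lemma rank_inj x0 s i j : rank x0 s i = rank x0 s j -> nth x0 s i = nth x0 s j.
Proof.
wlog ij : i j / i <= j => [H Er|].
  by case: (leqP i j) => [/H|/ltnW/H]; [apply|move->].
rewrite -(subnKC ij); elim: (j - i) => [|d IHd]; first by rewrite addn0.
rewrite addnS /rank -addn1 iotaD count_cat /= add0n addn1 addn0 -/(rank _ _ _) => Er.
have Ed := rank_le x0 s (leq_addr d i); rewrite -/(rank _ _ _) in Er.
have : (nth x0 s (i + d) != nth x0 s (i + d).+1) = false by case: (_ != _) Er => //=; lia.
by move/negbFE/eqP <-; apply: IHd; move: Er; case: (_ != _) => /=; lia.
Qed.

Lemma rank_size x0 x s : rank x0 (x :: s) (size s) = size (norep x s).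
Proof.
rewrite /rank; elim: s x => //= y s IHs x.
have -> : count (fun j => nth x0 [:: x, y & s] j != nth x0 (y :: s) j)
    (iota 1 (size s)) = size (norep y s).
  by rewrite -(IHs y) -[1]addn0 iotaDl count_map.
by case: eqVneq.
Qed.
End Runs.

(** An edge becomes a chord between the runs of its two darts. A run belongs to one vertex, so
    different edges give different chords, and crossing chords would make two edges alternate. There
    are at most 2n - 1 runs by [nc_size], hence at most 4n - 5 chords if there is any. *)
Lemma edges_size (n : nat) (adj : rel nat) (wd es : seq (nat * nat)) :
  dart_order adj wd -> (forall d, d \in wd -> d.1 < n) -> symmetric adj ->
  uniq es -> (forall e, e \in es -> (e.1 < e.2) && adj e.1 e.2) ->
  size es <= 4 * n.
Proof.
move=> [uwd mwd nc1 nc2] wdn adjC ues esP.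
pose pos u v := index (u, v) wd; pose rk := rank 0 (map fst wd).
case Es : (map fst wd) => [|x s].
  case: es ues esP => // -[u v] es _ /(_ _ (mem_head _ _)) /= /andP[_ uv].
  by have := mwd (u, v); rewrite /= uv; case: (wd) Es.
have lt_pos u v : adj u v -> pos u v < size wd by rewrite index_mem mwd.
have nth_pos u v : adj u v -> nth 0 (map fst wd) (pos u v) = u.
  by move=> uv; rewrite (nth_map (0, 0)) ?lt_pos // nth_index // mwd.
have rk_lab u v u' v' : adj u v -> adj u' v' -> rk (pos u v) = rk (pos u' v') -> u = u'.
  by move=> uv uv' /rank_inj; rewrite !nth_pos.
have rk_lt i j : rk i < rk j -> i < j.
  by rewrite ltnNge; apply: contraR; rewrite -leqNgt; apply: rank_le.
have rk_min i j : rk (minn i j) = minn (rk i) (rk j).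
  by case: (leqP i j) => [|/ltnW] /(rank_le 0 (map fst wd)); rewrite -/rk; lia.
have rk_max i j : rk (maxn i j) = maxn (rk i) (rk j).
  by case: (leqP i j) => [|/ltnW] /(rank_le 0 (map fst wd)); rewrite -/rk; lia.
pose f (e : nat * nat) := let i := rk (pos e.1 e.2) in let j := rk (pos e.2 e.1) in
  (minn i j, maxn i j).
have finj : {in es &, injective f}.
  move=> [u v] [u' v'] /esP /= /andP[uv auv] /esP /= /andP[uv' auv'] [].
  have avu : adj v u by rewrite adjC.
  have avu' : adj v' u' by rewrite adjC.
  move=> E1 E2.
  have [[Eu Ev]|[Eu Ev]] : (rk (pos u v) = rk (pos u' v') /\ rk (pos v u) = rk (pos v' u'))
    \/ (rk (pos u v) = rk (pos v' u') /\ rk (pos v u) = rk (pos u' v')) by lia.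
  - by rewrite (rk_lab _ _ _ _ auv auv' Eu) (rk_lab _ _ _ _ avu avu' Ev).
  - have := rk_lab _ _ _ _ auv avu' Eu; have := rk_lab _ _ _ _ avu auv' Ev; lia.
pose L := rk (size s).
have szs : size wd = (size s).+1 by rewrite -(size_map fst) Es.
have rkL u v : adj u v -> rk (pos u v) <= L.
  by move=> /lt_pos; rewrite szs => ?; apply: rank_le.
have Ln : L.+1 <= n.*2.-1.
  rewrite /L /rk Es rank_size -[(size _).+1]/(size (x :: norep x s)).
  have sub : subseq (x :: norep x s) (map fst wd) by rewrite Es /= eqxx norep_subseq.
  apply: leq_trans (nc_size (nc_subseq sub nc1) (norep_path x s)) _.
  suff: size (undup (x :: norep x s)) <= n by lia.
  rewrite -(size_iota 0 n); apply: uniq_leq_size; first exact: undup_uniq.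
  move=> y; rewrite mem_undup => /(mem_subseq sub)/mapP[d /wdn dn ->].
  by rewrite mem_iota.
have [->//|nes] := eqVneq es [::].
have L0 : 0 < L.
  case: es nes esP {ues finj} => // -[u v] es _ /(_ _ (mem_head _ _)) /= /andP[uv auv].
  have avu : adj v u by rewrite adjC.
  have : rk (pos u v) <> rk (pos v u) by move/(rk_lab _ _ _ _ auv avu); lia.
  by have := rkL _ _ auv; have := rkL _ _ avu; lia.
rewrite -(size_map f); apply: leq_trans (chords_size L0 _ _ _) _; last by lia.
- by rewrite map_inj_in_uniq.
- move=> p /mapP[[u v] /esP /= /andP[uv auv] ->] /=.
  have avu : adj v u by rewrite adjC.
  have : rk (pos u v) <> rk (pos v u) by move/(rk_lab _ _ _ _ auv avu); lia.
  by have := rkL _ _ auv; have := rkL _ _ avu; lia.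
- move=> p q /mapP[[u v] /esP /= /andP[uv auv] ->] /mapP[[u' v'] /esP /= /andP[uv' auv'] ->] /=.
  have avu : adj v u by rewrite adjC.
  have avu' : adj v' u' by rewrite adjC.
  apply/negP=> cr.
  pose i := pos u v; pose j := pos v u; pose i' := pos u' v'; pose j' := pos v' u'.
  have cr' : [&& minn i j < minn i' j', minn i' j' < maxn i j & maxn i j < maxn i' j'].
    move: cr; rewrite -!rk_min -!rk_max => /and3P[/rk_lt c1 /rk_lt c2 /rk_lt c3].
    exact/and3P.
  have nthE k u1 v1 : adj u1 v1 -> pos u1 v1 = k ->
      nth (0, 0) (map edge_of wd) k = edge_of (u1, v1).
    by move=> a1 <-; rewrite (nth_map (0, 0)) ?lt_pos // nth_index // mwd.
  have EC a b : edge_of (a, b) = edge_of (b, a) by apply/edge_of_eq; right.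
  have eij k : k \in [:: i; j] -> nth (0, 0) (map edge_of wd) k = edge_of (u, v).
    by rewrite !inE => /orP[]/eqP->; [|rewrite EC]; apply: nthE.
  have eij' k : k \in [:: i'; j'] -> nth (0, 0) (map edge_of wd) k = edge_of (u', v').
    by rewrite !inE => /orP[]/eqP->; [|rewrite EC]; apply: nthE.
  have subs k1 k2 k3 k4 : k1 < k2 -> k2 < k3 -> k3 < k4 -> k4 < size wd ->
      subseq [seq nth (0, 0) (map edge_of wd) k | k <- [:: k1; k2; k3; k4]] (map edge_of wd).
    move=> k12 k23 k34 k4s; set t := map edge_of wd.
    rewrite -[t in X in subseq _ X](mkseq_nth (0, 0)) map_subseq //.
    apply: (@subseq_trans _ [seq k <- iota 0 (size t) | k \in [:: k1; k2; k3; k4]]);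
      last exact: filter_subseq.
    suff E : [:: k1; k2; k3; k4] = [seq k <- iota 0 (size t) | k \in [:: k1; k2; k3; k4]].
      by rewrite -E subseq_refl.
    apply: (@irr_sorted_eq _ ltn); [exact: ltn_trans | exact: ltnn | | |].
      - by rewrite /= k12 k23 k34.
      - by apply: sorted_filter; [exact: ltn_trans | exact: iota_ltn_sorted].
      - move=> k; rewrite mem_filter mem_iota add0n leq0n !inE /= size_map.
        by apply/idP/idP => [H|/andP[]//]; rewrite H /=; lia.
  have /= := subs (minn i j) (minn i' j') (maxn i j) (maxn i' j').
  rewrite !(eij (minn i j)) ?(eij (maxn i j)) ?(eij' (minn i' j')) ?(eij' (maxn i' j'));
    try by rewrite !inE; lia.
  case/and3P: cr' => c1 c2 c3 /(_ c1 c2 c3).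
  have c4 : maxn i' j' < size wd by rewrite gtn_max !lt_pos.
  move=> /(_ c4)/nc2 /edge_of_eq[[E1 E2]|[E1 E2]]; subst; lia.
Qed.

(** * Laminar families and contiguous orders *)

Lemma contiguous_order (T : finType) (F : seq {set T}) :
  (forall A B, A \in F -> B \in F ->
    [\/ A \subset B, B \subset A | [disjoint A & B]]) ->
  exists2 s : seq T, uniq s /\ (forall x, x \in s) &
    forall A x y z, A \in F -> subseq [:: x; y; z] s -> x \in A -> z \in A ->
      y \in A.
Proof.
pose le (A B : {set T}) := #|A| <= #|B|.
have le_trans : transitive le by move=> A B C; exact: leq_trans.
have : pairwise le (sort le F).
  rewrite -(sorted_pairwise le_trans); apply: sort_sorted => A B; exact: leq_total.
move=> pw lam; have {}lam A B : A \in sort le F -> B \in sort le F ->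
    [\/ A \subset B, B \subset A | [disjoint A & B]] by rewrite !mem_sort; apply: lam.
suff [s us cs] : exists2 s : seq T, uniq s /\ (forall x, x \in s) &
    forall A x y z, A \in sort le F -> subseq [:: x; y; z] s -> x \in A -> z \in A ->
      y \in A.
  by exists s => // A x y z AF; apply: cs; rewrite mem_sort.
elim/last_ind: (sort le F) pw lam => [|G S IHG].
  by exists (enum T) => //; split=> [|x]; rewrite ?enum_uniq ?mem_enum.
rewrite pairwise_rcons => /andP[/allP leS pw] lam.
have [|s [us ms] cs] := IHG pw.
  by move=> A B AG BG; apply: lam; rewrite mem_rcons inE ?AG ?BG orbT.
(* The sets are treated by increasing size. Moving [S] to the front, with the order inside [S] and
   outside it unchanged, keeps the earlier sets contiguous: being no larger than [S], each is
   contained in [S] or disjoint from it. *)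
pose f1 := [seq x <- s | x \in S]; pose f2 := [seq x <- s | x \notin S].
exists (f1 ++ f2).
  split; last by move=> x; rewrite mem_cat !mem_filter ms !andbT orbN.
  rewrite cat_uniq !filter_uniq // andbT; apply/hasPn=> x.
  by rewrite !mem_filter => /andP[/negbTE->].
move=> A x y z; rewrite mem_rcons inE => AG sub xA zA.
have inS1 : z \in S -> subseq [:: x; y; z] f1.
  move=> zS; case/subseq_cat_split: sub => t1 [t2 [Et sub1 sub2]].
  case: (lastP t2) Et sub2 => [|t2' w]; first by rewrite cats0 => ->.
  rewrite -rcons_cat -[[:: x; y; z]]/(rcons [:: x; y] z) => /rcons_inj[_ <-].
  by move/mem_subseq/(_ z); rewrite mem_rcons mem_head mem_filter zS => /(_ isT).
have inS2 : x \notin S -> subseq [:: x; y; z] f2.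
  move=> xS; case/subseq_cat_split: sub => t1 [t2 [Et sub1 sub2]].
  case: t1 Et sub1 => [/= -> //|w t1 [<- _]].
  by move/mem_subseq/(_ x); rewrite mem_head mem_filter (negbTE xS) => /(_ isT).
have caseS : A = S -> y \in A.
  move=> AS; rewrite AS in zA *; have /mem_subseq/(_ y) := inS1 zA.
  by rewrite !inE eqxx orbT mem_filter => /(_ isT)/andP[].
have [/caseS//|AS] := eqVneq A S; rewrite (negbTE AS) /= in AG.
have AGS : A \in rcons G S by rewrite mem_rcons inE AG orbT.
have SGS : S \in rcons G S by rewrite mem_rcons mem_head.
have [AsubS|SsubA|dis] := lam A S AGS SGS.
- apply: (cs A x y z) => //; apply: subseq_trans (inS1 _) (filter_subseq _ _).
  exact: (subsetP AsubS).
- apply: caseS; apply/esym/eqP; rewrite eqEcard SsubA; exact: leS.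
- apply: (cs A x y z) => //; apply: subseq_trans (inS2 _) (filter_subseq _ _).
  by rewrite (disjointFr dis).
Qed.

(** * Walks on the grid and the branch sets of a minor *)

Definition cadj (c d : nat * nat) :=
  ((c.1 == d.1) && ((c.2 == d.2.+1) || (d.2 == c.2.+1))) ||
  ((c.2 == d.2) && ((c.1 == d.1.+1) || (d.1 == c.1.+1))).

Lemma grid_share x m c d : c.1 < x -> c.2 < m -> d.1 < x -> d.2 < m -> cadj c d ->
  exists k, (c, k) \in grid x m /\ (d, k) \in grid x m.
Proof.
case: c d => [i j] [i' j'] /= ix jm ix' jm'.
have [a1 a2 a3 a4] := mem_grid ix jm; have [b1 b2 b3 b4] := mem_grid ix' jm'.
case/orP=> /andP[/eqP E /orP[]/eqP E'] /=; rewrite /= in E E'; subst.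
- by exists (true, (i', j'.+1)).
- by exists (true, (i', j.+1)).
- by exists (false, (i'.+1, j')).
- by exists (false, (i.+1, j')).
Qed.

Section Walks.
Variables (n : nat) (adj : rel nat) (X M L1 L2 L : nat).
Variables (wk : nat -> nat -> nat -> nat * nat) (ctr : nat -> nat * nat).
Variable star : nat -> nat * nat -> bool.
Local Notation edge a b := (adj a b && (a < b)).
Hypothesis adjC : symmetric adj.
Hypothesis adjI : irreflexive adj.
Hypothesis adjn : forall a b, adj a b -> a < n.
Hypothesis wk_box : forall a b j, edge a b -> j <= L ->
  (wk a b j).1 < X /\ (wk a b j).2 < M.
Hypothesis wk_step : forall a b j, edge a b -> j < L ->
  wk a b j = wk a b j.+1 \/ cadj (wk a b j) (wk a b j.+1).
Hypothesis wk_ctr : forall a b, edge a b -> wk a b 0 = ctr a /\ wk a b L = ctr b.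
Hypothesis star1 : forall a b j, edge a b -> j <= L1 -> star a (wk a b j).
Hypothesis star2 : forall a b j, edge a b -> L2 <= j -> j <= L -> star b (wk a b j).
Hypothesis starP : forall u c, star u c -> exists a b j,
  [/\ edge a b, j <= L, c = wk a b j &
      (a = u /\ j <= L1) \/ (b = u /\ L2 <= j)].
Hypothesis star_inj : forall u v c, star u c -> star v c -> u = v.
Hypothesis star_mid : forall a b j w, edge a b -> L1 < j < L2 ->
  star w (wk a b j) -> w = a \/ w = b.
Hypothesis mid_mid : forall a b j c d k, edge a b -> edge c d -> L1 < j < L2 ->
  L1 < k < L2 -> wk a b j = wk c d k -> a = c /\ b = d.
Hypothesis L2L : L2 <= L.

(** [star u] is a neighbourhood of [u] made of the ends of its walks. A walk may revisit the stars
    of its own ends, so it is cut at its first entry into the star of [b] and, before that, at its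
    last visit to the star of [a]. *)
Let e_to a b := find (fun j => star b (wk a b j)) (iota 0 L.+1).
Let e_from a b :=
  (e_to a b).-1 - find (fun k => star a (wk a b ((e_to a b).-1 - k))) (iota 0 (e_to a b)).

Lemma walk_ends a b : edge a b -> [/\ e_from a b < e_to a b, e_to a b <= L,
  star a (wk a b (e_from a b)), star b (wk a b (e_to a b)) &
  forall j, e_from a b < j < e_to a b ->
    ~~ star a (wk a b j) /\ ~~ star b (wk a b j)].
Proof.
move=> eab; have ab : a <> b by case/andP: eab => ab _ E; rewrite E adjI in ab.
have hasb : has (fun j => star b (wk a b j)) (iota 0 L.+1).
  by apply/hasP; exists L; [rewrite mem_iota /= ltnS | apply: star2].
have toL : e_to a b <= L.
  by have := hasb; rewrite has_find size_iota ltnS.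
have sb : star b (wk a b (e_to a b)).
  by have := nth_find 0 hasb; rewrite nth_iota ?add0n // ltnS.
have nb j : j < e_to a b -> ~~ star b (wk a b j).
  move=> jt; have := before_find 0 jt; rewrite nth_iota ?add0n; first by move->.
  exact: leq_trans jt (leqW toL).
have to0 : 0 < e_to a b.
  rewrite lt0n; apply/eqP=> t0; rewrite t0 in sb.
  by have := star_inj (star1 eab (leq0n _)) sb.
have hasa : has (fun k => star a (wk a b ((e_to a b).-1 - k))) (iota 0 (e_to a b)).
  apply/hasP; exists (e_to a b).-1; first by rewrite mem_iota /=; lia.
  by rewrite subnn; apply: star1.
have flt : find (fun k => star a (wk a b ((e_to a b).-1 - k))) (iota 0 (e_to a b)) < e_to a b.
  by have := hasa; rewrite has_find size_iota.
have sa : star a (wk a b (e_from a b)).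
  by have := nth_find 0 hasa; rewrite nth_iota ?add0n.
split=> //; first by rewrite /e_from; lia.
move=> j /andP[fj jt]; split; last exact: nb.
have := @before_find _ 0 (fun k => star a (wk a b ((e_to a b).-1 - k)))
  (iota 0 (e_to a b)) ((e_to a b).-1 - j).
have jlt : (e_to a b).-1 - j < find (fun k => star a (wk a b ((e_to a b).-1 - k))) (iota 0 (e_to a b)).
  by move: fj; rewrite /e_from; lia.
move/(_ jlt); rewrite nth_iota ?add0n; last by lia.
by rewrite (_ : (e_to a b).-1 - ((e_to a b).-1 - j) = j) => [->|]; last by lia.
Qed.

Lemma walk_mid a b j : edge a b -> e_from a b < j < e_to a b -> L1 < j < L2.
Proof.
move=> eab jlt; have [ft tL sa sb nab] := walk_ends eab; have [na nb] := nab j jlt.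
rewrite !ltnNge; apply/andP; split.
  by apply: contra na; apply: star1.
by apply: contra nb => ?; apply: star2 => //; lia.
Qed.

(** The branch set of [u]: its star and, for each edge whose smaller end is [u], the part of the
    walk strictly between the two stars. With all of that part given to one end, a single step of
    the walk is left to represent the edge. *)
Let labb c u := star u c || has (fun b => edge u b &&
  has (fun j => (e_from u b < j < e_to u b) && (c == wk u b j)) (iota 0 L.+1)) (iota 0 n).

Lemma labbP c u : labb c u -> star u c \/ exists b j,
  [/\ edge u b, e_from u b < j < e_to u b & c = wk u b j].
Proof.
case/orP=> [|/hasP[b _ /andP[eub /hasP[j _ /andP[jlt /eqP cE]]]]]; first by left.
by right; exists b, j.
Qed.

Lemma labb_ext u b j : edge u b -> e_from u b < j < e_to u b -> labb (wk u b j) u.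
Proof.
move=> eub jlt; apply/orP; right; have [ft tL _ _ _] := walk_ends eub.
apply/hasP; exists b; first by rewrite mem_iota /= add0n; case/andP: eub; rewrite adjC => /adjn.
by rewrite eub; apply/hasP; exists j; [rewrite mem_iota /=; lia | rewrite jlt eqxx].
Qed.

Lemma labb_star_ext c u v b j : star v c -> edge u b ->
  e_from u b < j < e_to u b -> c = wk u b j -> u = v.
Proof.
move=> sv eub jlt cE; have [_ _ _ _ nab] := walk_ends eub; have [_ nb] := nab j jlt.
rewrite cE in sv; case: (star_mid eub (walk_mid eub jlt) sv) => // vb.
by rewrite vb in sv; rewrite sv in nb.
Qed.

Lemma labb_inj c u v : labb c u -> labb c v -> u = v.
Proof.
case/labbP=> [su|[b [j [eub jlt cE]]]] /labbP[sv|[b' [j' [evb jlt' cE']]]].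
- exact: star_inj su sv.
- by apply/esym/(labb_star_ext su evb jlt').
- exact: labb_star_ext sv eub jlt cE.
- have E : wk u b j = wk v b' j' by rewrite -cE.
  by have [] := mid_mid eub evb (walk_mid eub jlt) (walk_mid evb jlt') E.
Qed.

Lemma labb_n c u : labb c u -> u < n.
Proof.
case/labbP=> [/starP[a [b [j [/andP[ab _] _ _ [[<- _]|[<- _]]]]]]|[b [j [/andP[ub _] _ _]]]].
- exact: adjn ab.
- by rewrite adjC in ab; apply: adjn ab.
- exact: adjn ub.
Qed.

Let lab c := ohead [seq u <- iota 0 n | labb c u].

Lemma labE c u : labb c u -> lab c = Some u.
Proof.
move=> cu; rewrite /lab; have : u \in [seq u <- iota 0 n | labb c u].
  by rewrite mem_filter cu mem_iota /= (labb_n cu).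
have : all (labb c) [seq u <- iota 0 n | labb c u].
  by apply/allP=> v; rewrite mem_filter => /andP[].
by case: (filter _ _) => //= v s /andP[cv _] _; rewrite (labb_inj cv cu).
Qed.

Lemma lab_some c u : lab c = Some u -> labb c u.
Proof.
rewrite /lab; have : all (labb c) [seq u <- iota 0 n | labb c u].
  by apply/allP=> v; rewrite mem_filter => /andP[].
by case: (filter _ _) => //= v s /andP[cv _] [<-].
Qed.

Lemma labb_box c u : labb c u -> c.1 < X /\ c.2 < M.
Proof.
case/labbP=> [/starP[a [b [j [eab jL -> _]]]]|[b [j [eub jlt ->]]]].
  exact: wk_box.
by apply: wk_box => //; have [_ tL _ _ _] := walk_ends eub; lia.
Qed.

(** The branch sets are disjoint and connected, so the grid word restricted to them contracts to a
    word on the vertices. An edge survives as the step by which its walk enters the star of its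
    larger end. *)
Lemma walks_dart_order : exists wd, dart_order adj wd.
Proof.
pose w := [seq p <- grid X M | lab p.1 != None].
have ww : word w by apply/word_filter/grid_word.
(* The default is never read: every cell kept in [w] has a label. *)
pose lab' c := odflt 0 (lab c).
have share c d u v : labb c u -> labb d v -> cadj c d ->
    exists k, (c, k) \in w /\ (d, k) \in w.
  move=> cu dv cd; have [c1 c2] := labb_box cu; have [d1 d2] := labb_box dv.
  have [k [ck dk]] := grid_share c1 c2 d1 d2 cd; exists k.
  by rewrite !mem_filter /= ck dk (labE cu) (labE dv).
have [w' [ww' w'P]] : exists w' : seq (nat * _), word w' /\
    forall x y k, (x, k) \in w -> (y, k) \in w -> lab' x <> lab' y ->
      (lab' x, k) \in w' /\ (lab' y, k) \in w'.
  apply: minor_word => // psi psiP.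
  have step c d u : labb c u -> labb d u -> c = d \/ cadj c d -> psi c = psi d.
    move=> cu du [->//|cd]; have [k [ck dk]] := share _ _ _ _ cu du cd.
    by apply: (psiP _ _ k) => //; rewrite /lab' (labE cu) (labE du).
  have path a b u i j : edge a b -> i <= j -> j <= L ->
      (forall k, i <= k <= j -> labb (wk a b k) u) -> psi (wk a b i) = psi (wk a b j).
    move=> eab ij; rewrite -(subnKC ij); elim: (j - i) => [|d IHd] jL lb.
      by rewrite addn0.
    rewrite IHd; [|lia|by move=> k kd; apply: lb; lia].
    by rewrite addnS; apply: (step _ _ u); rewrite -?addnS; [apply: lb; lia | apply: lb; lia |]; rewrite addnS; apply: wk_step => //; lia.
  have starc u c : star u c -> psi c = psi (ctr u).
    case/starP=> a [b [j [eab jL -> [[<- jL1]|[<- jL2]]]]].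
      have [<- _] := wk_ctr eab; apply/esym; apply: (path _ _ a) => // k kj.
      by apply/orP; left; apply: star1 => //; lia.
    have [_ <-] := wk_ctr eab; apply: (path _ _ b) => // k kj.
    by apply/orP; left; apply: star2 => //; lia.
  have labc u c : labb c u -> psi c = psi (ctr u).
    case/labbP=> [/starc//|[b [j [eub jlt ->]]]].
    have [ft tL sa sb nab] := walk_ends eub; rewrite -(starc _ _ sa); apply/esym.
    apply: (path _ _ u) => //; [lia | lia |] => k kj.
    have [->|kf] := eqVneq k (e_from u b); first by rewrite /labb sa.
    by apply: labb_ext => //; lia.
  move=> x y /mapP[p pw ->] /mapP[q qw ->]; move: pw qw; rewrite !mem_filter /lab'.
  case Ep : (lab p.1) => [u|] //= _; case Eq : (lab q.1) => [v|] //= _ uv; subst v.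
  by rewrite (labc _ _ (lab_some Ep)) (labc _ _ (lab_some Eq)).
apply: (@word_dart_order _ adj [seq d <- [seq (u, v) | u <- iota 0 n, v <- iota 0 n] | adj d.1 d.2] w') => //.
- move=> [u v]; rewrite mem_filter /=; case uv : (adj u v) => //=.
  have vn : v < n by apply: (@adjn v u); rewrite adjC.
  by apply/allpairsP; exists (u, v); rewrite !mem_iota /= (adjn uv) vn.
- have real u v : edge u v -> exists k, (u, k) \in w' /\ (v, k) \in w'.
    move=> euv; have [ft tL sa sb nab] := walk_ends euv.
    have l1 : labb (wk u v (e_to u v).-1) u.
      have [E|E] := eqVneq (e_to u v).-1 (e_from u v); first by rewrite E /labb sa.
      by apply: labb_ext => //; lia.
    have l2 : labb (wk u v (e_to u v)) v by rewrite /labb sb.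
    have uv : u <> v by case/andP: euv => uv _ E; rewrite E adjI in uv.
    have := @wk_step u v (e_to u v).-1 euv; rewrite prednK; last by lia.
    case=> [|E|cd]; first by lia.
      by rewrite E in l1; case: uv; apply: labb_inj l1 l2.
    have [k [k1 k2]] := share _ _ _ _ l1 l2 cd; exists k.
    by have := w'P _ _ _ k1 k2; rewrite /lab' (labE l1) (labE l2); apply.
  move=> u v uv; case: (ltngtP u v) => [uv'|vu|E].
  + by apply: real; rewrite uv.
  + by have [|k [k1 k2]] := real v u; [rewrite adjC uv | exists k].
  + by rewrite E adjI in uv.
Qed.
End Walks.

(** * Computable functions on countable types *)

Import GRing.Theory.

Definition rf k (f : seq nat -> nat) :=
  exists r, forall xs, size xs = k -> reval r xs (f xs).

Lemma rf_ext k f g : (forall xs, size xs = k -> f xs = g xs) -> rf k f -> rf k g.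
Proof. by move=> fg [r rP]; exists r => xs sz; rewrite -fg //; apply: rP. Qed.

Lemma rf_proj k i : i < k -> rf k (fun xs => nth 0 xs i).
Proof. by move=> ik; exists (RProj i) => xs sz; apply: EvProj; rewrite sz. Qed.

Lemma rf_comp1 k f g1 : rf 1 f -> rf k g1 -> rf k (fun xs => f [:: g1 xs]).
Proof.
move=> [r rP] [r1 r1P]; exists (RComp r [:: r1]) => xs sz.
apply: (@EvComp _ _ _ [:: g1 xs]); last exact: rP.
by apply: EvCons; [apply: r1P | apply: EvNil].
Qed.

Lemma rf_comp2 k f g1 g2 : rf 2 f -> rf k g1 -> rf k g2 ->
  rf k (fun xs => f [:: g1 xs; g2 xs]).
Proof.
move=> [r rP] [r1 r1P] [r2 r2P]; exists (RComp r [:: r1; r2]) => xs sz.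
apply: (@EvComp _ _ _ [:: g1 xs; g2 xs]); last exact: rP.
by do 2![apply: EvCons; first by [apply: r1P | apply: r2P]]; apply: EvNil.
Qed.

Lemma rf_const k c : rf k (fun=> c).
Proof.
elim: c => [|c [r rP]]; first by exists RZero => xs _; apply: EvZero.
exists (RComp RSucc [:: r]) => xs sz; apply: (@EvComp _ _ _ [:: c]); last exact: EvSucc.
by apply: EvCons; [apply: rP | apply: EvNil].
Qed.

Lemma rf_succ : rf 1 (fun xs => (nth 0 xs 0).+1).
Proof. by exists RSucc => -[|x [|? ?]] // _; apply: EvSucc. Qed.

Lemma rf_prim k f g : rf k f -> rf k.+2 g ->
  rf k.+1 (fun xs => nat_rect (fun=> nat) (f (behead xs))
    (fun i y => g [:: i, y & behead xs]) (head 0 xs)).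
Proof.
move=> [r rP] [q qP]; exists (RPrim r q) => -[|x xs] //= [sz].
elim: x => [|x IHx] /=; first exact/EvPrim0/rP.
by apply: EvPrimS IHx _; apply: qP; rewrite /= sz.
Qed.

(** Minimisation looks for a zero, so the predicate enters negated. Any function known to return the
    least witness becomes recursive in this way, however it was defined. *)
Lemma rf_mu k (P : seq nat -> bool) (f : seq nat -> nat) :
  rf k.+1 (fun xs => ~~ P xs) -> (forall xs, size xs = k -> P (f xs :: xs)) ->
  (forall xs i, size xs = k -> i < f xs -> ~~ P (i :: xs)) -> rf k f.
Proof.
move=> [r rP] Pf Pi; exists (RMin r) => xs sz; apply: (@EvMin _ _ _ (fun=> 0)).
  move=> i ilt; have := rP (i :: xs); rewrite (negbTE (Pi xs i sz ilt)) /=.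
  by apply; rewrite sz.
by have := rP (f xs :: xs); rewrite Pf //; apply; rewrite /= sz.
Qed.

Lemma rf_add : rf 2 (fun xs => nth 0 xs 0 + nth 0 xs 1).
Proof.
apply: rf_ext (rf_prim (rf_proj (isT : 0 < 1)) (rf_comp1 rf_succ (rf_proj (isT : 1 < 3)))).
by move=> [|x [|y [|? ?]]] //= _; elim: x => //= x ->.
Qed.

Lemma rf_mul : rf 2 (fun xs => nth 0 xs 0 * nth 0 xs 1).
Proof.
apply: rf_ext (rf_prim (rf_const 1 0)
  (rf_comp2 rf_add (rf_proj (isT : 1 < 3)) (rf_proj (isT : 2 < 3)))).
by move=> [|x [|y [|? ?]]] //= _; elim: x => //= x ->; rewrite mulSn addnC.
Qed.

Lemma rf_pred : rf 1 (fun xs => (nth 0 xs 0).-1).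
Proof.
apply: rf_ext (rf_prim (rf_const 0 0) (rf_proj (isT : 0 < 2))).
by move=> [|x [|? ?]] //= _; case: x.
Qed.

Lemma rf_sub : rf 2 (fun xs => nth 0 xs 0 - nth 0 xs 1).
Proof.
have := rf_prim (rf_proj (isT : 0 < 1)) (rf_comp1 rf_pred (rf_proj (isT : 1 < 3))).
move=> /rf_comp2/(_ (rf_proj (isT : 1 < 2)) (rf_proj (isT : 0 < 2))).
apply: rf_ext => -[|x [|y [|? ?]]] //= _.
by elim: y => [|y /= ->]; rewrite ?subn0 // subnS.
Qed.

Lemma rf_pow2 : rf 1 (fun xs => 2 ^ nth 0 xs 0).
Proof.
apply: rf_ext (rf_prim (rf_const 0 1)
  (rf_comp2 rf_add (rf_proj (isT : 1 < 2)) (rf_proj (isT : 1 < 2)))).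
by move=> [|x [|? ?]] //= _; elim: x => //= x ->; rewrite expnS mul2n addnn.
Qed.

Lemma rf_odd : rf 1 (fun xs => odd (nth 0 xs 0)).
Proof.
apply: rf_ext (rf_prim (rf_const 0 0)
  (rf_comp2 rf_sub (rf_const 2 1) (rf_proj (isT : 1 < 2)))).
by move=> [|x [|? ?]] //= _; elim: x => //= x ->; case: (odd x).
Qed.

Lemma rf_half : rf 1 (fun xs => (nth 0 xs 0)./2).
Proof.
apply: rf_ext (rf_prim (rf_const 0 0) (rf_comp2 rf_add (rf_proj (isT : 1 < 2))
  (rf_comp1 rf_odd (rf_proj (isT : 0 < 2))))).
move=> [|x [|? ?]] //= _; elim: x => //= x ->.
by rewrite uphalf_half addnC.
Qed.

(** One step of [CodeSeq.code], on which [pickle] is built for sequences and pairs: [cd_cons],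
    [cd_head] and [cd_behead] are the list operations on codes. *)
Definition cd_cons n m := 2 ^ n * m.*2.+1.
Definition cd_drop k i := iter i half k.
Definition cd_head k := if k == 0 then 0 else logn 2 k.
Definition cd_behead k := (cd_drop k (cd_head k))./2.

Lemma rf_cons : rf 2 (fun xs => cd_cons (nth 0 xs 0) (nth 0 xs 1)).
Proof.
have := rf_comp2 rf_mul (rf_comp1 rf_pow2 (rf_proj (isT : 0 < 2)))
  (rf_comp1 rf_succ (rf_comp2 rf_add (rf_proj (isT : 1 < 2)) (rf_proj (isT : 1 < 2)))).
by apply: rf_ext => xs _ /=; rewrite addnn.
Qed.

Lemma cd_drop_cons n m i : i <= n -> cd_drop (cd_cons n m) i = cd_cons (n - i) m.
Proof.
rewrite /cd_drop; elim: i => [|i IHi] ltin; first by rewrite subn0.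
rewrite /= IHi 1?ltnW // /cd_cons -[n - i]prednK ?subn_gt0 // expnS -mulnA mul2n.
by rewrite doubleK -subnS.
Qed.

Lemma odd_cd_cons n m : odd (cd_cons n m) = (n == 0).
Proof. by rewrite /cd_cons oddM oddX /= odd_double; case: n. Qed.

Lemma cd_consP k : 0 < k -> exists n m, k = cd_cons n m.
Proof.
move=> k0; have := CodeSeq.decodeK k; case: (CodeSeq.decode k) => [|n s] /=.
  by move=> k0'; rewrite -k0' in k0.
by move=> <-; exists n, (CodeSeq.code s).
Qed.

Lemma cd_headK n m : cd_head (cd_cons n m) = n.
Proof.
rewrite /cd_head /cd_cons ifN; last by rewrite -lt0n muln_gt0 expn_gt0.
rewrite lognM ?expn_gt0 // pfactorK // lognE /= dvdn2 /= odd_double /=.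
by rewrite addn0.
Qed.

Lemma cd_beheadK n m : cd_behead (cd_cons n m) = m.
Proof.
rewrite /cd_behead cd_headK cd_drop_cons // subnn /cd_cons mul1n.
by rewrite /= uphalf_double.
Qed.

Lemma rf_cd_drop : rf 2 (fun xs => cd_drop (nth 0 xs 0) (nth 0 xs 1)).
Proof.
have := rf_prim (rf_proj (isT : 0 < 1)) (rf_comp1 rf_half (rf_proj (isT : 1 < 3))).
move=> /rf_comp2/(_ (rf_proj (isT : 1 < 2)) (rf_proj (isT : 0 < 2))).
by apply: rf_ext => -[|x [|y [|? ?]]] //= _; elim: y => //= y ->.
Qed.

(** The exponent of 2 is the least number of halvings that yields an odd number; the code 0 of the
    empty list is tested apart, as no halving makes it odd. *)
Lemma rf_cd_head : rf 1 (fun xs => cd_head (nth 0 xs 0)).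
Proof.
pose P (xs : seq nat) := (nth 0 xs 1 == 0) || odd (cd_drop (nth 0 xs 1) (nth 0 xs 0)).
apply: (@rf_mu 1 P).
- have := rf_comp2 rf_sub (rf_comp2 rf_sub (rf_const 2 1) (rf_comp2 rf_sub (rf_const 2 1)
    (rf_proj (isT : 1 < 2))))
   (rf_comp1 rf_odd (rf_comp2 rf_cd_drop (rf_proj (isT : 1 < 2)) (rf_proj (isT : 0 < 2)))).
  apply: rf_ext => -[|i [|k [|? ?]]] //= _; rewrite /P /=.
  by case: k => [|k] /=; case: (odd _).
- move=> [|k [|? ?]] //= _; rewrite /P /=; case: posnP => //= k0.
  by have [n [m ->]] := cd_consP k0; rewrite cd_headK cd_drop_cons // subnn odd_cd_cons.
- move=> [|k [|? ?]] //= i _; rewrite /P /=; case: posnP => [->//|k0].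
  have [n [m ->]] := cd_consP k0; rewrite cd_headK => lt_in.
  by rewrite cd_drop_cons 1?ltnW // odd_cd_cons subn_eq0 -ltnNge lt_in.
Qed.

Lemma rf_cd_behead : rf 1 (fun xs => cd_behead (nth 0 xs 0)).
Proof.
exact: (rf_comp1 rf_half (rf_comp2 rf_cd_drop (rf_proj (isT : 0 < 1))
  (rf_comp1 rf_cd_head (rf_proj (isT : 0 < 1))))).
Qed.

Definition comp (T U : countType) (f : T -> U) :=
  exists r, forall t, reval r [:: pickle t] (pickle (f t)).

Section Comp.
Implicit Types T U V : countType.

Lemma pickle_pair T U (a : T) (b : U) :
  pickle (a, b) = cd_cons (pickle a) (cd_cons (pickle b) 0).
Proof. by []. Qed.

Lemma pickle_cons T (a : T) (s : seq T) :
  pickle (a :: s) = cd_cons (pickle a) (pickle s).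
Proof. by []. Qed.

Lemma pickle_bool (b : bool) : pickle b = b :> nat.
Proof. by []. Qed.

Lemma pickle_some (n : nat) : pickle (Some n) = cd_cons n 0.
Proof. by []. Qed.

Lemma pickle_Posz (n : nat) : pickle (Posz n) = cd_cons (cd_cons n 0) (cd_cons 0 0).
Proof. by []. Qed.

Lemma pickle_Negz (n : nat) : pickle (Negz n) = cd_cons 0 (cd_cons (cd_cons n 0) 0).
Proof. by []. Qed.

(** A rational is coded as its reduced fraction, and for an integer the denominator is 1. Integer
    coordinates therefore need no reduction of fractions. *)
Lemma pickle_intr (z : int) : pickle (z%:~R%R : rat) = pickle (z, 1%:Z%R).
Proof.
rewrite -[pickle (_ : rat)]/(pickle (valq z%:~R%R)).
suff -> : valq z%:~R%R = (z, 1%:Z%R) by [].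
have := numq_int z; have := denq_int z; rewrite /numq /denq.
by case: (valq _) => a b /= -> ->.
Qed.

Lemma comp_id T : comp (fun t : T => t).
Proof. by exists (RProj 0) => t; apply: EvProj. Qed.

Lemma comp_ext T U (f g : T -> U) : f =1 g -> comp f -> comp g.
Proof. by move=> fg [r rP]; exists r => t; rewrite -fg. Qed.

Lemma comp_comp T U V (f : T -> U) (g : U -> V) :
  comp g -> comp f -> comp (fun t => g (f t)).
Proof.
move=> [r rP] [q qP]; exists (RComp r [:: q]) => t.
apply: (@EvComp _ _ _ [:: pickle (f t)]); last exact: rP.
by apply: EvCons; [apply: qP | apply: EvNil].
Qed.

Lemma comp_rf1 T U V (F : seq nat -> nat) (f : T -> U) (g : T -> V) :
  rf 1 F -> comp f -> (forall t, pickle (g t) = F [:: pickle (f t)]) -> comp g.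
Proof.
move=> [r rP] [q qP] gE; exists (RComp r [:: q]) => t.
apply: (@EvComp _ _ _ [:: pickle (f t)]); last by rewrite gE; apply: rP.
by apply: EvCons; [apply: qP | apply: EvNil].
Qed.

Lemma comp_rf2 T U1 U2 V (F : seq nat -> nat) (f1 : T -> U1) (f2 : T -> U2)
    (g : T -> V) : rf 2 F -> comp f1 -> comp f2 ->
  (forall t, pickle (g t) = F [:: pickle (f1 t); pickle (f2 t)]) -> comp g.
Proof.
move=> [r rP] [q1 q1P] [q2 q2P] gE; exists (RComp r [:: q1; q2]) => t.
apply: (@EvComp _ _ _ [:: pickle (f1 t); pickle (f2 t)]).
  by apply: EvCons; [apply: q1P | apply: EvCons; [apply: q2P | apply: EvNil]].
by rewrite gE; apply: rP.
Qed.

Lemma comp_const T U (u : U) : comp (fun _ : T => u).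
Proof. by have [r rP] := rf_const 1 (pickle u); exists r => t; apply: rP. Qed.

Lemma comp_pair T U V (f : T -> U) (g : T -> V) :
  comp f -> comp g -> comp (fun t => (f t, g t)).
Proof.
move=> cf cg; apply: (comp_rf2 (rf_comp2 rf_cons (rf_proj (isT : 0 < 2))
  (rf_comp2 rf_cons (rf_proj (isT : 1 < 2)) (rf_const 2 0))) cf cg).
by move=> t; rewrite pickle_pair.
Qed.

Lemma comp_fst T U V (f : T -> U * V) : comp f -> comp (fun t => (f t).1).
Proof.
move=> cf; apply: (comp_rf1 rf_cd_head cf) => t /=; case: (f t) => a b.
by rewrite pickle_pair cd_headK.
Qed.

Lemma comp_snd T U V (f : T -> U * V) : comp f -> comp (fun t => (f t).2).
Proof.
move=> cf; apply: (comp_rf1 (rf_comp1 rf_cd_head rf_cd_behead) cf) => t /=.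
by case: (f t) => a b; rewrite pickle_pair cd_beheadK cd_headK.
Qed.

Lemma comp_nat_rec T U (f : T -> U) (G : T -> nat -> U -> U) (h : T -> nat) :
  comp f -> comp (fun p : T * nat * U => G p.1.1 p.1.2 p.2) -> comp h ->
  comp (fun t => nat_rect (fun=> U) (f t) (G t) (h t)).
Proof.
move=> [r0 r0P] [rg rgP] [rh rhP].
(* [RPrim] passes counter, accumulator and parameter as separate arguments; [q] packs them into the
   code of the triple that [G] expects. *)
have [q qP] : rf 3 (fun xs => cd_cons (cd_cons (nth 0 xs 2) (cd_cons (nth 0 xs 0) 0))
    (cd_cons (nth 0 xs 1) 0)).
  apply: (@rf_comp2 3 (fun xs => cd_cons (nth 0 xs 0) (nth 0 xs 1))
    (fun xs => cd_cons (nth 0 xs 2) (cd_cons (nth 0 xs 0) 0))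
    (fun xs => cd_cons (nth 0 xs 1) 0)); first exact: rf_cons.
    apply: (rf_comp2 rf_cons (rf_proj (isT : 2 < 3))).
    exact: (rf_comp2 rf_cons (rf_proj (isT : 0 < 3)) (rf_const 3 0)).
  exact: (rf_comp2 rf_cons (rf_proj (isT : 1 < 3)) (rf_const 3 0)).
exists (RComp (RPrim r0 (RComp rg [:: q])) [:: rh; RProj 0]) => t.
apply: (@EvComp _ _ _ [:: h t; pickle t]).
  apply: EvCons; first exact: rhP.
  by apply: EvCons; [apply: EvProj | apply: EvNil].
elim: (h t) => [|k IHk] /=; first exact/EvPrim0/r0P.
apply: EvPrimS IHk _; set y := nat_rect _ _ _ _.
apply: (@EvComp _ _ _ [:: pickle (t, k, y)]); last exact: (rgP (t, k, y)).
by apply: EvCons; [apply: (qP [:: k; pickle y; pickle t]) | apply: EvNil].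
Qed.

Lemma comp_search T (P : T -> nat -> bool) :
  comp (fun p : T * nat => P p.1 p.2) ->
  exists r, forall t k, P t k -> (forall i, i < k -> ~~ P t i) ->
    reval r [:: pickle t] k.
Proof.
move=> [r rP].
have [q qP] : rf 2 (fun xs => cd_cons (nth 0 xs 1) (cd_cons (nth 0 xs 0) 0)).
  apply: (rf_comp2 rf_cons (rf_proj (isT : 1 < 2))).
  exact: (rf_comp2 rf_cons (rf_proj (isT : 0 < 2)) (rf_const 2 0)).
have [nr nrP] := rf_comp2 rf_sub (rf_const 1 1) (rf_proj (isT : 0 < 1)).
pose pr := RComp nr [:: RComp r [:: q]].
have prP t i : reval pr [:: i; pickle t] (~~ P t i).
  apply: (@EvComp _ _ _ [:: P t i : nat]); last first.
    by have := nrP [:: P t i : nat] erefl; case: (P t i).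
  apply: EvCons; last exact: EvNil.
  apply: (@EvComp _ _ _ [:: pickle (t, i)]); last exact: (rP (t, i)).
  by apply: EvCons; [apply: (qP [:: i; pickle t]) | apply: EvNil].
exists (RMin pr) => t k Pk Pi; apply: (@EvMin _ _ _ (fun=> 0)).
  by move=> i /Pi; have := prP t i; case: (P t i).
by have := prP t k; rewrite Pk.
Qed.

Lemma comp_mu T (P : T -> nat -> bool) (f : T -> nat) :
  comp (fun p : T * nat => P p.1 p.2) -> (forall t, P t (f t)) ->
  (forall t i, i < f t -> ~~ P t i) -> comp f.
Proof.
move=> /comp_search[r rP] Pf Pi; exists r => t; apply: rP => // i; exact: Pi.
Qed.

Lemma comp_if T U (b : T -> bool) (f g : T -> U) :
  comp b -> comp f -> comp g -> comp (fun t => if b t then f t else g t).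
Proof.
move=> cb cf cg; have cb' : comp (fun t => b t : nat) by case: cb => r rP; exists r.
apply: (comp_ext _ (comp_nat_rec cg (G := fun t _ _ => f t) _ cb')).
  by move=> t; case: (b t).
exact: (comp_comp cf (comp_fst (comp_fst (@comp_id _)))).
Qed.

Lemma comp_succ T (f : T -> nat) : comp f -> comp (fun t => (f t).+1).
Proof. by move=> cf; apply: (comp_rf1 rf_succ cf). Qed.

Lemma comp_add T (f g : T -> nat) : comp f -> comp g -> comp (fun t => f t + g t).
Proof. by move=> cf cg; apply: (comp_rf2 rf_add cf cg). Qed.

Lemma comp_mul T (f g : T -> nat) : comp f -> comp g -> comp (fun t => f t * g t).
Proof. by move=> cf cg; apply: (comp_rf2 rf_mul cf cg). Qed.

Lemma comp_sub T (f g : T -> nat) : comp f -> comp g -> comp (fun t => f t - g t).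
Proof. by move=> cf cg; apply: (comp_rf2 rf_sub cf cg). Qed.

Lemma comp_leq T (f g : T -> nat) : comp f -> comp g -> comp (fun t => f t <= g t).
Proof.
move=> cf cg; apply: (comp_rf2 (rf_comp2 rf_sub (rf_const 2 1) rf_sub) cf cg) => t.
by rewrite pickle_bool /=; rewrite /leq; case: (_ - _).
Qed.

Lemma comp_negb T (f : T -> bool) : comp f -> comp (fun t => ~~ f t).
Proof.
move=> cf; apply: (comp_rf1 (rf_comp2 rf_sub (rf_const 1 1) (rf_proj (isT : 0 < 1))) cf).
by move=> t /=; case: (f t).
Qed.

Lemma comp_andb T (f g : T -> bool) : comp f -> comp g -> comp (fun t => f t && g t).
Proof.
move=> cf cg; apply: comp_ext (comp_if cf cg (@comp_const _ _ false)) => t.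
by case: (f t).
Qed.

Lemma comp_orb T (f g : T -> bool) : comp f -> comp g -> comp (fun t => f t || g t).
Proof.
move=> cf cg; apply: comp_ext (comp_if cf (@comp_const _ _ true) cg) => t.
by case: (f t).
Qed.

(** Equality is equality of codes, and two numbers agree when both truncated differences vanish. *)
Lemma comp_eq T U (f g : T -> U) : comp f -> comp g -> comp (fun t => f t == g t).
Proof.
move=> cf cg; apply: (comp_rf2 (rf_comp2 rf_sub (rf_const 2 1)
  (rf_comp2 rf_add rf_sub (rf_comp2 rf_sub (rf_proj (isT : 1 < 2)) (rf_proj (isT : 0 < 2)))))
  cf cg) => t /=.
rewrite pickle_bool -(inj_eq (pcan_inj pickleK)) /=.
by case: (ltngtP (pickle (f t)) (pickle (g t))) => /=; lia.
Qed.

Lemma comp_cons T U (f : T -> U) (g : T -> seq U) :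
  comp f -> comp g -> comp (fun t => f t :: g t).
Proof. by move=> cf cg; apply: (comp_rf2 rf_cons cf cg) => t; rewrite pickle_cons. Qed.

Lemma comp_behead T U (f : T -> seq U) : comp f -> comp (fun t => behead (f t)).
Proof.
move=> cf; apply: (comp_rf1 rf_cd_behead cf) => t; case: (f t) => // a s.
by rewrite pickle_cons /= cd_beheadK.
Qed.

Lemma comp_head T U (x0 : U) (f : T -> seq U) : comp f -> comp (fun t => head x0 (f t)).
Proof.
move=> cf; apply: (comp_rf1 (rf_comp2 rf_add (rf_comp2 rf_mul (rf_comp2 rf_sub
  (rf_const 1 1) (rf_proj (isT : 0 < 1))) (rf_const 1 (pickle x0))) rf_cd_head) cf).
have E0 : pickle ([::] : seq U) = 0 by [].
move=> t /=; case: (f t) => [|a s]; first by rewrite E0 /= subn0 mul1n addn0.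
rewrite pickle_cons cd_headK /= (_ : 1 - _ = 0) //.
by apply/eqP; rewrite subn_eq0 muln_gt0 expn_gt0.
Qed.

Lemma comp_drop T U (i : T -> nat) (s : T -> seq U) :
  comp i -> comp s -> comp (fun t => drop (i t) (s t)).
Proof.
move=> ci cs; apply: comp_ext (comp_nat_rec cs (G := fun _ _ a => behead a) _ ci).
  move=> t; elim: (i t) => [|k /= ->]; first by rewrite drop0.
  by rewrite -drop1 drop_drop add1n.
exact/comp_behead/comp_snd/comp_id.
Qed.

Lemma comp_nth T U (x0 : U) (s : T -> seq U) (i : T -> nat) :
  comp s -> comp i -> comp (fun t => nth x0 (s t) (i t)).
Proof.
move=> cs ci; apply: comp_ext (comp_head x0 (comp_drop ci cs)) => t.
by rewrite -nth0 nth_drop addn0.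
Qed.

Lemma comp_size T U (s : T -> seq U) : comp s -> comp (fun t => size (s t)).
Proof.
move=> cs; apply: (@comp_mu _ (fun t i => drop i (s t) == [::])).
- apply: comp_eq; last exact: comp_const.
  by apply: comp_drop; [apply/comp_snd/comp_id | apply/(comp_comp cs)/comp_fst/comp_id].
- by move=> t; rewrite drop_size.
- by move=> t i lt_i; rewrite -size_eq0 size_drop subn_eq0 -ltnNge.
Qed.

(** A primitive recursion that reads the list from its end, so that the accumulator is the fold over
    the suffix already read. *)
Lemma comp_foldr T U V (u0 : U) (G : T -> U -> V -> V) (z : T -> V) (s : T -> seq U) :
  comp (fun p : T * U * V => G p.1.1 p.1.2 p.2) -> comp z -> comp s ->
  comp (fun t => foldr (G t) (z t) (s t)).
Proof.
move=> cG cz cs.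
have cG' : comp (fun p : T * nat * V =>
    G p.1.1 (nth u0 (s p.1.1) (size (s p.1.1) - p.1.2.+1)) p.2).
  have ct : comp (fun p : T * nat * V => p.1.1) by apply/comp_fst/comp_fst/comp_id.
  have cs' := comp_comp cs ct.
  apply: (@comp_comp _ _ _ (fun p : T * nat * V => (p.1.1,
    nth u0 (s p.1.1) (size (s p.1.1) - p.1.2.+1), p.2)) _ cG).
  apply: comp_pair; last exact/comp_snd/comp_id.
  apply: comp_pair => //; apply: comp_nth => //; apply: comp_sub; first exact: comp_size.
  exact/comp_succ/comp_snd/comp_fst/comp_id.
apply: comp_ext (comp_nat_rec (G := fun t i a =>
  G t (nth u0 (s t) (size (s t) - i.+1)) a) cz cG' (comp_size cs)) => t.
pose F i a := G t (nth u0 (s t) (size (s t) - i.+1)) a; rewrite -/F; suff H k : k <= size (s t) ->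
    nat_rect (fun=> V) (z t) F k = foldr (G t) (z t) (drop (size (s t) - k) (s t)).
  by rewrite H // subnn drop0.
elim: k => [|k IHk] lek; first by rewrite subn0 drop_size.
rewrite /= IHk 1?ltnW // /F [in RHS](drop_nth u0) /= -?subSn ?subSS //.
exact: leq_subr.
Qed.

Lemma comp_mkseq T U (F : T -> nat -> U) (n : T -> nat) :
  comp (fun p : T * nat => F p.1 p.2) -> comp n ->
  comp (fun t => mkseq (F t) (n t)).
Proof.
move=> cF cn.
have cG : comp (fun p : T * nat * seq U => F p.1.1 (n p.1.1 - p.1.2.+1) :: p.2).
  have ct : comp (fun p : T * nat * seq U => p.1.1) by apply/comp_fst/comp_fst/comp_id.
  apply: comp_cons; last exact/comp_snd/comp_id.
  apply: (@comp_comp _ _ _ (fun p : T * nat * seq U => (p.1.1, n p.1.1 - p.1.2.+1)) _ cF).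
  apply: comp_pair => //; apply: comp_sub; first exact: (comp_comp cn ct).
  exact/comp_succ/comp_snd/comp_fst/comp_id.
apply: comp_ext (comp_nat_rec (@comp_const _ _ [::]) (G := fun t i a =>
  F t (n t - i.+1) :: a) cG cn) => t.
suff H k : k <= n t -> nat_rect (fun=> seq U) [::] (fun i a => F t (n t - i.+1) :: a) k
    = map (F t) (iota (n t - k) k) by rewrite H // subnn.
elim: k => // k IHk lek; rewrite /= IHk 1?ltnW //; congr (_ :: map _ (iota _ _)); lia.
Qed.

Lemma comp_cat T U (u0 : U) (f g : T -> seq U) :
  comp f -> comp g -> comp (fun t => f t ++ g t).
Proof.
move=> cf cg; apply: (comp_ext _ (@comp_foldr _ _ _ u0 (fun _ => cons) _ _ _ cg cf)).
  by move=> t; elim: (f t) => //= a s ->.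
by apply: comp_cons; [apply/comp_snd/comp_fst/comp_id | apply/comp_snd/comp_id].
Qed.

Lemma comp_flatten T U (u0 : U) (f : T -> seq (seq U)) :
  comp f -> comp (fun t => flatten (f t)).
Proof.
move=> cf; apply: (@comp_foldr _ _ _ [::] (fun _ => cat)) => //; last exact: comp_const.
by apply: (comp_cat u0); [apply/comp_snd/comp_fst/comp_id | apply/comp_snd/comp_id].
Qed.

Lemma comp_rev T U (u0 : U) (f : T -> seq U) : comp f -> comp (fun t => rev (f t)).
Proof.
move=> cf; have cf' := comp_comp cf (comp_fst (@comp_id (T * nat)%type)).
apply: (comp_ext _ (@comp_mkseq _ _ (fun t i => nth u0 (f t) (size (f t) - i.+1))
  _ _ (comp_size cf))).
  move=> t; apply: (@eq_from_nth _ u0); rewrite size_mkseq ?size_rev // => i ilt.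
  by rewrite nth_mkseq // nth_rev.
apply: comp_nth => //; apply: comp_sub; first exact: comp_size.
exact/comp_succ/comp_snd/comp_id.
Qed.

Lemma comp_all T (P : T -> nat -> bool) (n : T -> nat) :
  comp (fun p : T * nat => P p.1 p.2) -> comp n ->
  comp (fun t => all (P t) (iota 0 (n t))).
Proof.
move=> cP cn; have cG : comp (fun p : T * nat * bool => P p.1.1 p.1.2 && p.2).
  apply: comp_andb; last exact/comp_snd/comp_id.
  exact: (comp_comp cP (comp_fst (@comp_id _))).
apply: comp_ext (comp_nat_rec (@comp_const _ _ true) (G := fun t i a => P t i && a) cG cn).
by move=> t; elim: (n t) => // k IHk; rewrite iota0S all_cat -IHk /= andbT andbC.
Qed.

Lemma comp_has T (P : T -> nat -> bool) (n : T -> nat) :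
  comp (fun p : T * nat => P p.1 p.2) -> comp n ->
  comp (fun t => has (P t) (iota 0 (n t))).
Proof.
move=> cP cn; apply: comp_ext (comp_negb (@comp_all _ (fun t i => ~~ P t i) _
  (comp_negb cP) cn)) => t /=.
by rewrite -[RHS]negbK -all_predC.
Qed.

Lemma comp_count T (P : T -> nat -> bool) (n : T -> nat) :
  comp (fun p : T * nat => P p.1 p.2) -> comp n ->
  comp (fun t => count (P t) (iota 0 (n t))).
Proof.
move=> cP cn; have cG : comp (fun p : T * nat * nat => P p.1.1 p.1.2 + p.2).
  apply: comp_add; last exact/comp_snd/comp_id.
  have [r rP] : comp (fun p : T * nat * nat => P p.1.1 p.1.2); last by exists r.
  exact: (comp_comp cP (comp_fst (@comp_id _))).
apply: comp_ext (comp_nat_rec (@comp_const _ _ 0) (G := fun t i a => P t i + a) cG cn).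
by move=> t; elim: (n t) => // k IHk; rewrite iota0S count_cat -IHk /= addn0 addnC.
Qed.

Lemma comp_find T (P : T -> nat -> bool) (n : T -> nat) :
  comp (fun p : T * nat => P p.1 p.2) -> comp n ->
  comp (fun t => find (P t) (iota 0 (n t))).
Proof.
move=> cP cn; apply: (@comp_mu _ (fun t i => (n t <= i) || P t i)).
- apply: comp_orb => //; apply: comp_leq; last exact/comp_snd/comp_id.
  exact: (comp_comp cn (comp_fst (@comp_id _))).
- move=> t; case: leqP => //= lt_f; rewrite -[X in P t X](nth_iota 0 0 lt_f) //.
  by apply: nth_find; rewrite has_find size_iota.
- move=> t i lt_i; have lt_in : i < n t.
    by apply: leq_trans lt_i _; have := find_size (P t) (iota 0 (n t)); rewrite size_iota.
  rewrite negb_or -ltnNge lt_in /=; have := before_find 0 lt_i.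
  by rewrite nth_iota // => ->.
Qed.

Lemma comp_Posz T (f : T -> nat) : comp f -> comp (fun t => Posz (f t)).
Proof.
move=> cf; apply: (comp_rf1 (rf_comp2 rf_cons (rf_comp2 rf_cons (rf_proj (isT : 0 < 1))
  (rf_const 1 0)) (rf_const 1 (cd_cons 0 0))) cf) => t; exact: pickle_Posz.
Qed.

Lemma comp_Negz T (f : T -> nat) : comp f -> comp (fun t => Negz (f t)).
Proof.
move=> cf; apply: (comp_rf1 (rf_comp2 rf_cons (rf_const 1 0) (rf_comp2 rf_cons
  (rf_comp2 rf_cons (rf_proj (isT : 0 < 1)) (rf_const 1 0)) (rf_const 1 0))) cf) => t.
exact: pickle_Negz.
Qed.

Lemma comp_iter T U (h : T -> nat) (F : T -> U -> U) (f : T -> U) :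
  comp h -> comp (fun p : T * U => F p.1 p.2) -> comp f ->
  comp (fun t => iter (h t) (F t) (f t)).
Proof.
move=> ch cF cf; have cG : comp (fun p : T * nat * U => F p.1.1 p.2).
  apply: (@comp_comp _ _ _ (fun p : T * nat * U => (p.1.1, p.2)) _ cF).
  by apply: comp_pair; [apply/comp_fst/comp_fst/comp_id | apply/comp_snd/comp_id].
apply: comp_ext (comp_nat_rec (G := fun t _ => F t) cf cG ch) => t.
by elim: (h t) => //= k ->.
Qed.

Definition onat (o : option nat) := if o is Some k then k.+1 else 0.

Lemma comp_onat T (f : T -> option nat) : comp f -> comp (fun t => onat (f t)).
Proof.
move=> cf; apply: (comp_rf1 (rf_comp2 rf_mul (rf_comp2 rf_sub (rf_const 1 1)
  (rf_comp2 rf_sub (rf_const 1 1) (rf_proj (isT : 0 < 1)))) (rf_comp1 rf_succ rf_cd_head))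
  cf) => t /=; case: (f t) => [k|] //=.
rewrite pickle_some cd_headK (_ : 1 - cd_cons k 0 = 0) ?mul1n //.
by apply/eqP; rewrite subn_eq0 muln_gt0 expn_gt0.
Qed.

(** On lists of numbers [pickle] is [CodeSeq.code], so at the level of codes decoding is the
    identity. *)
Lemma comp_decode T (f : T -> nat) : comp f -> comp (fun t => CodeSeq.decode (f t)).
Proof.
case=> r rP; exists r => t.
suff -> : pickle (CodeSeq.decode (f t)) = f t by apply: rP.
by rewrite -[RHS]CodeSeq.decodeK -[pickle _]/(CodeSeq.code (map id _)) map_id.
Qed.

Lemma comp_intr T (f : T -> int) : comp f -> comp (fun t => (f t)%:~R%R : rat).
Proof.
move=> cf; have [r rP] := comp_pair cf (@comp_const T int 1%:Z%R).
by exists r => t; rewrite pickle_intr.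
Qed.

Lemma comp_subz T (f g : T -> nat) : comp f -> comp g ->
  comp (fun t => ((f t)%:Z - (g t)%:Z)%R).
Proof.
move=> cf cg; apply: (comp_ext _ (comp_if (comp_leq cg cf) (comp_Posz (comp_sub cf cg))
  (comp_Negz (comp_sub cg (comp_succ cf))))) => t.
by case: leqP => fg; rewrite ?NegzE; lia.
Qed.
End Comp.

Definition ipoint (a b c d : nat) : rat * rat :=
  ((a%:Z - b%:Z)%:~R, (c%:Z - d%:Z)%:~R)%R.

(** * The layout *)

Section Layout.
Variables (n nd : nat) (ord da db : nat -> nat).

(* ord lists the vertices from left to right, the positions p < nd are the    *)
(* darts (da p, db p). Vertex v is drawn at abscissa lx v, the part of the    *)
(* dart p that runs past the vertices has height lh p, the part that comes    *)
(* back to its vertex has height lt p; a strand of height h passes above the  *)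
(* vertex at abscissa i if ly i < h and below it if h < ly i.                 *)
Definition lx v := (find (fun i => ord i == v) (iota 0 n)).+1.
Definition lfirst v := find (fun p => da p == v) (iota 0 nd).
(** The gaps of [nd.+2] leave room, below the first dart of a vertex, for the level of the vertex
    and for the returning strands of all its darts. *)
Definition lbase p := nd.+2 * p.+1.
Definition lyv v := lbase (lfirst v) - 1.
Definition ly i := if (0 < i) && (i <= n) then lyv (ord i.-1) else 0.
Definition lh p := lbase p.
(** Just below the level of the vertex, later darts lower: of two darts at a vertex, the later one
    leaves higher and returns lower, so their turns at the left are nested. *)
Definition lt p := lbase (lfirst (da p)) - 2 - (p - lfirst (da p)).
(** Half of the scale is an integer so that the apex of a turn, halfway between two heights, has
    integer coordinates. The size dominates the product of the largest half-height of a rectangle,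
    at most [n], and the largest height of a strand; [Sc_big] is the estimate that results. *)
Definition lhalf := 8 * n * lbase nd.+1 + 8.
Definition lscale := 2 * lhalf.
Definition lpoint h i := ipoint (lscale * i) 0 (lscale * h) (lscale * ly i).
Definition lvertex v := ipoint (lscale * lx v) 0 0 0.
Definition lleft p := ipoint 0 (lh p - lt p) (lhalf * (lh p + lt p)) 0.
Definition lright p q :=
  ipoint (lscale * n.+1 + ((lh p - lh q) + (lh q - lh p))) 0 (lhalf * (lh p + lh q)) 0.
Definition ltstrand p := mkseq (lpoint (lt p)) (lx (da p)).
Definition lhstrand p := mkseq (lpoint (lh p)) n.+2.
Definition ldart p := lvertex (da p) :: rev (ltstrand p) ++ lleft p :: lhstrand p.
Definition ldpos u v := find (fun p => (da p == u) && (db p == v)) (iota 0 nd).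
Definition ledge u v :=
  ldart (ldpos u v) ++ lright (ldpos u v) (ldpos v u) :: rev (ldart (ldpos v u)).

Variable inc : nat -> bool.
Definition lstart := (find (fun i => inc (ord i)) (iota 0 n)).+1.
Definition lcard := count (fun i => inc (ord i)) (iota 0 n).
(** The half-height is the size of the cluster, so that a proper subcluster has a strictly smaller
    rectangle. The horizontal margin of twice that size lies beyond the crossings of the strands
    ending in the outer vertices and short of all other crossings. *)
Definition lregion :=
  let x1 := lscale * lstart in let x2 := lscale * (lstart + lcard - 1) + 2 * lcard in
  [:: ipoint x1 (2 * lcard) 0 lcard; ipoint x2 0 0 lcard; ipoint x2 0 lcard 0;
      ipoint x1 (2 * lcard) lcard 0].
Definition linterval :=
  all (fun i => inc (ord i) == (lstart <= i.+1) && (i.+1 < lstart + lcard)) (iota 0 n).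
End Layout.

(** * Checking a certificate and searching for one *)

Section Check.
Variables (n nd : nat) (ord da db : nat -> nat) (adj : nat -> nat -> bool).

Definition ord_ok := all (fun v => has (fun i => ord i == v) (iota 0 n)) (iota 0 n).
Definition darts_ok := all (fun u => all (fun v => ~~ adj u v ||
  has (fun p => (da p == u) && (db p == v)) (iota 0 nd)) (iota 0 n)) (iota 0 n) &&
  all (fun p => da p < n) (iota 0 nd).
Definition samev i j := da i == da j.
Definition samee i j :=
  ((da i == da j) && (db i == db j)) || ((da i == db j) && (db i == da j)).
Definition nc_ok (r : nat -> nat -> bool) :=
  all (fun i => all (fun j => all (fun k => all (fun l =>
    ~~ ((i < j) && (j < k) && (k < l) && r i k && r j l) || r i j)
    (iota 0 nd)) (iota 0 nd)) (iota 0 nd)) (iota 0 nd).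
End Check.

Notation input :=
  (nat * nat * seq bool * seq (option nat) * seq (option nat))%type.

Definition in_n (x : input) := x.1.1.1.1.
Definition in_m (x : input) := x.1.1.1.2.
Definition in_adj (x : input) u v := nth false x.1.1.2 (u * in_n x + v).
(** Parents are coded by numbers with 0 for none; the [None] in front of the list keeps 0 at 0. The
    number of internal nodes bounds the length of a chain of ancestors. *)
Definition in_inc (x : input) mu v := has (fun j =>
  iter j (fun a => onat (nth None (None :: x.2) a)) (onat (nth None x.1.2 v)) == mu.+1)
  (iota 0 (in_m x)).

(** A certificate is one list: the number of darts, the vertices from left to right, then the two
    ends of each dart in turn. *)
Definition c_nd (c : seq nat) := nth 0 c 0.
Definition c_ord (c : seq nat) i := nth 0 c i.+1.
Definition c_da (x : input) (c : seq nat) p := nth 0 c ((in_n x).+1 + (p + p)).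
Definition c_db (x : input) (c : seq nat) p := nth 0 c ((in_n x).+2 + (p + p)).

Definition check (x : input) (c : seq nat) :=
  [&& ord_ok (in_n x) (c_ord c),
      darts_ok (in_n x) (c_nd c) (c_da x c) (c_db x c) (in_adj x),
      nc_ok (c_nd c) (samev (c_da x c)), nc_ok (c_nd c) (samee (c_da x c) (c_db x c))
    & all (fun mu => linterval (in_n x) (c_ord c) (in_inc x mu)) (iota 0 (in_m x))].

Definition build (x : input) (c : seq nat) :=
  let n := in_n x in let nd := c_nd c in let ord := c_ord c in
  let da := c_da x c in let db := c_db x c in
  (mkseq (lvertex n nd ord) n,
   flatten (mkseq (fun u => mkseq (fun v => ledge n nd ord da db u v) n) n),
   mkseq (fun mu => lregion n nd ord (in_inc x mu)) (in_m x)).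

Ltac comp_step := lazymatch goal with
  | |- comp (fun t => t) => exact: comp_id
  | |- comp (fun _ => ?c) => exact: comp_const
  | |- comp fst => exact: (comp_fst (@comp_id _))
  | |- comp snd => exact: (comp_snd (@comp_id _))
  | |- comp (fun t => fst _) => apply: comp_fst
  | |- comp (fun t => snd _) => apply: comp_snd
  | |- comp (fun t => (_, _)) => apply: comp_pair
  | |- comp (fun t => _ + _) => apply: comp_add
  | |- comp (fun t => _ * _) => apply: comp_mul
  | |- comp (fun t => _ - _) => apply: comp_sub
  | |- comp (fun t => _.+1) => apply: comp_succ
  | |- comp (fun t => _ <= _) => apply: comp_leq
  | |- comp (fun t => ~~ _) => apply: comp_negb
  | |- comp (fun t => _ && _) => apply: comp_andb
  | |- comp (fun t => _ || _) => apply: comp_orb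
  | |- comp (fun t => _ == _) => apply: comp_eq
  | |- comp (fun t => if _ then _ else _) => apply: comp_if
  | |- comp (fun t => nth _ _ _) => apply: comp_nth
  | |- comp (fun t => all _ (iota 0 _)) => apply: comp_all
  | |- comp (fun t => has _ (iota 0 _)) => apply: comp_has
  | |- comp (fun t => count _ (iota 0 _)) => apply: comp_count
  | |- comp (fun t => find _ (iota 0 _)) => apply: comp_find
  | |- comp (fun t => iter _ _ _) => apply: comp_iter
  | |- comp (fun t => mkseq _ _) => apply: comp_mkseq
  | |- comp (fun t => onat _) => apply: comp_onat
  | |- comp (fun t => _ :: _) => apply: comp_cons
  | H : comp ?x |- comp ?x => exact: H
  | H : comp ?x |- comp (fun t => ?x t) => exact: H
  | H : comp ?x |- comp (fun p => ?x (@?f p)) => apply: (comp_comp H)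
  end.
Ltac comp_tac := repeat (comp_step; cbv beta).

Lemma comp_point (T : countType) (f g h k : T -> nat) :
  comp f -> comp g -> comp h -> comp k ->
  comp (fun t => ipoint (f t) (g t) (h t) (k t)).
Proof.
move=> cf cg ch ck; apply: comp_pair; apply: comp_intr; exact: comp_subz.
Qed.

Section CompLayout.
Variables (T : countType) (x : T -> input) (c : T -> seq nat).
Hypotheses (cx : comp x) (cc : comp c).
Implicit Types (f g h k : T -> nat).

Lemma comp_in_n : comp (fun t => in_n (x t)).
Proof. by rewrite /in_n; comp_tac. Qed.

Lemma comp_in_m : comp (fun t => in_m (x t)).
Proof. by rewrite /in_m; comp_tac. Qed.

Lemma comp_in_adj f g : comp f -> comp g -> comp (fun t => in_adj (x t) (f t) (g t)).
Proof. by move=> cf cg; rewrite /in_adj /in_n; comp_tac. Qed.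

Lemma comp_in_inc f g : comp f -> comp g -> comp (fun t => in_inc (x t) (f t) (g t)).
Proof. by move=> cf cg; rewrite /in_inc /in_m; comp_tac. Qed.

Lemma comp_c_nd : comp (fun t => c_nd (c t)).
Proof. by rewrite /c_nd; comp_tac. Qed.

Lemma comp_c_ord f : comp f -> comp (fun t => c_ord (c t) (f t)).
Proof. by move=> cf; rewrite /c_ord; comp_tac. Qed.

Lemma comp_c_da f : comp f -> comp (fun t => c_da (x t) (c t) (f t)).
Proof. by move=> cf; rewrite /c_da /in_n; comp_tac. Qed.

Lemma comp_c_db f : comp f -> comp (fun t => c_db (x t) (c t) (f t)).
Proof. by move=> cf; rewrite /c_db /in_n; comp_tac. Qed.
End CompLayout.

Ltac comp_step2 := lazymatch goal with
  | |- comp (fun t => in_n _) => apply: comp_in_n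
  | |- comp (fun t => in_m _) => apply: comp_in_m
  | |- comp (fun t => in_adj _ _ _) => apply: comp_in_adj
  | |- comp (fun t => in_inc _ _ _) => apply: comp_in_inc
  | |- comp (fun t => c_nd _) => apply: comp_c_nd
  | |- comp (fun t => c_ord _ _) => apply: comp_c_ord
  | |- comp (fun t => c_da _ _ _) => apply: comp_c_da
  | |- comp (fun t => c_db _ _ _) => apply: comp_c_db
  | |- comp (fun t => ipoint _ _ _ _) => apply: comp_point
  | H : comp ?x |- comp ?x => exact: H
  | _ => comp_step
  end.
Ltac comp_tac2 := repeat (comp_step2; cbv beta).

Section CompLayout2.
Variables (T : countType) (x : T -> input) (c : T -> seq nat).
Hypotheses (cx : comp x) (cc : comp c).
Implicit Types (f g h k : T -> nat).

Lemma comp_lx f : comp f -> comp (fun t => lx (in_n (x t)) (c_ord (c t)) (f t)).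
Proof. by move=> cf; rewrite /lx; comp_tac2. Qed.

Lemma comp_lfirst f : comp f -> comp (fun t => lfirst (c_nd (c t)) (c_da (x t) (c t)) (f t)).
Proof. by move=> cf; rewrite /lfirst; comp_tac2. Qed.

Lemma comp_lbase f : comp f -> comp (fun t => lbase (c_nd (c t)) (f t)).
Proof. by move=> cf; rewrite /lbase; comp_tac2. Qed.

Lemma comp_lyv f : comp f -> comp (fun t => lyv (c_nd (c t)) (c_da (x t) (c t)) (f t)).
Proof.
by move=> cf; rewrite /lyv; apply: comp_sub; [apply/comp_lbase/comp_lfirst | comp_tac2].
Qed.

Lemma comp_ly f : comp f ->
  comp (fun t => ly (in_n (x t)) (c_nd (c t)) (c_ord (c t)) (c_da (x t) (c t)) (f t)).
Proof.
move=> cf; rewrite /ly; apply: comp_if; [by comp_tac2 | | by comp_tac2].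
apply/comp_lyv/comp_c_ord => //.
by apply: comp_ext (comp_sub cf (@comp_const _ _ 1)) => t; rewrite subn1.
Qed.

Lemma comp_lt f : comp f -> comp (fun t => lt (c_nd (c t)) (c_da (x t) (c t)) (f t)).
Proof.
move=> cf; have cd : comp (fun t => c_da (x t) (c t) (f t)) by comp_tac2.
rewrite /lt; apply: comp_sub; first apply: comp_sub; try by comp_tac2.
  exact/comp_lbase/comp_lfirst.
by apply: comp_sub => //; apply: comp_lfirst.
Qed.

Lemma comp_lhalf : comp (fun t => lhalf (in_n (x t)) (c_nd (c t))).
Proof. by rewrite /lhalf /lbase; comp_tac2. Qed.

Lemma comp_lscale : comp (fun t => lscale (in_n (x t)) (c_nd (c t))).
Proof. by rewrite /lscale /lhalf /lbase; comp_tac2. Qed.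

Lemma comp_lpoint f g : comp f -> comp g ->
  comp (fun t => lpoint (in_n (x t)) (c_nd (c t)) (c_ord (c t)) (c_da (x t) (c t))
    (f t) (g t)).
Proof.
move=> cf cg; have := comp_ly cg; have := comp_lscale => cs cy.
by rewrite /lpoint; apply: comp_point; comp_tac2.
Qed.

Lemma comp_lvertex f : comp f ->
  comp (fun t => lvertex (in_n (x t)) (c_nd (c t)) (c_ord (c t)) (f t)).
Proof.
move=> cf; have := comp_lx cf; have := comp_lscale => cs cl.
by rewrite /lvertex; apply: comp_point; comp_tac2.
Qed.

Lemma comp_lleft f : comp f ->
  comp (fun t => lleft (in_n (x t)) (c_nd (c t)) (c_da (x t) (c t)) (f t)).
Proof.
move=> cf; have := comp_lt cf; have := comp_lbase cf; have := comp_lhalf => cs ch cl.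
by rewrite /lleft /lh; apply: comp_point; comp_tac2.
Qed.

Lemma comp_lright f g : comp f -> comp g ->
  comp (fun t => lright (in_n (x t)) (c_nd (c t)) (f t) (g t)).
Proof.
move=> cf cg; have cf' := comp_lbase cf; have cg' := comp_lbase cg.
have cs := comp_lscale; have ch := comp_lhalf.
by rewrite /lright /lh; apply: comp_point; comp_tac2.
Qed.

Lemma comp_ldpos f g : comp f -> comp g ->
  comp (fun t => ldpos (c_nd (c t)) (c_da (x t) (c t)) (c_db (x t) (c t)) (f t) (g t)).
Proof. by move=> cf cg; rewrite /ldpos; comp_tac2. Qed.

Lemma comp_lcard (P : T -> nat -> bool) : comp (fun p : T * nat => P p.1 p.2) ->
  comp (fun t => lcard (in_n (x t)) (c_ord (c t)) (P t)).
Proof.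
move=> cP; rewrite /lcard; apply: comp_count; last by comp_tac2.
apply: (@comp_comp _ _ _ (fun p : T * nat => (p.1, c_ord (c p.1) p.2)) _ cP).
by comp_tac2.
Qed.

Lemma comp_lstart (P : T -> nat -> bool) : comp (fun p : T * nat => P p.1 p.2) ->
  comp (fun t => lstart (in_n (x t)) (c_ord (c t)) (P t)).
Proof.
move=> cP; rewrite /lstart; apply/comp_succ/comp_find; last by comp_tac2.
apply: (@comp_comp _ _ _ (fun p : T * nat => (p.1, c_ord (c p.1) p.2)) _ cP).
by comp_tac2.
Qed.

Lemma comp_lregion f : comp f ->
  comp (fun t => lregion (in_n (x t)) (c_nd (c t)) (c_ord (c t)) (in_inc (x t) (f t))).
Proof.
move=> cf; have cP : comp (fun p : T * nat => in_inc (x p.1) (f p.1) p.2) by comp_tac2.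
pose P t v := in_inc (x t) (f t) v; have ca := @comp_lstart P cP; have cb := @comp_lcard P cP; have cs := comp_lscale.
by rewrite /lregion; cbv zeta; rewrite -/(P _); comp_tac2.
Qed.

Lemma comp_linterval f : comp f ->
  comp (fun t => linterval (in_n (x t)) (c_ord (c t)) (in_inc (x t) (f t))).
Proof.
move=> cf; have cP : comp (fun p : T * nat => in_inc (x p.1) (f p.1) p.2) by comp_tac2.
pose P t v := in_inc (x t) (f t) v; have ca := @comp_lstart P cP; have cb := @comp_lcard P cP.
have ca' : comp (fun p : T * nat => lstart (in_n (x p.1)) (c_ord (c p.1)) (P p.1)).
  exact: (comp_comp ca (comp_fst (@comp_id _))).
have cb' : comp (fun p : T * nat => lcard (in_n (x p.1)) (c_ord (c p.1)) (P p.1)).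
  exact: (comp_comp cb (comp_fst (@comp_id _))).
rewrite /linterval; apply: comp_all; last by comp_tac2.
apply: comp_eq; first by comp_tac2.
apply: comp_andb; apply: comp_leq; rewrite ?addnS; first exact: ca'.
- by comp_tac2.
- by comp_tac2.
- exact: (comp_add ca' cb').
Qed.
End CompLayout2.

Section CompLayout3.
Variables (T : countType) (x : T -> input) (c : T -> seq nat).
Hypotheses (cx : comp x) (cc : comp c).
Implicit Types (f g h k : T -> nat).

Lemma comp_ltstrand f : comp f -> comp (fun t => ltstrand (in_n (x t)) (c_nd (c t))
  (c_ord (c t)) (c_da (x t) (c t)) (f t)).
Proof.
move=> cf; have cd : comp (fun t => c_da (x t) (c t) (f t)) by comp_tac2.
have cl := comp_lt cx cc cf; rewrite /ltstrand; apply: comp_mkseq; last exact: comp_lx.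
by apply: comp_lpoint; first [exact: (comp_comp cl (comp_fst (@comp_id _))) | comp_tac2].
Qed.

Lemma comp_lhstrand f : comp f -> comp (fun t => lhstrand (in_n (x t)) (c_nd (c t))
  (c_ord (c t)) (c_da (x t) (c t)) (f t)).
Proof.
move=> cf; have cl := comp_lbase cc cf; rewrite /lhstrand; apply: comp_mkseq; last by comp_tac2.
by apply: comp_lpoint; first [exact: (comp_comp cl (comp_fst (@comp_id _))) | comp_tac2].
Qed.

Lemma comp_ldart f : comp f -> comp (fun t => ldart (in_n (x t)) (c_nd (c t))
  (c_ord (c t)) (c_da (x t) (c t)) (f t)).
Proof.
move=> cf; have cd : comp (fun t => c_da (x t) (c t) (f t)) by comp_tac2.
rewrite /ldart; apply: comp_cons; first exact: comp_lvertex.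
apply: (comp_cat (0, 0)%R).
  by apply: (comp_rev (0, 0)%R); apply: comp_ltstrand.
by apply: comp_cons; [apply: comp_lleft | apply: comp_lhstrand].
Qed.
End CompLayout3.

Lemma comp_ledge (T : countType) (x : T -> input) (c : T -> seq nat) (f g : T -> nat) :
  comp x -> comp c -> comp f -> comp g -> comp (fun t => ledge (in_n (x t))
    (c_nd (c t)) (c_ord (c t)) (c_da (x t) (c t)) (c_db (x t) (c t)) (f t) (g t)).
Proof.
move=> cx cc cf cg; have c1 := comp_ldpos cx cc cf cg; have c2 := comp_ldpos cx cc cg cf.
rewrite /ledge; apply: (comp_cat (0, 0)%R); first exact: comp_ldart.
apply: comp_cons; first exact: comp_lright.
by apply: (comp_rev (0, 0)%R); apply: comp_ldart.
Qed.

Lemma comp_nc_ok (T : countType) (n : T -> nat) (r : T -> nat -> nat -> bool) :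
  comp n -> comp (fun p : T * nat * nat => r p.1.1 p.1.2 p.2) ->
  comp (fun t => nc_ok (n t) (r t)).
Proof.
move=> cn cr; rewrite /nc_ok.
have cr' (U : countType) (t : U -> T) (f g : U -> nat) :
    comp t -> comp f -> comp g -> comp (fun u => r (t u) (f u) (g u)).
  move=> ct cf cg; apply: (@comp_comp _ _ _ (fun u => (t u, f u, g u)) _ cr).
  by comp_tac2.
do 4![apply: comp_all; last by comp_tac2].
apply: comp_orb; last by apply: cr'; comp_tac2.
by apply: comp_negb; do !apply: comp_andb; try (by apply: cr'; comp_tac2); comp_tac2.
Qed.

Lemma comp_check (T : countType) (x : T -> input) (c : T -> seq nat) :
  comp x -> comp c -> comp (fun t => check (x t) (c t)).
Proof.
move=> cx cc; rewrite /check; do !apply: comp_andb.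
- by rewrite /ord_ok; comp_tac2.
- by comp_tac2.
- by comp_tac2.
- by apply: comp_nc_ok; [comp_tac2 | rewrite /samev; comp_tac2].
- by apply: comp_nc_ok; [comp_tac2 | rewrite /samee; comp_tac2].
- apply: comp_all; last by comp_tac2.
  by apply: comp_linterval; comp_tac2.
Qed.

Lemma comp_build (T : countType) (x : T -> input) (c : T -> seq nat) :
  comp x -> comp c -> comp (fun t => build (x t) (c t)).
Proof.
move=> cx cc; rewrite /build /=; apply: comp_pair; first apply: comp_pair.
- by apply: comp_mkseq; [apply: comp_lvertex; comp_tac2 | comp_tac2].
- apply: (comp_flatten [::]); apply: comp_mkseq; last by comp_tac2.
  apply: comp_mkseq; last by comp_tac2.
  by apply: comp_ledge; comp_tac2.
- by apply: comp_mkseq; [apply: comp_lregion; comp_tac2 | comp_tac2].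
Qed.

(** A single recursive function for all inputs: it finds the least code of a certificate and builds
    the drawing from it. It decides nothing about planarity, as it is only specified when a
    certificate exists. *)
Theorem build_search : exists alg : recfun, forall (x : input),
  (exists c, check x c) ->
  exists c, check x c /\ reval alg [:: pickle x] (pickle (build x c)).
Proof.
have [r rP] := @comp_search input (fun x k => check x (CodeSeq.decode k))
  (comp_check (comp_fst (@comp_id _)) (comp_decode (comp_snd (@comp_id _)))).
have [b bP] := @comp_build (input * nat)%type _ _ (comp_fst (@comp_id _))
  (comp_decode (comp_snd (@comp_id _))).
have [q qP] := rf_comp2 rf_cons (rf_proj (isT : 0 < 2))
  (rf_comp2 rf_cons (rf_proj (isT : 1 < 2)) (rf_const 2 0)).
exists (RComp b [:: RComp q [:: RProj 0; r]]) => x [c cP].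
have ex : exists k, check x (CodeSeq.decode k).
  by exists (CodeSeq.code c); rewrite CodeSeq.codeK.
case: (ex_minnP ex) => k kP kmin; exists (CodeSeq.decode k); split=> //.
apply: (@EvComp _ _ _ [:: pickle (x, k)]); last exact: (bP (x, k)).
apply: EvCons; last exact: EvNil.
apply: (@EvComp _ _ _ [:: pickle x; k]); last exact: (qP [:: pickle x; k]).
apply: EvCons; first exact: EvProj.
apply: EvCons; last exact: EvNil.
by apply: rP => // i ik; apply/negP => /kmin; rewrite leqNgt ik.
Qed.

(** * Combinatorial properties of the layout *)

Section LayoutNat.
Variables (n nd : nat) (ord da db : nat -> nat).
Local Notation lx := (lx n ord).
Local Notation lfirst := (lfirst nd da).
Local Notation lbase := (lbase nd).
Local Notation ly := (ly n nd ord da).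
Local Notation lh := (lh nd).
Local Notation lt := (lt nd da).

Lemma lfirstP p : p < nd -> lfirst (da p) <= p /\ da (lfirst (da p)) = da p.
Proof.
move=> pn; have h : has (fun q => da q == da p) (iota 0 nd).
  by apply/hasP; exists p; rewrite ?mem_iota.
have flt : lfirst (da p) < nd by have := h; rewrite has_find size_iota.
split; last by have := nth_find 0 h; rewrite nth_iota // => /eqP.
rewrite leqNgt; apply/negP=> lt_p; have := before_find 0 lt_p.
by rewrite nth_iota // add0n eqxx.
Qed.

Lemma lbase_lt a b : a < b -> lbase a + nd.+2 <= lbase b.
Proof. by move=> ab; rewrite /lbase -mulnSr leq_mul2l ltnS ab orbT. Qed.

Lemma lbase_ge a : nd.+2 <= lbase a.
Proof. by rewrite /lbase mulnS leq_addr. Qed.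

Lemma lbase_le a b : a <= b -> lbase a <= lbase b.
Proof. by move=> ab; apply: leq_mul. Qed.

(** The returning strands of a vertex fit strictly between its level and the preceding multiple of
    [nd.+2], so no outgoing strand and no other vertex gets between them. *)
Lemma lt_bounds p : p < nd -> let f := lfirst (da p) in
  lbase f < lt p + nd.+2 /\ lt p + 1 < lbase f.
Proof.
move=> pn f; have [fp _] := lfirstP pn; have := lbase_ge f.
by rewrite /lt -/f -/(lfirst (da p)) -/f; lia.
Qed.

Lemma lt_lh p : p < nd -> lt p < lh p.
Proof.
move=> pn; have [_ b2] := lt_bounds pn; have [fp _] := lfirstP pn.
have := lbase_le fp.
by rewrite /lh; lia.
Qed.

Lemma lh_mono p q : (lh p < lh q) = (p < q).
Proof. by rewrite /lh /lbase ltn_mul2l. Qed.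

(** [true] denotes the strand that runs past all the vertices, [false] the one that stops at its
    vertex; [rng] is the index of the abscissa where it stops. *)
Definition hgt (b : bool) p := if b then lh p else lt p.
Definition rng (b : bool) p := if b then n.+1 else lx (da p).

Lemma hgt_gt0 b p : p < nd -> 0 < hgt b p.
Proof.
move=> pn; case: b; rewrite /hgt; first by rewrite /lh; have := lbase_ge p; lia.
by have [b1 _] := lt_bounds pn; have := lbase_ge (lfirst (da p)); lia.
Qed.

Lemma hgt_le b p : p < nd -> hgt b p <= lbase nd.
Proof.
move=> pn; have h : lh p <= lbase nd by rewrite /lh; have := lbase_lt pn; lia.
by case: b => //; rewrite /hgt; have := lt_lh pn; lia.
Qed.

Lemma hgt_lh_lt p q : q < nd -> lh p <> lt q.
Proof.
move=> qn E; have [b1 b2] := lt_bounds qn; rewrite -E /lh in b1 b2.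
case: (ltngtP p (lfirst (da q))) => [h|h|h]; try have := lbase_lt h; rewrite ?h in b1 b2; lia.
Qed.

Lemma lt_inj p q : p < nd -> q < nd -> lt p = lt q -> p = q.
Proof.
move=> pn qn E; have [b1 b2] := lt_bounds pn; have [c1 c2] := lt_bounds qn.
have [fp dp] := lfirstP pn; have [fq dq] := lfirstP qn.
have Ef : lfirst (da p) = lfirst (da q).
  case: (ltngtP (lfirst (da p)) (lfirst (da q))) => // h; have := lbase_lt h; rewrite E in b1 b2; lia.
have := E; rewrite /lt -!/(lfirst _) Ef; have := lbase_ge (lfirst (da q)).
by rewrite Ef in fp; lia.
Qed.

Lemma hgt_inj b p b' p' : p < nd -> p' < nd -> hgt b p = hgt b' p' -> b = b' /\ p = p'.
Proof.
move=> pn pn'; case: b; case: b'; rewrite /hgt => E.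
- split=> //; case: (ltngtP p p') => // h; have := h; by rewrite -lh_mono E ltnn.
- by case: (hgt_lh_lt pn' E).
- by case: (hgt_lh_lt pn (esym E)).
- by split=> //; exact: lt_inj.
Qed.

Lemma lyS : ly n.+1 = 0. Proof. by rewrite /ly ltnn andbF. Qed.

Lemma lyP i : ly i = 0 \/ exists f, ly i = lbase f - 1.
Proof. by rewrite /ly; case: ifP => _; [right; eexists | left]. Qed.

(** So every strand passes strictly above or strictly below each vertex, apart from the bend to its
    own end. *)
Lemma hgt_ly b p i : p < nd -> hgt b p <> ly i.
Proof.
move=> pn E; case: (lyP i) => [y0|[f yf]].
  by have := hgt_gt0 b pn; rewrite E y0.
have := lbase_ge f; rewrite yf in E; case: b E => E; rewrite /hgt in E.
  rewrite /lh in E; case: (ltngtP p f) => [h|h|h]; try have := lbase_lt h; rewrite ?h in E *; lia.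
have [b1 b2] := lt_bounds pn; case: (ltngtP (lfirst (da p)) f) => [h|h|h];
try have := lbase_lt h; rewrite ?h in b1 b2; lia.
Qed.

Lemma ly_le i : ly i <= lbase nd.
Proof.
rewrite /ly; case: ifP => _ //; rewrite /lyv.
have : lfirst (ord i.-1) <= nd by have := find_size (fun p => da p == ord i.-1) (iota 0 nd); rewrite size_iota.
rewrite leq_eqVlt => /orP[/eqP E|h]; first by rewrite -/(lfirst _) E; lia.
by have := lbase_lt h; rewrite -/(lfirst _); lia.
Qed.

Lemma nc_okP r i j k l : nc_ok nd r -> i < j -> j < k -> k < l -> l < nd ->
  r i k -> r j l -> r i j.
Proof.
move=> nr ij jk kl ln rik rjl.
have kn : k < nd by exact: ltn_trans ln.
have jn : j < nd by exact: ltn_trans kn.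
have in_ : i < nd by exact: ltn_trans jn.
have := allP nr i; rewrite mem_iota in_ => /(_ isT)/allP/(_ j).
rewrite mem_iota jn => /(_ isT)/allP/(_ k); rewrite mem_iota kn => /(_ isT)/allP/(_ l).
by rewrite mem_iota ln ij jk kl rik rjl => /(_ isT).
Qed.

Lemma lt_desc p q : p < nd -> q < nd -> da p = da q -> p < q -> lt q < lt p.
Proof.
move=> pn qn dpq pq; have [fp _] := lfirstP pn; have [fq _] := lfirstP qn.
rewrite /lt -!/(lfirst _) -dpq; have := lbase_ge (lfirst (da p)).
by rewrite -dpq in fq; lia.
Qed.

(** The turn of [p] spans the heights from [lt p] to [lh p]. If the vertex of [p] starts before that
    of [q], then [p] itself precedes all darts of the latter, since otherwise the two vertices would
    alternate, and the spans are disjoint. In the other cases they are nested. *)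
Lemma left_nested p q : nc_ok nd (samev da) -> p < nd -> q < nd -> p < q ->
  lh p < lt q \/ (lt q < lt p /\ lh p < lh q).
Proof.
move=> ncv pn qn pq; have [b1 b2] := lt_bounds pn; have [c1 c2] := lt_bounds qn.
have [fp dp] := lfirstP pn; have [fq dq] := lfirstP qn; rewrite lh_mono pq.
case: (ltngtP (lfirst (da p)) (lfirst (da q))) => h; last first.
- by right; split=> //; apply: lt_desc => //; rewrite -dp h dq.
- by right; split=> //; have := lbase_lt h; lia.
- left; have hp : p < lfirst (da q).
    rewrite ltnNge leq_eqVlt; apply/negP=> /orP[/eqP E|h'].
      by move: h; rewrite E in dq; rewrite dq ltnn.
    have := nc_okP ncv h h' pq qn; rewrite /samev dp dq !eqxx => /(_ isT isT)/eqP E.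
    by rewrite -E ltnn in h.
  by have := lbase_lt hp; rewrite /lh; lia.
Qed.

(** A turn at the right spans the heights of the two darts of an edge. Partially overlapping spans
    would be an alternation of two edges. *)
Lemma right_nested p q p' q' : nc_ok nd (samee da db) -> p < nd -> q < nd -> p' < nd -> q' < nd ->
  p < q -> p' < q' -> samee da db p q -> samee da db p' q' -> ~~ samee da db p p' ->
  ~~ samee da db p' p -> p != p' -> p != q' -> q != p' -> q != q' ->
  [\/ lh q < lh p', lh q' < lh p, lh p < lh p' /\ lh q' < lh q |
      lh p' < lh p /\ lh q < lh q'].
Proof.
move=> nce pn qn pn' qn' pq pq' s s' ns ns' n1 n2 n3 n4; rewrite !lh_mono.
have c1 : ~ (p < p' /\ p' < q /\ q < q').
  by case=> h1 [h2 h3]; have := nc_okP nce h1 h2 h3 qn' s s'; rewrite (negbTE ns).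
have c2 : ~ (p' < p /\ p < q' /\ q' < q).
  by case=> h1 [h2 h3]; have := nc_okP nce h1 h2 h3 qn s' s; rewrite (negbTE ns').
have [h1|h1] := ltnP q p'; first by constructor 1.
have [h2|h2] := ltnP q' p; first by constructor 2.
have [h3|h3] := ltnP p p'; [constructor 3 | constructor 4]; lia.
Qed.

Hypothesis ordP : ord_ok n ord.

Lemma ord_ex v : v < n -> exists2 i, i < n & ord i = v.
Proof.
move=> vn; have vi : v \in iota 0 n by rewrite mem_iota.
have /hasP[i] := allP ordP v vi; rewrite mem_iota /= => im /eqP E.
by exists i.
Qed.

(** Only surjectivity is checked; since there are [n] positions, it forces [ord] to be a
    permutation. *)
Lemma ord_sub : {subset iota 0 n <= map ord (iota 0 n)}.
Proof.
move=> v; rewrite mem_iota /= => /ord_ex[i im <-].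
by apply/mapP; exists i; rewrite ?mem_iota.
Qed.

Lemma ord_lt i : i < n -> ord i < n.
Proof.
move=> im; have : ord i \in map ord (iota 0 n) by apply: map_f; rewrite mem_iota.
have szn : size (map ord (iota 0 n)) <= size (iota 0 n) by rewrite size_map.
have [_ <-] := uniq_min_size (iota_uniq 0 n) ord_sub szn.
by rewrite mem_iota.
Qed.

Lemma ord_inj i j : i < n -> j < n -> ord i = ord j -> i = j.
Proof.
move=> im jm E; have szn : size (map ord (iota 0 n)) <= size (iota 0 n) by rewrite size_map.
have u := leq_size_uniq (iota_uniq 0 n) ord_sub szn.
apply/eqP; rewrite -(nth_uniq 0 _ _ u) ?size_map ?size_iota //.
by rewrite !(nth_map 0) ?size_iota // !nth_iota // E.
Qed.

Lemma lxP v : v < n -> [/\ 0 < lx v, lx v <= n & ord (lx v).-1 = v].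
Proof.
move=> vn; have [i im Ei] := ord_ex vn.
have h : has (fun i => ord i == v) (iota 0 n).
  by apply/hasP; exists i; rewrite ?mem_iota ?Ei /=.
have flt : (lx v).-1 < n by have := h; rewrite has_find size_iota.
by split=> //; have := nth_find 0 h; rewrite nth_iota // => /eqP.
Qed.

Lemma lx_ord i : i < n -> lx (ord i) = i.+1.
Proof.
move=> im; have [h1 h2 h3] := lxP (ord_lt im).
by rewrite -(prednK h1); congr S; apply: ord_inj => //; lia.
Qed.

Lemma lx_inj u v : u < n -> v < n -> lx u = lx v -> u = v.
Proof. by move=> un vn E; have [_ _ <-] := lxP un; have [_ _ <-] := lxP vn; rewrite E. Qed.

Lemma ly_lx v : v < n -> ly (lx v) = lbase (lfirst v) - 1.
Proof. by move=> vn; have [h1 h2 h3] := lxP vn; rewrite /ly h1 h2 /= /lyv h3. Qed.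

Hypothesis dan : forall p, p < nd -> da p < n.

Lemma rng_gt0 b p : 0 < rng b p.
Proof. by case: b. Qed.

Lemma rng_le b p : p < nd -> rng b p <= n.+1.
Proof. by move=> pn; case: b => //=; have [_ + _] := lxP (dan pn); lia. Qed.

Lemma lt_end p : p < nd -> lt p < ly (lx (da p)).
Proof. by move=> pn; rewrite (ly_lx (dan pn)); have [_] := lt_bounds pn; lia. Qed.

(** The returning strands of a vertex occupy the levels right below it, so a higher strand is either
    another of them or passes above the vertex. Hence the final bend of a strand up to its vertex
    meets nothing. *)
Lemma hgt_end p b q : p < nd -> q < nd -> lt p < hgt b q ->
  (b = false /\ da q = da p) \/ ly (lx (da p)) < hgt b q.
Proof.
move=> pn qn; rewrite (ly_lx (dan pn)); have [b1 b2] := lt_bounds pn.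
have := lbase_ge (lfirst (da p)); case: b; rewrite /hgt => h0 h.
  right; have [hq|hq] := ltnP q (lfirst (da p)); first by have := lbase_lt hq; rewrite /lh in h; lia.
  have := lbase_le hq.
  by rewrite /lh; lia.
have [c1 c2] := lt_bounds qn; have [fp dp] := lfirstP pn; have [fq dq] := lfirstP qn.
case: (ltngtP (lfirst (da p)) (lfirst (da q))) => hf.
- by right; have := lbase_lt hf; lia.
- by have := lbase_lt hf; lia.
- by left; split=> //; rewrite -dq -hf.
Qed.
End LayoutNat.

(** * Clusters *)

Section Tree.
Variables (n m : nat) (par : 'I_n + 'I_m -> option 'I_m).
Implicit Types (x y : 'I_n + 'I_m) (mu nu : 'I_m).

Definition pstep (o : option 'I_m) := obind (fun mu => par (inr mu)) o.
Definition pstart x := if x is inr mu then Some mu else par x.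

Lemma iter_pstep_None j : iter j pstep None = None.
Proof. by elim: j => //= j ->. Qed.

(** Ancestors become iterates of one function: comparing two ancestors of a node is comparing two
    exponents, and the coded input can compute them. *)
Lemma descends_iter x mu :
  descends par x mu <-> exists j, iter j pstep (pstart x) = Some mu.
Proof.
split.
  case/connectP=> p; elim/last_ind: p mu => [|p y IHp] mu; first by move=> _ /= E; exists 0; rewrite -E.
  rewrite rcons_path last_rcons => /andP[pth] /[swap] <- /= /eqP E.
  case L : (last x p) E => [v|nu] E.
    case/lastP: p pth L {IHp} => [|p z] /=; first by move=> _ ->; exists 0.
    by rewrite rcons_path last_rcons => /andP[_] /[swap] ->.
  by have [j jE] := IHp nu pth (esym L); exists j.+1; rewrite iterS jE.
case=> j; elim: j mu => [|j IHj] mu /=.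
  case: x => [v|nu] /=; last by case=> ->; exact: connect0.
  by move=> E; apply: connect1; rewrite /up E eqxx.
case E : (iter j pstep (pstart x)) => [nu|//] /= pE.
apply: connect_trans (IHj _ E) _; apply: connect1.
by rewrite /up pE eqxx.
Qed.

(** Up to the first visit of [mu] no node repeats, as a repetition could be cut out; so at most [m]
    nodes are visited. *)
Lemma iter_pstep_bound o mu j : iter j pstep o = Some mu ->
  exists2 i, i < m & iter i pstep o = Some mu.
Proof.
move=> jE; have ex : exists i, iter i pstep o == Some mu by exists j; rewrite jE.
case: (ex_minnP ex) => i /eqP iE imin; exists i => //.
pose f (k : 'I_i.+1) := odflt mu (iter k pstep o).
have sm (k : 'I_i.+1) : iter k pstep o = Some (f k).
  rewrite /f; case E : (iter k pstep o) => [//|].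
  by move: iE; rewrite -(subnK (ltn_ord k : k <= i)) iterD E iter_pstep_None.
have fI : injective f.
  move=> k l; wlog kl : k l / k <= l => [H E|E].
    by case: (leqP k l) => [/H->//|/ltnW/H->].
  apply/val_inj/eqP; rewrite eqn_leq kl /= leqNgt; apply/negP => lt_kl.
  have : iter (i - l + k) pstep o == Some mu.
    rewrite iterD sm E -sm -iterD subnK ?iE //; exact: (ltn_ord l).
  by move/imin; have := ltn_ord l; lia.
by have := leq_card f fI; rewrite !card_ord.
Qed.

Lemma descends_comparable x mu nu : descends par x mu -> descends par x nu ->
  descends par (inr mu) nu \/ descends par (inr nu) mu.
Proof.
move=> /descends_iter[i iE] /descends_iter[j jE].
case: (leqP i j) => [ij|/ltnW ij]; [left | right]; apply/descends_iter.
  by exists (j - i); rewrite -jE -[in RHS](subnK ij) iterD iE.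
by exists (i - j); rewrite -iE -[in RHS](subnK ij) iterD jE.
Qed.

Lemma cluster_sub mu nu : descends par (inr mu) nu ->
  tree_cluster par mu \subset tree_cluster par nu.
Proof.
by move=> d; apply/subsetP => v; rewrite !inE => h; apply: connect_trans h d.
Qed.

Lemma cluster_laminar mu nu :
  [\/ descends par (inr mu) nu, descends par (inr nu) mu |
      [disjoint tree_cluster par mu & tree_cluster par nu]].
Proof.
have [d|] := boolP [disjoint tree_cluster par mu & tree_cluster par nu]; first by constructor 3.
case/pred0Pn=> v /=; rewrite !inE => /andP[h1 h2].
by case: (descends_comparable h1 h2) => h; [constructor 1 | constructor 2].
Qed.

Hypothesis root : exists2 r, par r = None & forall x, connect (up par) x r.

Lemma root_internal mu : exists2 rho, par (inr rho) = None & forall nu, descends par (inr nu) rho.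
Proof.
have [[v|rho] r0 rP] := root; last by exists rho => // nu; exact: rP.
case/connectP: (rP (inr mu)) => p pth; case: (lastP p) pth => [//|q y].
by rewrite rcons_path last_rcons => /andP[_] /[swap] <-.
Qed.

Lemma root_unique mu nu : par (inr mu) = None -> par (inr nu) = None -> mu = nu.
Proof.
have [rho r0 rP] := root_internal mu.
suff H lam : par (inr lam) = None -> lam = rho by move=> /H-> /H->.
move=> l0; have /descends_iter[[|j]] := rP lam; first by case.
by rewrite iterSr /= l0 iter_pstep_None.
Qed.

Lemma pstep_ends mu : exists j, iter j pstep (Some mu) == None.
Proof.
have [rho r0 rP] := root_internal mu; have /descends_iter[j jE] := rP mu.
by exists j.+1; rewrite iterS jE /= r0.
Qed.

Hypothesis child : forall mu, exists x, par x = Some mu.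

(** A descendant of greatest depth has a child, which can only be a vertex. *)
Lemma cluster_neq0 mu : exists v, v \in tree_cluster par mu.
Proof.
pose dep nu := ex_minn (pstep_ends nu).
have depS nu lam : par (inr nu) = Some lam -> dep lam < dep nu.
  move=> E; rewrite /dep; case: ex_minnP => d dE dmin; case: ex_minnP => -[//|e] + _.
  rewrite iterSr /= E => /dmin; exact.
have mm : descends par (inr mu) mu by exact: connect0.
case: (@arg_maxnP _ mu (fun nu => descends par (inr nu) mu) dep mm) => nu nuP numax; have [[v|lam] E] := child nu.
  by exists v; rewrite inE; apply: connect_trans nuP; apply: connect1; rewrite /up E eqxx.
have h : descends par (inr lam) mu by apply: connect_trans nuP; apply: connect1; rewrite /up E eqxx.
by have := numax lam h; rewrite /= leqNgt depS.
Qed.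

Hypothesis cinj : injective (tree_cluster par).

Lemma cluster_proper mu nu : descends par (inr mu) nu -> mu != nu ->
  #|tree_cluster par mu| < #|tree_cluster par nu|.
Proof.
move=> d ne; apply: proper_card; rewrite properEneq cluster_sub // andbT.
by apply: contraNneq ne => /cinj->.
Qed.

(** The clusters that contain [v] form a chain of distinct sets, so their sizes, between 0 and [n],
    tell them apart. *)
Lemma clusters_at v : #|[set mu | v \in tree_cluster par mu]| <= n.+1.
Proof.
pose f mu : 'I_n.+1 := inord #|tree_cluster par mu|.
have fE mu : f mu = #|tree_cluster par mu| :> nat.
  by rewrite inordK // ltnS -[X in _ <= X]card_ord max_card.
have fI : {in [set mu | v \in tree_cluster par mu] &, injective f}.
  move=> mu nu; rewrite !inE => h1 h2 /(congr1 val) /=; rewrite !fE => E.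
  apply/eqP; apply/negPn/negP => ne.
  case: (descends_comparable h1 h2) => /cluster_proper h; first by have := h ne; rewrite E ltnn.
  by have := h; rewrite eq_sym => /(_ ne); rewrite E ltnn.
by rewrite -(card_in_imset fI) -[X in _ <= X]card_ord max_card.
Qed.

(** Of two comparable clusters the larger is the root. So beside one cluster other than the root,
    only the root can contain [v]. *)
Lemma clusters_at_flat v :
  (forall mu nu, nu != mu -> tree_cluster par nu \subset tree_cluster par mu -> par (inr mu) = None) ->
  #|[set mu | v \in tree_cluster par mu]| <= 2.
Proof.
move=> flt; set S := [set _ | _]; pose Rt : {set 'I_m} := [set mu | par (inr mu) == None].
have Rt1 : #|Rt| <= 1.
  by apply/card_le1_eqP => mu nu; rewrite !inE => /eqP h1 /eqP h2; exact: root_unique.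
have [SR|] := boolP (S \subset Rt); first by apply: leq_trans (subset_leq_card SR) (leq_trans Rt1 _).
case/subsetPn=> lam lamS lamR.
have sub : S \subset lam |: Rt.
  apply/subsetP => mu muS; rewrite !inE; case: eqVneq => //= ne; apply/eqP.
  move: lamS muS lamR; rewrite !inE => h1 h2 /eqP h3.
  case: (descends_comparable h1 h2) => /cluster_sub h; first by apply: flt h; rewrite eq_sym.
  by case: h3; apply: flt h.
by apply: leq_trans (subset_leq_card sub) _; rewrite cardsU1 (leq_add (leq_b1 _) Rt1).
Qed.

(** Double counting of the incidences between vertices and clusters. *)
Lemma sum_clusters k : (forall v, #|[set mu | v \in tree_cluster par mu]| <= k) ->
  \sum_(mu < m) #|tree_cluster par mu| <= n * k.
Proof.
move=> H; rewrite (eq_bigr (fun mu => \sum_(v < n) (v \in tree_cluster par mu))); last first.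
  by move=> mu _; rewrite -sum1_card [LHS]big_mkcond /=; apply: eq_bigr => v _; case: (_ \in _).
rewrite exchange_big /= -[n in n * k]card_ord -sum_nat_const; apply: leq_sum => v _.
apply: leq_trans (H v); rewrite -sum1_card [X in _ <= X]big_mkcond /=.
by apply: leq_sum => mu _; case: ifP => [|/negbT]; rewrite inE; [case: (_ \in _) | move/negbTE->].
Qed.
End Tree.

(** * The coded input *)

Lemma nth_allpairs (S T : Type) (U : Type) (f : S -> T -> U) s t x0 y0 u0 i j :
  i < size s -> j < size t ->
  nth u0 [seq f x y | x <- s, y <- t] (i * size t + j) = f (nth x0 s i) (nth y0 t j).
Proof.
move=> + jt; elim: s i => // x s IHs [|i] /= it.
  by rewrite nth_cat size_map jt (nth_map y0).
rewrite nth_cat size_map mulSn -addnA ltnNge leq_addr /= addKn.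
exact: IHs.
Qed.

Section Input.
Variable C : clustered_graph.
Local Notation n := (nv C).
Local Notation m := (ni C).

Definition cg_input : input :=
  (n, m, [seq adj u v | u <- enum 'I_n, v <- enum 'I_n],
   [seq omap val (par (inl v)) | v <- enum 'I_n],
   [seq omap val (par (inr mu)) | mu <- enum 'I_m]).

Lemma in_adjE (u v : 'I_n) : in_adj cg_input u v = adj u v.
Proof.
rewrite /in_adj /in_n /= -[X in (_ * X + _)](size_enum_ord n).
by rewrite (nth_allpairs _ u v) ?size_enum_ord ?nth_ord_enum.
Qed.

Lemma in_incE (mu : 'I_m) (v : 'I_n) : in_inc cg_input mu v = (v \in cluster_of mu).
Proof.
pose F a := onat (nth None (None :: cg_input.2) a).
rewrite -[LHS]/(has (fun j => iter j F (onat (nth None cg_input.1.2 v)) == mu.+1) (iota 0 m)).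
pose enc (o : option 'I_m) := onat (omap val o).
have FE o : F (enc o) = enc (pstep (@par C) o).
  case: o => [nu|//]; rewrite /F /enc /=.
  by rewrite (nth_map nu) ?size_enum_ord ?nth_ord_enum.
have itE j o : iter j F (enc o) = enc (iter j (pstep (@par C)) o).
  by elim: j => //= j ->; rewrite FE.
have stE : onat (nth None cg_input.1.2 v) = enc (pstart (@par C) (inl v)).
  by rewrite (nth_map v) ?size_enum_ord ?nth_ord_enum.
have encP o : (enc o == mu.+1) = (o == Some mu).
  by case: o => [nu|//]; rewrite /enc /= eqSS.
rewrite inE; apply/hasP/idP.
  case=> j _; rewrite stE itE encP => /eqP jE.
  by apply/descends_iter; exists j.
case/descends_iter=> j /iter_pstep_bound[i im iE]; exists i; first by rewrite mem_iota.
by rewrite stE itE encP iE.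
Qed.
End Input.

(** * Certificates *)

Lemma subseq_nth (T : eqType) (x0 : T) (s : seq T) (t : seq nat) :
  sorted ltn t -> all (gtn (size s)) t -> subseq (map (nth x0 s) t) s.
Proof.
move=> st lt_t; rewrite -[X in subseq _ X](mkseq_nth x0); apply: map_subseq.
apply/(subseq_uniqP (iota_uniq _ _)); apply: (irr_sorted_eq ltn_trans ltnn) => //.
  by apply: sorted_filter; [exact: ltn_trans | exact: iota_ltn_sorted].
move=> i; rewrite mem_filter mem_iota /=; case it : (i \in t) => //=.
by have /= -> := allP lt_t i it.
Qed.

Lemma count_interval (a b n : nat) :
  count (fun i => (a <= i) && (i < b)) (iota 0 n) = minn b n - a.
Proof.
elim: n => [|n IHn]; first by rewrite minn0 sub0n.
by rewrite iota0S count_cat IHn /= addn0; case: leqP; case: ltnP; lia.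
Qed.

(** Turns the betweenness given by [contiguous_order] into the test made by [linterval], where the
    interval is described by its first position and its size. *)
Lemma convex_interval (Q : pred nat) n :
  (forall i j k, i < j -> j < k -> k < n -> Q i -> Q k -> Q j) ->
  forall i, i < n -> Q i = (find Q (iota 0 n) <= i) && (i < find Q (iota 0 n) + count Q (iota 0 n)).
Proof.
move=> cvx; set f := find _ _.
have fn : f <= n by rewrite -[X in _ <= X](size_iota 0 n) find_size.
have before i : i < f -> Q i = false.
  by move=> h; have := before_find 0 h; rewrite nth_iota //; apply: leq_trans h fn.
have [hasQ|/hasPn noQ] := boolP (has Q (iota 0 n)); last first.
  have -> : count Q (iota 0 n) = 0 by apply/eqP; rewrite -leqn0 leqNgt -has_count; apply/hasPn.
  move=> i im; rewrite addn0; case: (leqP f i) => //= h; last exact: before.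
  by apply/negbTE/noQ; rewrite mem_iota.
have fltn : f < n by move: hasQ; rewrite has_find size_iota.
have Qf : Q f by have := nth_find 0 hasQ; rewrite nth_iota.
have exe : exists e, [&& f <= e, e < n & Q e] by exists f; rewrite leqnn fltn.
have bnd e : [&& f <= e, e < n & Q e] -> e <= n by case/and3P=> _ /ltnW.
case: (ex_maxnP exe bnd) => e /and3P[fe en Qe] emax.
have QE i : i < n -> Q i = (f <= i) && (i < e.+1).
  move=> im; case: (ltnP i f) => [/before//|fi] /=; rewrite ltnS.
  case: (leqP i e) => ie; last first.
    by apply/negbTE/negP => Qi; have := emax i; rewrite fi im Qi leqNgt ie => /(_ isT).
  case: (ltngtP f i) => [h|h|<-//]; last by lia.
  by case: (ltngtP i e) => [h'|h'|->//]; [exact: (cvx f i e) | lia].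
have -> : count Q (iota 0 n) = e.+1 - f.
  rewrite (eq_in_count (a2 := fun i => (f <= i) && (i < e.+1))) ?count_interval; last first.
    by move=> i; rewrite mem_iota /= => /QE.
  by rewrite (minn_idPl en).
by move=> i /QE->; congr (_ && _); rewrite subnKC // ltnW.
Qed.

Section Certificate.
Variable C : clustered_graph.
Local Notation n := (nv C).
Local Notation m := (ni C).
Local Notation x := (cg_input C).

(** The darts come from the given order [wd], the order of the vertices from the laminar family of
    the clusters; nothing has to relate the two. *)
Lemma certificate (a : rel nat) (wd : seq (nat * nat)) :
  (forall u v : 'I_n, a u v = adj u v) -> (forall u v, a u v -> u < n) ->
  dart_order a wd -> exists c, check x c.
Proof.
move=> aE an [uwd mwd ncv nce].
have lam A B : A \in [seq cluster_of mu | mu <- enum 'I_m] ->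
    B \in [seq cluster_of mu | mu <- enum 'I_m] ->
    [\/ A \subset B, B \subset A | [disjoint A & B]].
  case/mapP=> mu _ -> /mapP[nu _ ->].
  case: (cluster_laminar (@par C) mu nu) => [/cluster_sub|/cluster_sub|] h;
  by [constructor 1 | constructor 2 | constructor 3].
have [s [us sP] cont] := contiguous_order lam.
have szs : size s = n.
  have /perm_size -> : perm_eq s (enum 'I_n).
    by apply: uniq_perm => //; [exact: enum_uniq | move=> v; rewrite sP mem_enum].
  exact: size_enum_ord.
pose dd := flatten [seq [:: d.1; d.2] | d <- wd].
pose c := size wd :: map val s ++ dd.
have ddE p : p < size wd -> nth 0 dd (p + p) = (nth (0, 0) wd p).1 /\
    nth 0 dd (p + p).+1 = (nth (0, 0) wd p).2.
  by rewrite /dd; elim: (wd) p => // d w IHw [|p] //= /IHw; rewrite addnS.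
have ordE i : i < n -> c_ord c i = nth 0 (map val s) i.
  by move=> im; rewrite /c_ord /= nth_cat size_map szs im.
have daE p : p < size wd -> c_da x c p = (nth (0, 0) wd p).1.
  move=> pn; rewrite /c_da /c /in_n /= nth_cat size_map szs ltnNge leq_addr /= addKn.
  by case: (ddE p pn).
have dbE p : p < size wd -> c_db x c p = (nth (0, 0) wd p).2.
  move=> pn; rewrite /c_db /c /in_n addSn -addnS /= nth_cat size_map szs ltnNge leq_addr /= addKn.
  by case: (ddE p pn).
have ncE (T : eqType) (f : nat * nat -> T) (r : nat -> nat -> bool) :
    (forall i j, i < size wd -> j < size wd ->
      r i j = (f (nth (0, 0) wd i) == f (nth (0, 0) wd j))) ->
    nc (map f wd) -> nc_ok (size wd) r.
  move=> rE ncf; apply/allP => i; rewrite mem_iota /= => im; apply/allP => j; rewrite mem_iota /= => jm.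
  apply/allP => k; rewrite mem_iota /= => km; apply/allP => l; rewrite mem_iota /= => lm.
  rewrite -implybE; apply/implyP => /andP[/andP[/andP[/andP[ij jk] kl]]].
  rewrite !rE // => /eqP ik /eqP jl; apply/eqP; apply: ncf.
  have := map_subseq f (@subseq_nth _ (0, 0) wd [:: i; j; k; l] _ _).
  by rewrite /= ik jl ij jk kl im jm km lm; apply.
exists c; apply/and5P; split.
- apply/allP => v; rewrite mem_iota /= => vn; apply/hasP; exists (index (Ordinal vn) s).
    by rewrite mem_iota /= -[X in _ < X]szs index_mem sP.
  rewrite ordE; last by rewrite -[X in _ < X]szs index_mem sP.
  by rewrite (nth_map (Ordinal vn)) ?nth_index ?index_mem ?sP.
- apply/andP; split; last first.
    apply/allP => p; rewrite mem_iota /= => pn; rewrite daE //.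
    by have := mem_nth (0, 0) pn; rewrite mwd => /an.
  apply/allP => u; rewrite mem_iota /= => un; apply/allP => v; rewrite mem_iota /= => vn.
  rewrite -implybE; apply/implyP => uv; have := in_adjE (Ordinal un) (Ordinal vn).
  rewrite /= uv -aE /= => /esym auv.
  have uvw : (u, v) \in wd by rewrite mwd.
  have pn : index (u, v) wd < size wd by rewrite index_mem.
  apply/hasP; exists (index (u, v) wd); first by rewrite mem_iota.
  by rewrite daE // dbE // nth_index //= !eqxx.
- by apply: ncE ncv => i j im jm; rewrite /samev !daE.
- apply: ncE nce => i j im jm; rewrite /samee !daE // !dbE //.
  case: (nth _ wd i) (nth _ wd j) => u v [u' v'] /=.
  apply/idP/eqP => [h|/edge_of_eq[[-> ->]|[-> ->]]]; rewrite ?eqxx ?orbT //.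
  by apply/edge_of_eq; case/orP: h => /andP[/eqP-> /eqP->]; auto.
- apply/allP => mu; rewrite mem_iota /= => mum; apply/allP => i; rewrite mem_iota /= => im.
  have QE v0 j : j < n -> in_inc x mu (c_ord c j) = (nth v0 s j \in cluster_of (Ordinal mum)).
    by move=> jm; rewrite -in_incE ordE // (nth_map v0) ?szs.
  apply/eqP; rewrite (@convex_interval (fun i => in_inc x mu (c_ord c i)) n) //.
  move=> j k l jk kl lm; have km := ltn_trans kl lm; have jm := ltn_trans jk km.
  rewrite !(QE (Ordinal im)) //; apply: cont; first by apply: map_f; rewrite mem_enum.
  by apply: (@subseq_nth _ _ _ [:: j; k; l]); rewrite /= ?jk ?kl ?szs ?jm ?km ?lm.
Qed.
End Certificate.

Section CheckFacts.
Variables (C : clustered_graph) (c : seq nat).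
Local Notation n := (nv C).
Local Notation m := (ni C).
Local Notation x := (cg_input C).
Local Notation nd := (c_nd c).
Local Notation ord := (c_ord c).
Local Notation da := (c_da x c).
Local Notation db := (c_db x c).
Hypothesis ck : check x c.
Implicit Types (u v : 'I_n) (mu nu : 'I_m) (e f : 'I_n * 'I_n).

Lemma ck_ord : ord_ok n ord. Proof. by case/and5P: ck. Qed.
Lemma ck_ncv : nc_ok nd (samev da). Proof. by case/and5P: ck. Qed.
Lemma ck_nce : nc_ok nd (samee da db). Proof. by case/and5P: ck. Qed.
Lemma ck_da p : (p < nd)%N -> (da p < n)%N.
Proof.
move=> pn; case/and5P: ck => _ /andP[_ /allP h] _ _ _; apply: h.
by rewrite mem_iota.
Qed.

Definition dpos u v := ldpos nd da db u v.

Lemma dposP u v : adj u v -> [/\ (dpos u v < nd)%N, da (dpos u v) = u & db (dpos u v) = v].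
Proof.
move=> uv; have h : has (fun p => (da p == u) && (db p == v)) (iota 0 nd).
  case/and5P: ck => _ /andP[/allP h _] _ _ _; move: (h u); rewrite mem_iota => /(_ (ltn_ord u)).
  move/allP/(_ v); rewrite mem_iota => /(_ (ltn_ord v)).
  by rewrite in_adjE uv.
have flt : (dpos u v < nd)%N by have := h; rewrite has_find size_iota.
by have := nth_find 0%N h; rewrite nth_iota // add0n => /andP[/eqP ? /eqP ?].
Qed.

(** [ra] and [rb] are the abscissae, counted from 1, of the outer vertices of a cluster, and [rk] is
    its size. *)
Definition ra mu := lstart n ord (in_inc x mu).
Definition rk mu := lcard n ord (in_inc x mu).
Definition rb mu := (ra mu + rk mu).-1.

Lemma rkE mu : rk mu = #|cluster_of mu|.
Proof.
have pq : perm_eq (map ord (iota 0 n)) (iota 0 n).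
  have u : uniq (map ord (iota 0 n)).
    rewrite map_inj_in_uniq ?iota_uniq // => i j; rewrite !mem_iota /= => im jm.
    exact: (ord_inj ck_ord).
  apply: uniq_perm; rewrite ?iota_uniq // => i; apply/idP/idP; last exact: (ord_sub ck_ord).
  by case/mapP=> j; rewrite !mem_iota /= => jm ->; exact: (ord_lt ck_ord).
rewrite /rk /lcard -(count_map ord (in_inc x mu)) (permP pq) -val_enum_ord count_map.
rewrite (eq_count (a2 := mem (cluster_of mu))); last by move=> v; exact: in_incE.
by rewrite cardE -size_filter enumT.
Qed.

Lemma rk_gt0 mu : (0 < rk mu)%N.
Proof.
rewrite rkE; apply/card_gt0P; apply: cluster_neq0; first exact: par_root.
exact: par_child.
Qed.

Lemma ra_gt0 mu : (0 < ra mu)%N. Proof. by []. Qed.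

Lemma rabk mu : (ra mu + rk mu = (rb mu).+1)%N.
Proof. by rewrite prednK // addn_gt0 ra_gt0. Qed.

Lemma inc_ord mu i : (i < n)%N -> in_inc x mu (ord i) = (ra mu <= i.+1 <= rb mu)%N.
Proof.
move=> im; case/and5P: ck => _ _ _ _ /allP /(_ mu); rewrite mem_iota => /(_ (ltn_ord mu)).
move=> /allP /(_ i); rewrite mem_iota => /(_ im) /eqP ->.
by rewrite -/(ra mu) -/(rk mu) rabk ltnS.
Qed.

Lemma rb_le mu : (rb mu <= n)%N.
Proof.
have E : rk mu = (minn (rb mu) n - (ra mu).-1)%N.
  rewrite -count_interval; apply: eq_in_count => i; rewrite mem_iota /= => im.
  by rewrite inc_ord //; have := ra_gt0 mu; lia.
by have := rabk mu; have := rk_gt0 mu; have := ra_gt0 mu; lia.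
Qed.

Lemma cluster_interval mu v : (v \in cluster_of mu) = (ra mu <= lx n ord v <= rb mu)%N.
Proof.
have [h1 h2 h3] := lxP ck_ord (ltn_ord v).
by rewrite -in_incE -[in LHS]h3 inc_ord; [rewrite prednK | lia].
Qed.

Lemma interval_vertex i : (0 < i <= n)%N -> exists v : 'I_n, lx n ord v = i.
Proof.
case/andP=> i0 im; have im' : (i.-1 < n)%N by lia.
by exists (Ordinal (ord_lt ck_ord im')); rewrite /= (lx_ord ck_ord) // prednK.
Qed.

Lemma interval_sub mu nu : cluster_of mu \subset cluster_of nu ->
  (ra nu <= ra mu)%N /\ (rb mu <= rb nu)%N.
Proof.
have h0 := ra_gt0 mu; have h1 := rabk mu; have h2 := rk_gt0 mu; have h3 := rb_le mu.
move/subsetP => sub.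
have [v vE] : exists v : 'I_n, lx n ord v = ra mu by apply: interval_vertex; lia.
have [w wE] : exists v : 'I_n, lx n ord v = rb mu by apply: interval_vertex; lia.
have := sub v; have := sub w; rewrite !cluster_interval vE wE !leqnn /= andbT.
by lia.
Qed.

Lemma interval_disjoint mu nu : [disjoint cluster_of mu & cluster_of nu] ->
  (rb mu < ra nu)%N \/ (rb nu < ra mu)%N.
Proof.
move=> dis; have [h|h] := ltnP (rb mu) (ra nu); first by left.
have [h'|h'] := ltnP (rb nu) (ra mu); first by right.
have [v vE] : exists v : 'I_n, lx n ord v = maxn (ra mu) (ra nu).
  by apply: interval_vertex; have := ra_gt0 mu; have := rb_le mu; have := rb_le nu; have := rabk mu; have := rk_gt0 mu; lia.
have := disjointFr dis (x := v); rewrite !cluster_interval vE.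
by have := rabk mu; have := rk_gt0 mu; have := rabk nu; have := rk_gt0 nu; lia.
Qed.

Lemma edge_darts e : e \in edges (@adj C) ->
  let p := dpos e.1 e.2 in let q := dpos e.2 e.1 in
  [/\ (p < nd)%N, (q < nd)%N, (da p = e.1 /\ db p = e.2), (da q = e.2 /\ db q = e.1) & p <> q].
Proof.
rewrite inE => /andP[e12 ae] p q; have [h1 h2 h3] := dposP ae.
have [|h4 h5 h6] := @dposP e.2 e.1; first by rewrite adj_sym.
split=> // E; move: e12; rewrite -h2 -h5 -/p -/q E.
by rewrite ltnn.
Qed.

End CheckFacts.

From mathcomp Require Import all_classical all_reals all_analysis.
Import Order.TTheory Num.Theory.
Import numFieldNormedType.Exports.

Local Open Scope classical_set_scope.
Local Open Scope ring_scope.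

(** * From topological planarity to an ordering of the darts *)

Section Separation.
Variable R : realType.
Implicit Types (r : R).

Lemma fin_pos (F : finType) (P : F -> R -> Prop) :
  (forall x, exists2 r, 0 < r & P x r) ->
  (forall x r r', 0 < r' -> r' <= r -> P x r -> P x r') ->
  exists2 r, 0 < r & forall x, P x r.
Proof.
move=> ex anti; suff [r r0 rP] : exists2 r, 0 < r & forall x, x \in enum F -> P x r.
  by exists r => // x; apply: rP; rewrite mem_enum.
elim: (enum F) => [|x s [r r0 rP]]; first by exists 1.
have [r' r'0 r'P] := ex x; exists (Num.min r r'); first by rewrite lt_min r0.
move=> y; rewrite inE => /orP[/eqP->|ys].
  by apply: anti r'P; rewrite ?lt_min ?r0 ?ge_min ?lexx ?orbT.
by apply: anti (rP _ ys); rewrite ?lt_min ?r0 ?ge_min ?lexx.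
Qed.

(** Composition with this retraction extends an arc to a map that is continuous on the whole line,
    which replaces continuity within the unit interval. *)
Definition clamp (t : R) : R := Num.max 0 (Num.min 1 t).

Lemma clamp_id t : t \in `[0, 1] -> clamp t = t.
Proof. by rewrite in_itv /= => /andP[t0 t1]; rewrite /clamp min_r // max_r. Qed.

Lemma clamp_in t : clamp t \in `[0, 1].
Proof. by rewrite in_itv /= /clamp le_max lexx ge_max ler01 ge_min lexx. Qed.

Lemma clamp_continuous : continuous clamp.
Proof.
move=> t; rewrite /clamp.
apply: (@continuous_comp _ _ _ (fun t : R => Num.min 1 t) (Num.max 0)).
  by apply: continuous_min; [apply: cvg_cst | apply: cvg_id].
by apply: continuous_max; [apply: cvg_cst | apply: cvg_id].
Qed.

Lemma within_clamp (T : topologicalType) (g : R -> T) :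
  {within `[0, 1], continuous g} -> continuous (g \o clamp).
Proof.
move=> /subspace_continuousP gc t.
have c01 : `[0, 1]%classic (clamp t) by exact: clamp_in.
have H : clamp x @[x --> t] --> within `[0, 1]%classic (nbhs (clamp t)).
  move=> V nV; apply: (@filterS _ (nbhs t) _ _ _ _ (@clamp_continuous t _ nV)) => x.
  by apply; exact: clamp_in.
exact: (cvg_comp _ _ H (gc _ c01)).
Qed.

Lemma separation (G G' : R -> plane R) a b c d : a <= b -> c <= d ->
  continuous G -> continuous G' ->
  (forall s t, s \in `[a, b] -> t \in `[c, d] -> G s <> G' t) ->
  exists2 r, 0 < r & forall s t, s \in `[a, b] -> t \in `[c, d] ->
    r <= `|G s - G' t|.
Proof.
move=> ab cd cG cG' dis.
pose f (p : R * R) := `|G p.1 - G' p.2|.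
have cf : continuous f.
  move=> p; apply: (@continuous_comp _ _ _ (fun p : R * R => G p.1 - G' p.2) (fun z : plane R => `|z|)); last exact: norm_continuous.
  apply: cvgB.
    by apply: (@continuous_comp _ _ _ (fun p : R * R => p.1) G); [exact: cvg_fst | exact: cG].
  by apply: (@continuous_comp _ _ _ (fun p : R * R => p.2) G'); [exact: cvg_snd | exact: cG'].
have [|||p pA pmin] := @compact_EVT_min _ R f (`[a, b]%classic `*` `[c, d]%classic).
- by exists (a, c); split; rewrite /= in_itv /= lexx.
- exact: compact_setX (@segment_compact _ _ _) (@segment_compact _ _ _).
- exact: continuous_subspaceT.
exists (f p).
  rewrite normr_gt0 subr_eq0; apply/eqP; case: (set_mem pA) => /= p1 p2; exact: dis.
by move=> s t sI tI; apply: (pmin (s, t)); apply/mem_set; split.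
Qed.

Lemma uniform_cont (G : R -> plane R) e : continuous G -> 0 < e ->
  exists2 r, 0 < r & forall s t, s \in `[0, 1] -> `|s - t| < r -> `|G s - G t| < e.
Proof.
move=> cG e0.
have : compact (`[0, 1] : set R) by exact: segment_compact.
move/compact_near_coveringP.
move=> /(_ R (0 : R)^'+ (fun d s => forall t, `|s - t| < d -> `|G s - G t| < e)).
case=> [s s01|r /= r0 rP].
  have e2 : 0 < e / 2 by rewrite divr_gt0.
  have /cvgrPdist_lt/(_ _ e2) := cG s.
  move=> /nbhs_ballP[h /= h0 hP].
  have h2 : 0 < h / 2 by rewrite divr_gt0.
  exists (ball s (h / 2), [set d | 0 < d < h / 2]) => /=.
    split; first by apply/nbhs_ballP; exists (h / 2).
    exists (h / 2) => // d /=; rewrite sub0r normrN => dh d0.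
    by rewrite d0 /=; apply: le_lt_trans dh; rewrite ler_norm.
  move=> [s' d] /= [s's /andP[d0 dh]] t st.
  have b1 : `|G s - G s'| < e / 2.
    by apply: hP; move: s's; rewrite /ball /= => s's; lra.
  have b2 : `|G s - G t| < e / 2.
    apply: hP; rewrite /ball /= -[s - t](subrKA s').
    apply: le_lt_trans (ler_normD _ _) _; move: s's; rewrite /ball /= => s's; lra.
  rewrite -[G s' - G t](subrKA (G s)); apply: le_lt_trans (ler_normD _ _) _.
  by rewrite distrC; lra.
exists (r / 2); first by rewrite divr_gt0.
move=> s t s01 st; apply: (rP (r / 2)) => //=.
  by rewrite sub0r normrN gtr0_norm ?divr_gt0 //; lra.
by rewrite divr_gt0.
Qed.

Lemma bounded_cont (G : R -> plane R) : continuous G ->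
  exists2 r, 0 < r & forall s, s \in `[0, 1] -> `|G s| <= r.
Proof.
move=> cG; have [|c c01 cmax] := @EVT_max R (fun t => `|G t|) 0 1 ler01.
  apply: continuous_subspaceT => t.
  by apply: (@continuous_comp _ _ _ G (fun z : plane R => `|z|)); [exact: cG | exact: norm_continuous].
exists (`|G c| + 1); first by rewrite ltr_wpDl.
by move=> s /cmax Hs; apply: le_trans Hs _; rewrite lerDl.
Qed.

Lemma norm_fst (z : plane R) : `|z.1| <= `|z|.
Proof. by rewrite prod_normE le_max lexx. Qed.

Lemma norm_snd (z : plane R) : `|z.2| <= `|z|.
Proof. by rewrite prod_normE le_max lexx orbT. Qed.

Lemma truncn_near (x y : R) (k : nat) : 0 <= x -> 0 <= y -> `|x - y| < k%:R ->
  (Num.truncn x <= Num.truncn y + k)%N.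
Proof.
move=> x0 y0 xy; have /andP[x1 x2] := truncn_itv x0; have /andP[y1 y2] := truncn_itv y0.
rewrite -ltnS -addSn -(ltr_nat R) natrD; apply: le_lt_trans x1 _.
have : x - y <= `|x - y| by exact: ler_norm.
by lra.
Qed.

Lemma truncn_far (x y : R) (k : nat) : 0 <= x -> 0 <= y ->
  (Num.truncn x <= Num.truncn y + k)%N -> (Num.truncn y <= Num.truncn x + k)%N ->
  `|x - y| < k.+1%:R.
Proof.
move=> x0 y0; have /andP[x1 x2] := truncn_itv x0; have /andP[y1 y2] := truncn_itv y0.
rewrite -!(ler_nat R) !natrD ltr_norml => h1 h2; move: x2 y2; rewrite -!natr1 => x2 y2.
by apply/andP; split; lra.
Qed.
End Separation.

(** * From the arcs of a planar drawing to walks on a grid *)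

Definition nadj n (a : rel 'I_n) : rel nat := fun u v =>
  if insub u is Some x then if insub v is Some y then a x y else false else false.

Lemma nadjE n (a : rel 'I_n) (u v : 'I_n) : nadj a u v = a u v.
Proof. by rewrite /nadj !valK. Qed.

Lemma nadjP n (a : rel 'I_n) u v : nadj a u v -> exists x y : 'I_n,
  [/\ u = x, v = y & a x y].
Proof.
by rewrite /nadj; case: insubP => // x _ <-; case: insubP => // y _ <- xy; exists x, y.
Qed.

Section PlanarDarts.
Variables (R : realType) (n : nat) (a : rel 'I_n).
Hypotheses (aC : symmetric a) (aI : irreflexive a).
Variables (pos : 'I_n -> plane R) (G : 'I_n * 'I_n -> R -> plane R).
Hypothesis posI : injective pos.
Hypothesis Gc : forall e, e \in edges a -> continuous (G e).
Hypothesis G0 : forall e, e \in edges a -> G e 0 = pos e.1.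
Hypothesis G1 : forall e, e \in edges a -> G e 1 = pos e.2.
Hypothesis GI : forall e s t, e \in edges a -> s \in `[0, 1] -> t \in `[0, 1] ->
  G e s = G e t -> s = t.
Hypothesis Gdis : forall e f s t, e \in edges a -> f \in edges a -> e != f ->
  s \in `[0, 1] -> t \in `[0, 1] -> G e s = G f t ->
  (s = 0 \/ s = 1) /\ (t = 0 \/ t = 1).

(** The outer thirds of the arcs make up the stars of the vertices; a middle third contains no end,
    so it meets no other arc. *)
Let third (i : 'I_3) : interval R := `[i%:R / 3, (i%:R + 1) / 3].

Lemma third01 i t : t \in third i -> t \in `[0, 1].
Proof.
rewrite !in_itv /= => /andP[t0 t1]; apply/andP; split.
  by apply: le_trans t0; rewrite divr_ge0.
apply: le_trans t1 _; rewrite ler_pdivrMr // mul1r.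
have : (i%:R : R) <= 2%:R by rewrite ler_nat -ltnS ltn_ord.
by lra.
Qed.

(** Two thirds that do not meet are disjoint compact sets, so they have a positive distance; there
    are finitely many pairs. *)
Lemma arcs_separated : exists2 r : R, 0 < r & forall e f i j,
  e \in edges a -> f \in edges a ->
  (forall s t, s \in third i -> t \in third j -> G e s <> G f t) ->
  forall s t, s \in third i -> t \in third j -> r <= `|G e s - G f t|.
Proof.
have [||r r0 rP] := @fin_pos R (('I_n * 'I_n) * ('I_n * 'I_n) * ('I_3 * 'I_3))%type
  (fun x r => x.1.1 \in edges a -> x.1.2 \in edges a ->
    (forall s t, s \in third x.2.1 -> t \in third x.2.2 -> G x.1.1 s <> G x.1.2 t) ->
    forall s t, s \in third x.2.1 -> t \in third x.2.2 -> r <= `|G x.1.1 s - G x.1.2 t|).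
- move=> [[e f] [i j]] /=; have [ein|ein] := boolP (e \in edges a); last by exists 1.
  have [fin|fin] := boolP (f \in edges a); last by exists 1.
  have [dis|dis] := pselect (forall s t, s \in third i -> t \in third j -> G e s <> G f t);
    last by exists 1.
  have [||r r0 rP] := separation _ _ (Gc ein) (Gc fin) dis; last by exists r.
    by rewrite ler_pM2r ?invr_gt0 //; lra.
  by rewrite ler_pM2r ?invr_gt0 //; lra.
- move=> [[e f] [i j]] /= r r' r'0 r'r rP ein fin dis s t si tj.
  by apply: le_trans r'r _; apply: rP.
- by exists r => // e f i j; apply: (rP ((e, f), (i, j))).
Qed.

Lemma arcs_bounded : exists2 B : R, 0 < B & forall e t,
  e \in edges a -> t \in `[0, 1] -> `|G e t| <= B.
Proof.
have [||r r0 rP] := @fin_pos R ('I_n * 'I_n)%type (fun e r => e \in edges a ->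
  forall t, t \in `[0, 1] -> `|G e t| <= r^-1).
- move=> e; have [ein|ein] := boolP (e \in edges a); last by exists 1.
  by have [r r0 rP] := bounded_cont (Gc ein); exists r^-1; rewrite ?invr_gt0 ?invrK.
- move=> e r r' r'0 r'r rP ein t t01; apply: le_trans (rP ein t t01) _.
  by rewrite lef_pV2 // posrE (lt_le_trans r'0).
- by exists r^-1; rewrite ?invr_gt0 // => e t ein; apply: rP.
Qed.

Lemma arcs_uniform (d : R) : 0 < d -> exists2 K : nat, (0 < K)%N & forall e s t,
  e \in edges a -> s \in `[0, 1] -> `|s - t| <= (3 * K)%:R^-1 -> `|G e s - G e t| < d.
Proof.
move=> d0; have [||r r0 rP] := @fin_pos R ('I_n * 'I_n)%type (fun e r => e \in edges a ->
  forall s t, s \in `[0, 1] -> `|s - t| < r -> `|G e s - G e t| < d).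
- move=> e; have [ein|ein] := boolP (e \in edges a); last by exists 1.
  have [r r0 rP] := uniform_cont (Gc ein) d0; by exists r => // _ s t; apply: rP.
- move=> e r r' r'0 r'r rP ein s t s01 st; apply: rP => //; exact: lt_le_trans st r'r.
- pose K := (Num.truncn r^-1).+1; have rK : r^-1 < K%:R.
    have r1 : 0 <= r^-1 by rewrite invr_ge0 ltW.
    by have /andP[] := truncn_itv r1.
  exists K => // e s t ein s01 st; apply: rP => //; apply: le_lt_trans st _.
  rewrite invf_plt ?posrE ?ltr0n ?muln_gt0 //; apply: lt_le_trans rK _.
  by rewrite ler_nat leq_pmull.
Qed.

Lemma leq_near2 (x y c : nat) : (x <= c + 1)%N -> (c <= y + 1)%N -> (x <= y + 2)%N.
Proof. by lia. Qed.

Lemma planar_darts : exists wd, dart_order (nadj a) wd.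
Proof.
have [r r0 sep] := arcs_separated; have [B B0 bnd] := arcs_bounded.
(* [d] is the side of a cell and bounds the distance of consecutive sample points. Two walks that
   visit the same cell then have sample points less than 3d < r apart, so the corresponding thirds
   meet. *)
pose d := r / 4; have d0 : 0 < d by rewrite divr_gt0.
have [K K0 unif] := arcs_uniform d0.
pose tt (i : nat) : R := i%:R / (3 * K)%:R.
have K3 : 0 < (3 * K)%:R :> R by rewrite ltr0n muln_gt0.
have tt01 i : (i <= 3 * K)%N -> tt i \in `[0, 1].
  by move=> iK; rewrite in_itv /= divr_ge0 ?ler0n //= ler_pdivrMr // mul1r ler_nat.
have ttS i : `|tt i - tt i.+1| <= (3 * K)%:R^-1.
  by rewrite -mulrBl -natr1 opprD addNKr mulN1r normrN normfV ger0_norm // ltW.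
pose cx (z : plane R) := Num.truncn ((z.1 + B) / d).
pose cy (z : plane R) := Num.truncn ((z.2 + B) / d).
pose z e i := G e (tt i).
(* An odd step has already moved to the next sample in the first coordinate but not in the second.
   So consecutive cells are equal or share a side, and the [3 * K] subdivisions give [6 * K]
   steps. *)
pose W e (j : nat) := (cx (z e (if odd j then j./2.+1 else j./2)), cy (z e j./2)).
have zB e i : e \in edges a -> (i <= 3 * K)%N ->
    [/\ 0 <= ((z e i).1 + B) / d, 0 <= ((z e i).2 + B) / d,
     ((z e i).1 + B) / d <= 2 * B / d & ((z e i).2 + B) / d <= 2 * B / d].
  move=> ein iK; have zb := bnd _ _ ein (tt01 _ iK).
  have := le_trans (norm_fst _) zb; have := le_trans (norm_snd _) zb.
  rewrite !ler_norml => /andP[y1 y2] /andP[x1 x2].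
  split; [apply: divr_ge0 | apply: divr_ge0 | |];
  by rewrite ?ler_pM2r ?invr_gt0 ?(ltW d0) // /z; lra.
have cS e i : e \in edges a -> (i < 3 * K)%N ->
    [/\ (cx (z e i) <= cx (z e i.+1) + 1)%N, (cx (z e i.+1) <= cx (z e i) + 1)%N,
        (cy (z e i) <= cy (z e i.+1) + 1)%N & (cy (z e i.+1) <= cy (z e i) + 1)%N].
  move=> ein iK; have [x0 y0 _ _] := zB e i ein (ltnW iK); have [x1 y1 _ _] := zB e i.+1 ein iK.
  have zz := unif e _ _ ein (tt01 _ (ltnW iK)) (ttS i).
  have h1 : `|((z e i).1 + B) / d - ((z e i.+1).1 + B) / d| < 1%:R.
    rewrite -mulrBl normrM normfV (gtr0_norm d0) ltr_pdivrMr // mul1r.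
    by apply: le_lt_trans zz; rewrite opprD addrACA subrr addr0; exact: (norm_fst (z e i - z e i.+1)).
  have h2 : `|((z e i).2 + B) / d - ((z e i.+1).2 + B) / d| < 1%:R.
    rewrite -mulrBl normrM normfV (gtr0_norm d0) ltr_pdivrMr // mul1r.
    by apply: le_lt_trans zz; rewrite opprD addrACA subrr addr0; exact: (norm_snd (z e i - z e i.+1)).
  by split; apply: truncn_near => //; rewrite distrC.
have half_lt j : (j <= 6 * K)%N -> (j./2 <= 3 * K)%N /\ (odd j -> j./2 < 3 * K)%N.
  by lia.
have Wnear e j : e \in edges a -> (j <= 6 * K)%N ->
    (cx (z e j./2) <= (W e j).1 + 1)%N /\ ((W e j).1 <= cx (z e j./2) + 1)%N.
  move=> ein jK; have [j1 j2] := half_lt j jK; rewrite /W /=; case: ifP => oj; last by lia.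
  by have [] := cS e j./2 ein (j2 oj).
have Wsep e f j k : e \in edges a -> f \in edges a -> (j <= 6 * K)%N -> (k <= 6 * K)%N ->
    W e j = W f k -> `|z e j./2 - z f k./2| < r.
  move=> ein fin jK kK [E1 E2].
  have [e1 e2] := Wnear e j ein jK; have [f1 f2] := Wnear f k fin kK.
  rewrite /W /= E1 in e1 e2 f1 f2.
  have [j1 _] := half_lt j jK; have [k1 _] := half_lt k kK.
  have [x0 y0 _ _] := zB e j./2 ein j1; have [x1 y1 _ _] := zB f k./2 fin k1.
  have h1 : `|((z e j./2).1 + B) / d - ((z f k./2).1 + B) / d| < 3%:R.
    by apply: truncn_far => //; [exact: leq_near2 e1 f2 | exact: leq_near2 f1 e2].
  have h2 : `|((z e j./2).2 + B) / d - ((z f k./2).2 + B) / d| < 3%:R.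
    by apply: truncn_far => //; move: E2; rewrite /cy => ->; exact: leq_addr.
  move: h1 h2; rewrite -!mulrBl !normrM !normfV !(gtr0_norm d0) !ltr_pdivrMr // !opprD ![_ + B + _]addrACA !subrr !addr0.
  move=> h1 h2; rewrite prod_normE gt_max /=.
  by apply/andP; split; [apply: lt_trans h1 _ | apply: lt_trans h2 _]; rewrite /d; lra.
pose o1 : 'I_3 := inord 1; pose o2 : 'I_3 := inord 2.
have E3 (x : R) : x / 3 * (3 * K)%:R = x * K%:R.
  by rewrite natrM mulrA divfK // pnatr_eq0.
have o0t j : (j <= 2 * K)%N -> tt j./2 \in third ord0.
  move=> jK; rewrite in_itv /= mul0r divr_ge0 ?ler0n //= ler_pdivrMr // add0r.
  by rewrite E3 mul1r ler_nat; lia.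
have o1t j : (2 * K < j < 4 * K)%N -> tt j./2 \in third o1.
  move=> jK; rewrite in_itv /= inordK // ler_pdivlMr // ler_pdivrMr // !E3.
  have h1 : K%:R <= j./2%:R :> R by rewrite ler_nat; lia.
  have h2 : j./2%:R <= (2 * K)%:R :> R by rewrite ler_nat; lia.
  by rewrite natrM in h2; apply/andP; split; lra.
have o2t j : (4 * K <= j <= 6 * K)%N -> tt j./2 \in third o2.
  move=> jK; rewrite in_itv /= inordK // ler_pdivlMr // ler_pdivrMr // !E3.
  have h1 : (2 * K)%:R <= j./2%:R :> R by rewrite ler_nat; lia.
  have h2 : j./2%:R <= (3 * K)%:R :> R by rewrite ler_nat; lia.
  by rewrite !natrM in h1 h2; apply/andP; split; lra.
have nsep e f i j s t : e \in edges a -> f \in edges a -> s \in third i -> t \in third j ->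
    (forall s t, s \in third i -> t \in third j -> G e s <> G f t) ->
    `|G e s - G f t| < r -> False.
  by move=> ein fin si tj dis; rewrite ltNge (sep e f i j).
have t0 s : s \in third ord0 -> s != 1.
  by rewrite in_itv /= => /andP[_ s1]; apply/eqP => E; move: s1; rewrite E; lra.
have t1 s : s \in third o1 -> s != 0 /\ s != 1.
  by rewrite in_itv /= inordK // => /andP[s0 s1]; split; apply/eqP => E; move: s0 s1; rewrite E; lra.
have t2 s : s \in third o2 -> s != 0.
  by rewrite in_itv /= inordK // => /andP[s0 _]; apply/eqP => E; move: s0; rewrite E; lra.
pose wk u v j : nat * nat := if insub u is Some x then
  if insub v is Some y then W (x, y) j else (0, 0)%N else (0, 0)%N.
pose ctr u : nat * nat :=
  if insub u is Some x then (cx (pos x), cy (pos x)) else (0, 0)%N.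
have edgeP u v : nadj a u v && (u < v)%N -> exists e : 'I_n * 'I_n,
    [/\ e \in edges a, u = e.1, v = e.2 & forall j, wk u v j = W e j].
  case/andP=> /nadjP[x [y [-> -> xy]]] xlty; exists (x, y).
  by rewrite inE /= xlty xy; split=> // j; rewrite /wk !valK.
pose near_end (u : nat) (e : 'I_n * 'I_n) (j : nat) := (e.1 = u :> nat /\ (j <= 2 * K)%N) \/
  (e.2 = u :> nat /\ (4 * K <= j)%N).
pose star u (c : nat * nat) := `[< exists e j, [/\ e \in edges a, (j <= 6 * K)%N, c = W e j &
  near_end u e j] >].
have t02 s : s \in third ord0 -> s \in third o2 -> False.
  by rewrite !in_itv /= inordK // => /andP[_ s0] /andP[s1 _]; lra.
have near_third u e j : e \in edges a -> (j <= 6 * K)%N -> near_end u e j -> exists i,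
    [/\ tt j./2 \in third i, (i = ord0 /\ e.1 = u :> nat) \/ (i = o2 /\ e.2 = u :> nat) &
     forall s, s \in third i ->
      (s = 0 \/ s = 1 -> exists2 x : 'I_n, x = u :> nat & G e s = pos x)].
  move=> ein jK [[Eu j2]|[Eu j4]].
    exists ord0; split=> [||s si]; [exact: o0t | by left |].
    by case=> Es; [exists e.1 => //; rewrite Es G0 | have := t0 _ si; rewrite Es eqxx].
  exists o2; split=> [||s si]; [by apply: o2t; rewrite j4 | by right |].
  by case=> Es; [have := t2 _ si; rewrite Es eqxx | exists e.2 => //; rewrite Es G1].
apply: (@walks_dart_order n (nadj a) (Num.truncn (2 * B / d)).+1
  (Num.truncn (2 * B / d)).+1 (2 * K) (4 * K) (6 * K) wk ctr star).
- move=> u v; rewrite /nadj; case: insubP => [x _ _|_]; case: insubP => [y _ _|_] //.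
- by move=> u; rewrite /nadj; case: insubP.
- by move=> u v /nadjP[x [y [-> _ _]]].
- move=> u v j /edgeP[e [ein -> -> ->]] jK; have [j1 j2] := half_lt j jK.
  have cle i : (i <= 3 * K)%N -> (cx (z e i) < (Num.truncn (2 * B / d)).+1)%N /\
      (cy (z e i) < (Num.truncn (2 * B / d)).+1)%N.
    by move=> iK; have [_ _ x1 y1] := zB e i ein iK; rewrite !ltnS; split; apply: le_truncn.
  rewrite /W /=; split; last by have [] := cle _ j1.
  by case: ifP => oj; [have [] := cle _ (j2 oj) | have [] := cle _ j1].
- move=> u v j /edgeP[e [ein -> -> wkE]] jK; rewrite !wkE.
  have [j1 j2] := half_lt j (ltnW jK); rewrite /W /=; case: ifP => oj /=.
    have [_ _ y1 y2] := cS e j./2 ein (j2 oj).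
    rewrite uphalf_half oj add1n.
    case: (eqVneq (cy (z e j./2)) (cy (z e j./2.+1))) => [->|ne]; first by left.
    by right; rewrite /cadj /= eqxx /=; apply/orP; left; lia.
  have jlt : (j./2 < 3 * K)%N by lia.
  have [x1 x2 _ _] := cS e j./2 ein jlt; rewrite uphalf_half oj add0n.
  case: (eqVneq (cx (z e j./2)) (cx (z e j./2.+1))) => [->|ne]; first by left.
  by right; rewrite /cadj /= eqxx /=; apply/orP; right; lia.
- move=> u v /edgeP[e [ein -> -> wkE]]; rewrite !wkE /ctr !valK /W /=.
  have -> : odd (6 * K) = false by lia.
  have -> : (6 * K)./2 = (3 * K)%N by lia.
  by rewrite /z /tt mul0r divff ?gt_eqF // G0 // G1.
- move=> u v j /edgeP[e [ein -> -> wkE]] jK; apply/asboolP; exists e, j.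
  by rewrite wkE; split=> //; [lia | left].
- move=> u v j /edgeP[e [ein -> -> wkE]] j4 jK; apply/asboolP; exists e, j.
  by rewrite wkE; split=> //; right.
- move=> u c /asboolP[e [j [ein jK -> ne]]]; exists e.1, e.2, j.
  have wkE : wk e.1 e.2 j = W e j by rewrite /wk !valK; case: (e).
  rewrite wkE; split=> //; first by move: ein; rewrite inE nadjE andbC.
(* A cell in two stars comes from two outer thirds that meet. On different edges they meet in a
   common end, so the vertices are equal; on one edge, the first and the last third are disjoint. *)
- move=> u v c /asboolP[e [j [ein jK -> ne]]] /asboolP[f [k [fin kK Ec nf]]].
  have [//|uv] := eqVneq u v; exfalso.
  have [i [ti ie iP]] := near_third _ _ _ ein jK ne.
  have [i' [ti' ie' iP']] := near_third _ _ _ fin kK nf.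
  apply: (nsep e f i i' _ _ ein fin ti ti' _ (Wsep _ _ _ _ ein fin jK kK Ec)).
  move=> s t si tj E; have s01 := third01 si; have t01 := third01 tj.
  have [ef|ef] := eqVneq e f; last first.
    have [s01' t01'] := Gdis ein fin ef s01 t01 E.
    have [x xu Ex] := iP s si s01'; have [y yv Ey] := iP' t tj t01'.
    by move: E; rewrite Ex Ey => /posI xy; move: uv; rewrite -xu -yv xy eqxx.
  subst f; have st := GI ein s01 t01 E; subst t.
  case: ie ie' => -[Ei Eu] [[Ei' Ev]|[Ei' Ev]]; rewrite Ei in si; rewrite Ei' in tj.
  + by rewrite -Eu Ev eqxx in uv.
  + exact: t02 si tj.
  + exact: t02 tj si.
  + by rewrite -Eu Ev eqxx in uv.
(* If [w] is not an end of [e], its star comes from other edges. These meet [e] only at ends of [e],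
   which the middle third does not contain. *)
- move=> u v j w /edgeP[e [ein -> -> wkE]] jm /asboolP[f [k [fin kK Ec nf]]].
  rewrite wkE in Ec; have [->|we1] := eqVneq w e.1; first by left.
  have [->|we2] := eqVneq w e.2; first by right.
  exfalso; have jK : (j <= 6 * K)%N by lia.
  have [i' [ti' _ iP']] := near_third _ _ _ fin kK nf.
  apply: (nsep e f o1 i' _ _ ein fin (o1t j jm) ti' _ (Wsep _ _ _ _ ein fin jK kK Ec)).
  move=> s t si tj E; have [s0 s1] := t1 s si.
  have ef : e != f.
    by apply/eqP=> ef; subst f; case: nf => -[Ew _]; rewrite -Ew eqxx in we1 we2.
  have [[] Es _] := Gdis ein fin ef (third01 si) (third01 tj) E.
    by rewrite Es eqxx in s0.
  by rewrite Es eqxx in s1.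
- move=> u v j u' v' k /edgeP[e [ein -> -> wkE]] /edgeP[f [fin -> -> wkE']] jm km.
  rewrite wkE wkE' => Ec; have jK : (j <= 6 * K)%N by lia.
  have kK : (k <= 6 * K)%N by lia.
  have [->//|ef] := eqVneq e f; exfalso.
  apply: (nsep e f o1 o1 _ _ ein fin (o1t j jm) (o1t k km) _ (Wsep _ _ _ _ ein fin jK kK Ec)).
  move=> s t si tj E; have [s0 s1] := t1 s si.
  have [[] Es _] := Gdis ein fin ef (third01 si) (third01 tj) E.
    by rewrite Es eqxx in s0.
  by rewrite Es eqxx in s1.
- by lia.
Qed.
End PlanarDarts.

Theorem planar_dart_order (R : realType) n (a : rel 'I_n) :
  symmetric a -> irreflexive a -> planar R a -> exists wd, dart_order (nadj a) wd.
Proof.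
move=> aC aI [pos [ec [[posI arcs ends] dis]]].
have [g gP] : exists g : 'I_n * 'I_n -> R -> plane R, forall e, e \in edges a ->
    [/\ {within `[0, 1], continuous (g e)}, {in `[0, 1] &, injective (g e)},
      g e 0 = pos e.1, g e 1 = pos e.2 & ec e = g e @` `[0, 1]].
  suff /boolp.choice[g gP] : forall e, exists g : R -> plane R, e \in edges a ->
    [/\ {within `[0, 1], continuous g}, {in `[0, 1] &, injective g},
      g 0 = pos e.1, g 1 = pos e.2 & ec e = g @` `[0, 1]] by exists g.
  move=> e.
  have [ein|nein] := boolP (e \in edges a); last by exists (fun=> (0, 0)).
  by have [g gE] := arcs e ein; exists g.
have z01 : (0 : R) \in `[0, 1] by rewrite in_itv /= lexx ler01.
have o01 : (1 : R) \in `[0, 1] by rewrite in_itv /= lexx ler01.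
apply: (@planar_darts R n a aC aI pos (fun e => g e \o @clamp R)) => //.
- by move=> e /gP[gc _ _ _ _]; apply: within_clamp.
- by move=> e /gP[_ _ g0 _ _]; rewrite /= clamp_id.
- by move=> e /gP[_ _ _ g1 _]; rewrite /= clamp_id.
- by move=> e s t /gP[_ gI _ _ _] s01 t01; rewrite /= !clamp_id //; apply: gI.
- move=> e f s t ein fin ef s01 t01; rewrite /= !clamp_id // => E.
  have [_ gI g0 g1 ecE] := gP e ein; have [_ fI f0 f1 fcE] := gP f fin.
  have [] := dis e f ein fin ef (g e s).
    by split; [rewrite ecE; exists s | rewrite fcE; exists t].
  move=> h1 h2; split.
    by case: h1; rewrite -?g0 -?g1 => /gI; [left | right]; auto.
  by move: h2; rewrite E => -[]; rewrite -?f0 -?f1 => /fI; [left | right]; auto.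
Qed.

(** * Arcs, rectangles and crossings in the plane *)

Section SquareCurve.
Variable R : realType.
Implicit Types a b u v : R.

Definition sqcl u : R := Num.max (-1) (Num.min 1 u).
(** With [sqy], the boundary of the square of half-side 1, run through counterclockwise from (1, 0)
    as [u] goes from 0 to 8. Absolute values, minima and maxima make continuity immediate; [sqpath]
    lists the five straight pieces. *)
Definition sqx u : R := sqcl (`|u - 4| - 2).
Definition sqy u : R := sqcl (Num.max (2 - `|u - 2|) (u - 8)).

Definition sqpath u a b := [\/ u <= 1 /\ (a = 1 /\ b = u),
  1 <= u <= 3 /\ (a = 2 - u /\ b = 1), 3 <= u <= 5 /\ (a = -1 /\ b = 4 - u) |
  (5 <= u <= 7 /\ (a = u - 6 /\ b = -1)) \/ (7 <= u /\ (a = 1 /\ b = u - 8))].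

Lemma sqpathP u : 0 <= u -> u <= 8 -> sqpath u (sqx u) (sqy u).
Proof.
have cl1 v : 1 <= v -> sqcl v = 1 by move=> h; rewrite /sqcl min_l // max_r //; lra.
have clm v : v <= -1 -> sqcl v = -1 by move=> h; rewrite /sqcl min_r ?max_l //; lra.
have clid v : -1 <= v -> v <= 1 -> sqcl v = v by move=> h h'; rewrite /sqcl min_r ?max_r.
have Xl : u <= 4 -> sqx u = sqcl (2 - u).
  by move=> h; rewrite /sqx ler0_norm; [congr sqcl; lra | lra].
have Xr : 4 <= u -> sqx u = sqcl (u - 6).
  by move=> h; rewrite /sqx ger0_norm; [congr sqcl; lra | lra].
have Y1 : u <= 2 -> sqy u = sqcl u.
  by move=> h; rewrite /sqy ler0_norm ?max_l; [congr sqcl; lra | lra | lra].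
have Y2 : 2 <= u -> u <= 6 -> sqy u = sqcl (4 - u).
  by move=> h h'; rewrite /sqy ger0_norm ?max_l; [congr sqcl; lra | lra | lra].
have Y3 : 6 <= u -> sqy u = sqcl (u - 8).
  by move=> h; rewrite /sqy ger0_norm ?max_r //; lra.
move=> u0 u8; have [h1|h1] := leP u 1.
  by constructor 1; split=> //; split; [rewrite Xl ?cl1 //; lra | rewrite Y1 ?clid //; lra].
have [h3|h3] := leP u 3.
  constructor 2; split; first by apply/andP; split; lra.
  split; first by rewrite Xl ?clid //; lra.
  have [h2|h2] := leP u 2; first by rewrite Y1 ?cl1 //; lra.
  by rewrite Y2 ?cl1 //; lra.
have [h5|h5] := leP u 5.
  constructor 3; split; first by apply/andP; split; lra.
  split; last by rewrite Y2 ?clid //; lra.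
  have [h4|h4] := leP u 4; first by rewrite Xl ?clm //; lra.
  by rewrite Xr ?clm //; lra.
have [h7|h7] := leP u 7; constructor 4; [left | right].
  split; first by apply/andP; split; lra.
  split; first by rewrite Xr ?clid //; lra.
  have [h6|h6] := leP u 6; first by rewrite Y2 ?clm //; lra.
  by rewrite Y3 ?clm //; lra.
by split; [lra | split; [rewrite Xr ?cl1 | rewrite Y3 ?clid]; lra].
Qed.

Lemma sq_inj u v : 0 <= u < 8 -> 0 <= v < 8 -> sqx u = sqx v -> sqy u = sqy v -> u = v.
Proof.
case/andP=> u0 u8 /andP[v0 v8] Ex Ey.
have := sqpathP u0 (ltW u8); have := sqpathP v0 (ltW v8); rewrite Ex Ey.
move: (sqx v) (sqy v) => a b {Ex Ey}.
by case=> [[h1 [h2 h3]]|[/andP[h1 h1'] [h2 h3]]|[/andP[h1 h1'] [h2 h3]]|[[/andP[h1 h1'] [h2 h3]]|[h1 [h2 h3]]]];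
  case=> [[k1 [k2 k3]]|[/andP[k1 k1'] [k2 k3]]|[/andP[k1 k1'] [k2 k3]]|[[/andP[k1 k1'] [k2 k3]]|[k1 [k2 k3]]]]; lra.
Qed.

Lemma sqpath_val u a b a' b' : 0 <= u -> u <= 8 -> sqpath u a b ->
  sqpath u a' b' -> a = a' /\ b = b'.
Proof.
move=> u0 u8.
by case=> [[h1 [h2 h3]]|[/andP[h1 h1'] [h2 h3]]|[/andP[h1 h1'] [h2 h3]]|[[/andP[h1 h1'] [h2 h3]]|[h1 [h2 h3]]]];
  case=> [[k1 [k2 k3]]|[/andP[k1 k1'] [k2 k3]]|[/andP[k1 k1'] [k2 k3]]|[[/andP[k1 k1'] [k2 k3]]|[k1 [k2 k3]]]]; lra.
Qed.

Lemma sq_at u a b : 0 <= u -> u <= 8 -> sqpath u a b -> sqx u = a /\ sqy u = b.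
Proof. by move=> u0 u8; apply: sqpath_val => //; exact: sqpathP. Qed.

Lemma sq0 : sqx 0 = 1 /\ sqy 0 = 0.
Proof. by apply: sq_at => //; constructor 1. Qed.

Lemma sq8 : sqx 8 = 1 /\ sqy 8 = 0.
Proof.
apply: sq_at => //; constructor 4; right; split; first by rewrite ler_nat.
by rewrite subrr.
Qed.

Lemma sq_surj a b : -1 <= a -> a <= 1 -> -1 <= b -> b <= 1 ->
  a = -1 \/ a = 1 \/ b = -1 \/ b = 1 -> exists2 u, 0 <= u <= 8 & sqx u = a /\ sqy u = b.
Proof.
move=> a1 a2 b1 b2.
have pick u : 0 <= u -> u <= 8 -> sqpath u a b ->
    exists2 u, 0 <= u <= 8 & sqx u = a /\ sqy u = b.
  by move=> u0 u8 H; exists u; [rewrite u0 u8 | exact: sq_at].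
case=> [E|[E|[E|E]]].
- by apply: (pick (4 - b)); [lra | lra | constructor 3; split; [apply/andP; split; lra | split; lra]].
- have [b0|b0] := leP 0 b.
    by apply: (pick b) => //; [lra | constructor 1].
  by apply: (pick (b + 8)); [lra | lra | constructor 4; right; split; [lra | split; lra]].
- by apply: (pick (a + 6)); [lra | lra | constructor 4; left; split; [apply/andP; split; lra | split; lra]].
- by apply: (pick (2 - a)); [lra | lra | constructor 2; split; [apply/andP; split; lra | split; lra]].
Qed.

Lemma sq_frame u : 0 <= u <= 8 -> [/\ -1 <= sqx u, sqx u <= 1, -1 <= sqy u, sqy u <= 1 &
  sqx u = -1 \/ sqx u = 1 \/ sqy u = -1 \/ sqy u = 1].
Proof.
case/andP=> u0 u8; have := sqpathP u0 u8; move: (sqx u) (sqy u) => a b.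
by case=> [[h1 [h2 h3]]|[/andP[h1 h1'] [h2 h3]]|[/andP[h1 h1'] [h2 h3]]|[[/andP[h1 h1'] [h2 h3]]|[h1 [h2 h3]]]];
  split; auto; lra.
Qed.

Lemma sqcl_cont : continuous sqcl.
Proof.
move=> t; apply: (@continuous_comp _ _ _ (fun t : R => Num.min 1 t) (Num.max (-1))).
  by apply: continuous_min; [apply: cvg_cst | apply: cvg_id].
by apply: continuous_max; [apply: cvg_cst | apply: cvg_id].
Qed.

Lemma abs_cont (c : R) : continuous (fun u : R => `|u - c|).
Proof.
move=> u; apply: (@continuous_comp _ _ _ (fun u : R => u - c) (fun x : R => `|x|)).
  by apply: cvgB; [exact: cvg_id | exact: cvg_cst].
exact: norm_continuous.
Qed.

Lemma sqx_cont : continuous sqx.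
Proof.
move=> u; apply: (@continuous_comp _ _ _ (fun u : R => `|u - 4| - 2) sqcl); last exact: sqcl_cont.
by apply: cvgB; [exact: abs_cont | exact: cvg_cst].
Qed.

Lemma sqy_cont : continuous sqy.
Proof.
move=> u; apply: (@continuous_comp _ _ _ (fun u : R => Num.max (2 - `|u - 2|) (u - 8)) sqcl);
  last exact: sqcl_cont.
apply: (@continuous_max _ _ (fun u : R => 2 - `|u - 2|) (fun u : R => u - 8)).
  by apply: cvgB; [exact: cvg_cst | exact: abs_cont].
by apply: cvgB; [exact: cvg_id | exact: cvg_cst].
Qed.
End SquareCurve.

Section Plane.
Variable R : realType.
Implicit Types (p q r z : plane R) (A B : set (plane R)).

Lemma pair_cont (T : topologicalType) (f g : T -> R) :
  continuous f -> continuous g -> continuous (fun t => (f t, g t)).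
Proof. by move=> fc gc t; exact: cvg_pair (fc t) (gc t). Qed.

Lemma min_cont (f g : R -> R) : continuous f -> continuous g ->
  continuous (fun t : R => Num.min (f t) (g t)).
Proof. by move=> fc gc t; apply: (@continuous_min _ _ f g); [exact: fc | exact: gc]. Qed.

Lemma arcP A p q : is_arc A p q -> exists g : R -> plane R,
  [/\ continuous g, {in `[0, 1] &, injective g}, g 0 = p, g 1 = q &
      A = g @` `[0, 1] /\ forall t, g t = g (clamp t)].
Proof.
case=> g [gc gI g0 g1 ->]; exists (g \o @clamp R).
have z01 : (0 : R) \in `[0, 1] by rewrite in_itv /= lexx ler01.
have o01 : (1 : R) \in `[0, 1] by rewrite in_itv /= lexx ler01.
split; rewrite /= ?clamp_id //.
- exact: within_clamp.
- by move=> s t s01 t01; rewrite /= !clamp_id //; apply: gI.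
split; last by move=> t; rewrite (clamp_id (clamp_in _)).
by apply/seteqP; split=> [z [t t01 <-]|z [t t01 <-]]; exists t; rewrite //= clamp_id.
Qed.

Lemma arc_of_cont A p q (g : R -> plane R) : continuous g ->
  {in `[0, 1] &, injective g} -> g 0 = p -> g 1 = q -> A = g @` `[0, 1] -> is_arc A p q.
Proof. by move=> gc gI g0 g1 gA; exists g; split=> //; exact: continuous_subspaceT. Qed.

Lemma affine_cont (a b : R) : continuous (fun t : R => a * t + b).
Proof. by move=> t; apply: cvgD; [apply: cvgMr; exact: cvg_id | exact: cvg_cst]. Qed.

Lemma arc_rev A p q : is_arc A p q -> is_arc A q p.
Proof.
case/arcP=> g [gc gI g0 g1 [gA gcl]].
have sym (t : R) : t \in `[0, 1] -> -1 * t + 1 \in `[0, 1].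
  by rewrite !in_itv /= => /andP[t0 t1]; apply/andP; split; lra.
apply: (@arc_of_cont _ _ _ (fun t => g (-1 * t + 1))).
- move=> t; apply: (@continuous_comp _ _ _ (fun t : R => -1 * t + 1) g); last exact: gc.
  exact: affine_cont.
- by move=> s t s01 t01 /gI E; have := E (sym _ s01) (sym _ t01); lra.
- by rewrite mulr0 add0r.
- by rewrite mulr1 addNr.
- rewrite gA; apply/seteqP; split=> z [t t01 <-]; exists (-1 * t + 1); rewrite ?sym //;
  by [apply: sym | congr g; lra].
Qed.

(* Since g is constant outside [0, 1], no case distinction is needed to       *)
(* concatenate two arcs.                                                      *)
Lemma arc_glue A B p q r : is_arc A p q -> is_arc B q r -> A `&` B `<=` [set q] ->
  is_arc (A `|` B) p r.
Proof.
case/arcP=> f [fc fI f0 f1 [fA fcl]] /arcP[g [gc gI g0 g1 [gB gcl]]] AB.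
have c0 (t : R) : t <= 0 -> clamp t = 0.
  by move=> t0; rewrite /clamp min_r ?max_l //; lra.
have c1 (t : R) : 1 <= t -> clamp t = 1.
  by move=> t1; rewrite /clamp min_l ?max_r //; lra.
pose h (t : R) := f (2 * t + 0) + (g (2 * t + -1) - q).
have h1 t : t <= 2^-1 -> h t = f (2 * t).
  by move=> t1; rewrite /h gcl c0 ?g0 ?subrr ?addr0 //; lra.
have h2 t : 2^-1 <= t -> h t = g (2 * t + -1).
  move=> t1; rewrite /h fcl c1 ?f1; last by lra.
  by rewrite addrC subrK.
apply: (@arc_of_cont _ _ _ h).
- move=> t; apply: cvgD.
    apply: (@continuous_comp _ _ _ (fun t : R => 2 * t + 0) f); last exact: fc.
    exact: affine_cont.
  apply: cvgB; last exact: cvg_cst.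
  apply: (@continuous_comp _ _ _ (fun t : R => 2 * t + -1) g); last exact: gc.
  exact: affine_cont.
- have mixed s t : s \in `[0, 1] -> t \in `[0, 1] -> s <= 2^-1 -> 2^-1 < t -> h s = h t -> s = t.
    rewrite !in_itv /= => /andP[s0 s1] /andP[t0 t1] sh th E.
    have : (A `&` B) (h s).
      split; first by rewrite fA h1 //; exists (2 * s) => //=; rewrite in_itv /=; apply/andP; split; lra.
      by rewrite gB E h2 ?ltW //; exists (2 * t + -1) => //=; rewrite in_itv /=; apply/andP; split; lra.
    move/AB => /= Eq; rewrite E h2 ?ltW // -g0 in Eq.
    have := gI (2 * t + -1) 0; rewrite !in_itv /= => /(_ _ _ Eq) H.
    suff: 2 * t + -1 = 0 by lra.
    by apply: H; apply/andP; split; lra.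
  move=> s t s01 t01 E; have [sh|sh] := leP s 2^-1; have [th|th] := leP t 2^-1.
  + move: E; rewrite !h1 // => /fI; rewrite !in_itv /=; rewrite !in_itv /= in s01 t01.
    move: s01 t01 => /andP[s0 s1] /andP[t0 t1] H.
    suff: 2 * s = 2 * t by lra.
    by apply: H; apply/andP; split; lra.
  + exact: mixed.
  + by apply/esym/mixed.
  + move: E; rewrite !h2 ?ltW // => /gI; rewrite !in_itv /=; rewrite !in_itv /= in s01 t01.
    move: s01 t01 => /andP[s0 s1] /andP[t0 t1] H.
    suff: 2 * s + -1 = 2 * t + -1 by lra.
    by apply: H; apply/andP; split; lra.
- by rewrite h1 ?mulr0 //; lra.
- by rewrite h2; [rewrite (_ : 2 * 1 + -1 = 1) //; lra | lra].
- rewrite fA gB; apply/seteqP; split=> [z [] [t]|z [t]]; rewrite /= in_itv /= => /andP[t0 t1] <-.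
  + exists (t / 2); first by rewrite /= in_itv /=; apply/andP; split; lra.
    by rewrite h1; [congr f; lra | lra].
  + exists ((t + 1) / 2); first by rewrite /= in_itv /=; apply/andP; split; lra.
    by rewrite h2; [congr g; lra | lra].
  + have [th|th] := leP t 2^-1.
      by left; exists (2 * t); [rewrite /= in_itv /=; apply/andP; split; lra | rewrite h1].
    right; exists (2 * t + -1); [rewrite /= in_itv /=; apply/andP; split; lra |].
    by rewrite h2 // ltW.
Qed.

Lemma segment_arc p q : p <> q -> is_arc (segment p q) p q.
Proof.
move=> pq; pose g (t : R) : plane R :=
  ((1 - t) * p.1 + t * q.1, (1 - t) * p.2 + t * q.2).
have lin (a b : R) : continuous (fun t : R => (1 - t) * a + t * b).
  move=> t; have -> : (fun t : R => (1 - t) * a + t * b) = (fun t => (b - a) * t + a).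
    by apply/funext=> s; lra.
  exact: affine_cont.
apply: (@arc_of_cont _ _ _ g) => //.
- by apply: pair_cont; exact: lin.
- move=> s t _ _ [E1 E2]; apply/eqP; rewrite -subr_eq0.
  have F1 : (s - t) * (q.1 - p.1) = 0 by lra.
  have F2 : (s - t) * (q.2 - p.2) = 0 by lra.
  case/eqP: F1; rewrite mulf_eq0 => /orP[//|/eqP F1].
  case/eqP: F2; rewrite mulf_eq0 => /orP[//|/eqP F2].
  by case: pq; case: (p) (q) F1 F2 => [p1 p2] [q1 q2] /= F1 F2; congr pair; lra.
- by rewrite /g subr0 !mul1r !mul0r !addr0; case: (p).
- by rewrite /g subrr !mul1r !mul0r !add0r; case: (q).
Qed.

(** The shape of a turn: the distance from the line [x = x0] is proportional to the distance of the
    height from the nearer end of the interval. All turns on one side use the same factor. *)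
Definition tent (S x0 s a b : R) : set (plane R) := [set z |
  a <= z.2 <= b /\ S * (z.1 - x0) = s * Num.min (z.2 - a) (b - z.2)].

Lemma tent_arc (S x0 s a b : R) : 0 < S -> a < b ->
  is_arc (tent S x0 s a b) (x0, a) (x0, b).
Proof.
move=> S0 ab; pose y (t : R) := (b - a) * t + a.
pose g (t : R) : plane R := (x0 + s / S * Num.min (y t - a) (b - y t), y t).
have mc : continuous (fun t : R => Num.min (y t - a) (b - y t)).
  apply: (@min_cont (fun t => y t - a) (fun t => b - y t)) => t.
    by apply: cvgB; [exact: affine_cont | exact: cvg_cst].
  by apply: cvgB; [exact: cvg_cst | exact: affine_cont].
apply: (@arc_of_cont _ _ _ g).
- apply: pair_cont; last exact: affine_cont.
  move=> t; apply: cvgD; first exact: cvg_cst.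
  by apply: cvgMr; exact: mc.
- move=> t t' _ _ [_]; rewrite /y => /addIr/mulfI; apply.
  by rewrite subr_eq0 gt_eqF.
- by rewrite /g /y mulr0 add0r subrr min_l ?mulr0 ?addr0 // subr_ge0 ltW.
- by rewrite /g /y mulr1 subrK subrr min_r ?mulr0 ?addr0 // subr_ge0 ltW.
- apply/seteqP; split=> [[x z] [/andP[/= za zb] /= E]|_ [t t01 <-]].
    exists ((z - a) / (b - a)).
      rewrite /= in_itv /= divr_ge0 ?subr_ge0 // ?(ltW ab) //= ler_pdivrMr ?subr_gt0 //.
      by rewrite mul1r; lra.
    have Ey : y ((z - a) / (b - a)) = z.
      by rewrite /y mulrC divfK ?subrK // subr_eq0 gt_eqF.
    rewrite /g Ey; congr pair.
    by rewrite mulrAC -E [S * _]mulrC mulfK ?gt_eqF // addrC subrK.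
  rewrite /= in_itv /= in t01; case/andP: t01 => t0 t1; split.
    by rewrite /g /y /=; apply/andP; split; nra.
  by rewrite /g /= addrAC subrr add0r mulrA (mulrC S) divfK ?gt_eqF.
Qed.

(** At a common height, the outer of two strictly nested intervals has its nearer end strictly
    farther away. *)
Lemma tent_disjoint (S x0 s a b a' b' : R) : s != 0 ->
  (b < a' \/ b' < a \/ (a < a' /\ b' < b) \/ (a' < a /\ b < b')) ->
  tent S x0 s a b `&` tent S x0 s a' b' = set0.
Proof.
move=> s0 H; apply/seteqP; split=> // z [[/andP[h1 h2] E] [/andP[h3 h4] E']].
have {E E'} E : Num.min (z.2 - a) (b - z.2) = Num.min (z.2 - a') (b' - z.2).
  by apply: (mulfI s0); rewrite -E -E'.
have : Num.min (z.2 - a) (b - z.2) = z.2 - a \/ Num.min (z.2 - a) (b - z.2) = b - z.2.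
  by case: (leP (z.2 - a) (b - z.2)); [left | right].
have : Num.min (z.2 - a') (b' - z.2) = z.2 - a' \/ Num.min (z.2 - a') (b' - z.2) = b' - z.2.
  by case: (leP (z.2 - a') (b' - z.2)); [left | right].
have m1 : Num.min (z.2 - a) (b - z.2) <= z.2 - a by rewrite ge_min lexx.
have m2 : Num.min (z.2 - a) (b - z.2) <= b - z.2 by rewrite ge_min lexx orbT.
have m3 : Num.min (z.2 - a') (b' - z.2) <= z.2 - a' by rewrite ge_min lexx.
have m4 : Num.min (z.2 - a') (b' - z.2) <= b' - z.2 by rewrite ge_min lexx orbT.
move=> [F|F] [F'|F']; case: H => [H|[H|[[H H']|[H H']]]]; lra.
Qed.

Lemma segmentC p q : segment p q = segment q p.
Proof.
have sub p' q' : segment p' q' `<=` segment q' p'.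
  move=> _ [t + <-]; rewrite /= in_itv /= => /andP[t0 t1]; exists (1 - t).
    by rewrite /= in_itv /=; apply/andP; split; lra.
  by congr pair; lra.
by apply/seteqP; split; exact: sub.
Qed.

Lemma tent_segments (S x0 s a b w : R) : 0 < S -> a < b ->
  S * w = s * ((b - a) / 2) ->
  segment (x0, a) (x0 + w, (a + b) / 2) `|` segment (x0 + w, (a + b) / 2) (x0, b)
  = tent S x0 s a b.
Proof.
move=> S0 ab Ew; have Sn0 : S != 0 by rewrite gt_eqF.
have ba0 : b - a != 0 by rewrite subr_eq0 gt_eqF.
have fw t : S * (t * w) = s * (t * ((b - a) / 2)) by rewrite mulrCA Ew mulrCA.
have half t : 0 <= t <= 1 -> tent S x0 s a b (x0 + t * w, a + t * ((b - a) / 2)) /\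
    tent S x0 s a b (x0 + t * w, b - t * ((b - a) / 2)).
  case/andP=> t0 t1; have h1 : 0 <= t * ((b - a) / 2) by rewrite mulr_ge0 //; lra.
  have h2 : t * ((b - a) / 2) <= (b - a) / 2 by rewrite ler_piMl //; lra.
  split; (split; first by rewrite /=; apply/andP; split; lra).
    by rewrite /= min_l; [rewrite addrAC subrr add0r fw; congr (_ * _); lra | lra].
  by rewrite /= min_r; [rewrite addrAC subrr add0r fw; congr (_ * _); lra | lra].
apply/seteqP; split=> [_ [[t + <-]|[t + <-]]|[x y] [/= /andP[ya yb] E]].
- rewrite /= in_itv /= => t01; have [h _] := half t t01.
  by rewrite (_ : (_, _) = (x0 + t * w, a + t * ((b - a) / 2))) //; congr pair; lra.
- rewrite /= in_itv /= => /andP[t0 t1]; have [|_ h] := half (1 - t); first by apply/andP; split; lra.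
  by rewrite (_ : (_, _) = (x0 + (1 - t) * w, b - (1 - t) * ((b - a) / 2))) //; congr pair; lra.
- have xE t : S * (x - x0) = s * (t * ((b - a) / 2)) -> x = x0 + t * w.
    by rewrite -fw => /(mulfI Sn0); lra.
  case: (leP (y - a) (b - y)) E => yy E; [left | right].
    pose t := (y - a) / ((b - a) / 2); have Et : t * ((b - a) / 2) = y - a.
      by rewrite /t divfK // mulf_neq0 // invr_eq0 pnatr_eq0.
    have t01 : t \in `[0, 1] by rewrite in_itv /= divr_ge0 ?ler_pdivrMr /=; lra.
    have Ex := xE t; rewrite Et in Ex; move: t t01 Et {xE} Ex => t t01 Et /(_ E) Ex.
    by exists t => //; rewrite Ex; congr pair => /=; lra.
  pose t := (b - y) / ((b - a) / 2); have Et : t * ((b - a) / 2) = b - y.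
    by rewrite /t divfK // mulf_neq0 // invr_eq0 pnatr_eq0.
  have t0 : 0 <= t by rewrite divr_ge0; lra.
  have t1 : t <= 1 by rewrite ler_pdivrMr; lra.
  have Ex := xE t; rewrite Et in Ex; move: t t0 t1 Et {xE} Ex => t t0 t1 Et /(_ E) Ex.
  exists (1 - t); last by rewrite Ex; congr pair => /=; lra.
  by rewrite /= in_itv /=; apply/andP; split; lra.
Qed.

Definition rect (x1 x2 y1 y2 : R) : set (plane R) :=
  [set z | x1 <= z.1 <= x2 /\ y1 <= z.2 <= y2].
Definition orect (x1 x2 y1 y2 : R) : set (plane R) :=
  [set z | x1 < z.1 < x2 /\ y1 < z.2 < y2].

Lemma fst_cont : continuous (fun z : plane R => z.1).
Proof. by move=> z; exact: cvg_fst. Qed.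

Lemma snd_cont : continuous (fun z : plane R => z.2).
Proof. by move=> z; exact: cvg_snd. Qed.

Lemma open_preim (f : plane R -> R) (D : set R) : continuous f -> open D ->
  open [set z | D (f z)].
Proof. by move=> fc oD; apply: (open_comp _ oD) => z _; exact: fc. Qed.

Lemma orect_open x1 x2 y1 y2 : open (orect x1 x2 y1 y2).
Proof.
have -> : orect x1 x2 y1 y2 = [set z | `]x1, x2[%classic z.1] `&` [set z | `]y1, y2[%classic z.2].
  by apply/seteqP; split=> z /=; rewrite !in_itv.
apply: openI; apply: open_preim; do ?exact: interval_open;
by [exact: fst_cont | exact: snd_cont].
Qed.

Lemma rectE x1 x2 y1 y2 : rect x1 x2 y1 y2 = `[x1, x2]%classic `*` `[y1, y2]%classic.
Proof. by apply/seteqP; split=> z /=; rewrite !in_itv. Qed.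

Lemma rect_compact x1 x2 y1 y2 : compact (rect x1 x2 y1 y2).
Proof. by rewrite rectE; apply: compact_setX; exact: segment_compact. Qed.

Lemma plane_hausdorff : hausdorff_space (plane R).
Proof. exact: norm_hausdorff. Qed.

Lemma rect_closed x1 x2 y1 y2 : closed (rect x1 x2 y1 y2).
Proof. exact: compact_closed plane_hausdorff (@rect_compact _ _ _ _). Qed.

Section Rect.
Variables x1 x2 y1 y2 : R.
Hypotheses (x12 : x1 < x2) (y12 : y1 < y2).

(** Aiming at the centre of the rectangle shows that boundary points are in the closure of the open
    rectangle; aiming away from it, that they are not interior. *)
Lemma near_toward (z w : plane R) (U : set (plane R)) : nbhs z U ->
  exists2 t : R, 0 < t < 1 & U ((1 - t) * z.1 + t * w.1, (1 - t) * z.2 + t * w.2).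
Proof.
move=> Uz; pose f (t : R) : plane R := ((w.1 - z.1) * t + z.1, (w.2 - z.2) * t + z.2).
have fc : continuous f by apply: pair_cont; exact: affine_cont.
have : nbhs (0 : R) (f @^-1` U).
  by apply: fc; rewrite /f !mulr0 !add0r; case: (z) Uz.
case/nbhs_ballP=> e /= e0 eP; pose m := Num.min (e / 2) 2^-1.
have m0 : 0 < m by rewrite lt_min divr_gt0 //=; lra.
have me : m <= e / 2 by rewrite ge_min lexx.
have m1 : m <= 2^-1 by rewrite ge_min lexx orbT.
move: m m0 me m1 => m m0 me m1; exists m; first by apply/andP; split; lra.
rewrite (_ : (_, _) = f m); last by rewrite /f; congr pair; lra.
by apply: (eP m); rewrite /ball /= sub0r normrN gtr0_norm //; lra.
Qed.

Lemma rect_interior : interior (rect x1 x2 y1 y2) = orect x1 x2 y1 y2.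
Proof.
apply/seteqP; split; last first.
  move=> z zo; apply: (@filterS _ _ _ (orect x1 x2 y1 y2)).
    by move=> w [/andP[? ?] /andP[? ?]]; split; rewrite !ltW.
  by apply: open_nbhs_nbhs; split=> //; exact: orect_open.
move=> z zi; have [/andP[a1 a2] /andP[b1 b2]] := nbhs_singleton zi.
have [t /andP[t0 t1] [/= /andP[c1 c2] /andP[c3 c4]]] :=
  near_toward (z.1 + (z.1 - (x1 + x2) / 2), z.2 + (z.2 - (y1 + y2) / 2)) zi.
split; apply/andP; split; rewrite lt_neqAle ?a1 ?a2 ?b1 ?b2 andbT; apply/eqP => E.
- have : t * (x2 - x1) <= 0 by rewrite -E in c1; lra.
  by rewrite pmulr_rle0 // subr_le0 leNgt x12.
- have : t * (x2 - x1) <= 0 by rewrite E in c2; lra.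
  by rewrite pmulr_rle0 // subr_le0 leNgt x12.
- have : t * (y2 - y1) <= 0 by rewrite -E in c3; lra.
  by rewrite pmulr_rle0 // subr_le0 leNgt y12.
- have : t * (y2 - y1) <= 0 by rewrite E in c4; lra.
  by rewrite pmulr_rle0 // subr_le0 leNgt y12.
Qed.

Lemma orect_closure : closure (orect x1 x2 y1 y2) = rect x1 x2 y1 y2.
Proof.
apply/seteqP; split.
  rewrite [X in _ `<=` X]((closure_id _).1 (@rect_closed _ _ _ _)).
  by apply: closure_subset => w [/andP[? ?] /andP[? ?]]; split; rewrite !ltW.
move=> z [/andP[a1 a2] /andP[b1 b2]] U /(near_toward ((x1 + x2) / 2, (y1 + y2) / 2)).
case=> t /andP[t0 t1] /= Ut; eexists; split; last exact: Ut.
have h1 : t * (x2 - x1) > 0 by rewrite mulr_gt0 // subr_gt0.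
have h2 : t * (y2 - y1) > 0 by rewrite mulr_gt0 // subr_gt0.
have h3 : 0 <= (1 - t) * (z.1 - x1) by rewrite mulr_ge0 //; lra.
have h4 : 0 <= (1 - t) * (x2 - z.1) by rewrite mulr_ge0 //; lra.
have h5 : 0 <= (1 - t) * (z.2 - y1) by rewrite mulr_ge0 //; lra.
have h6 : 0 <= (1 - t) * (y2 - z.2) by rewrite mulr_ge0 //; lra.
by split=> /=; apply/andP; split; lra.
Qed.

Definition frame : set (plane R) := [set z | rect x1 x2 y1 y2 z /\
  (z.1 = x1 \/ z.1 = x2 \/ z.2 = y1 \/ z.2 = y2)].

Lemma rect_bnd : bnd (rect x1 x2 y1 y2) = frame.
Proof.
rewrite /bnd -(closure_id _).1; last exact: rect_closed.
rewrite rect_interior; apply/seteqP; split=> [z [zr zo]|z [zr zf]].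
  split=> //; case: zr => /andP[a1 a2] /andP[b1 b2].
  apply: contrapT => nf; apply: zo.
  by split; apply/andP; split; rewrite lt_neqAle ?a1 ?a2 ?b1 ?b2 andbT; apply/eqP => E; apply: nf; rewrite E; auto.
split=> // -[/andP[a1 a2] /andP[b1 b2]].
by case: zf => [E|[E|[E|E]]]; move: a1 a2 b1 b2; rewrite E ltxx.
Qed.

Lemma convex_rect_connected (D : set (plane R)) c : D c ->
  (forall z, D z -> segment c z `<=` D) -> connected D.
Proof.
move=> Dc star; have -> : D = \bigcup_(z in D) segment c z.
  apply/seteqP; split=> [z Dz|z [w Dw /star]]; last exact.
  exists z => //; exists 1; first by rewrite /= in_itv /= lexx ler01.
  by rewrite subrr !mul0r !mul1r !add0r; case: (z).
apply: bigcup_connected.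
  exists c => z Dz; exists 0; first by rewrite /= in_itv /= lexx ler01.
  by rewrite subr0 !mul0r !mul1r !addr0; case: (c).
move=> z Dz; apply: connected_continuous_connected; first exact: segment_connected.
apply: continuous_subspaceT; apply: pair_cont => t.
  have -> : (fun t : R => (1 - t) * c.1 + t * z.1) = (fun t => (z.1 - c.1) * t + c.1).
    by apply/funext=> s; lra.
  exact: affine_cont.
have -> : (fun t : R => (1 - t) * c.2 + t * z.2) = (fun t => (z.2 - c.2) * t + c.2).
  by apply/funext=> s; lra.
exact: affine_cont.
Qed.

Lemma orect_connected : connected (orect x1 x2 y1 y2).
Proof.
apply: (@convex_rect_connected _ ((x1 + x2) / 2, (y1 + y2) / 2)).
  by move: x12 y12 => hx hy; split=> /=; apply/andP; split; lra.
move=> z [/andP[a1 a2] /andP[b1 b2]] _ [t + <-]; rewrite /= in_itv /= => /andP[t0 t1].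
by split=> /=; apply/andP; split; nra.
Qed.

Lemma rect_connected : connected (rect x1 x2 y1 y2).
Proof.
apply: (@convex_rect_connected _ ((x1 + x2) / 2, (y1 + y2) / 2)).
  by move: x12 y12 => hx hy; split=> /=; apply/andP; split; lra.
move=> z [/andP[a1 a2] /andP[b1 b2]] _ [t + <-]; rewrite /= in_itv /= => /andP[t0 t1].
by split=> /=; apply/andP; split; nra.
Qed.

Lemma frame_segments : segment (x1, y1) (x2, y1) `|` segment (x2, y1) (x2, y2) `|`
  segment (x2, y2) (x1, y2) `|` segment (x1, y2) (x1, y1) = frame.
Proof.
have mid (a b c : R) : a <= b -> a <= c -> c <= b -> exists2 t : R, t \in `[0, 1] &
    c = (1 - t) * a + t * b /\ c = (1 - (1 - t)) * b + (1 - t) * a.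
  move=> ab ac cb; have [E|ne] := eqVneq a b.
    by exists 0; [rewrite in_itv /= lexx ler01 | lra].
  have ba : 0 < b - a by rewrite subr_gt0 lt_neqAle ne.
  exists ((c - a) / (b - a)).
    by rewrite in_itv /= divr_ge0 ?subr_ge0 //= ler_pdivrMr // mul1r; lra.
  have E : (c - a) / (b - a) * (b - a) = c - a by rewrite divfK // gt_eqF.
  by move: (_ / _) E => t E; split; lra.
have flip (t : R) : t \in `[0, 1] -> 1 - t \in `[0, 1].
  by rewrite !in_itv /= => /andP[? ?]; apply/andP; split; lra.
move: x12 y12 => hx hy; apply/seteqP; split=> [_ [[[|]|]|] [t + <-]|].
1-4: rewrite /= in_itv /= => /andP[t0 t1].
- by split; [split; apply/andP; split => /=; nra | right; right; left => /=; lra].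
- by split; [split; apply/andP; split => /=; nra | right; left => /=; lra].
- by split; [split; apply/andP; split => /=; nra | right; right; right => /=; lra].
- by split; [split; apply/andP; split => /=; nra | left => /=; lra].
move=> [x y] [[/= /andP[xa xb] /andP[ya yb]] [E|[E|[E|E]]]]; subst.
- right; have [t t01 [E1 E2]] := mid y1 y2 y (ltW hy) ya yb.
  by exists (1 - t); [exact: flip | congr pair => /=; lra].
- left; left; right; have [t t01 [E1 E2]] := mid y1 y2 y (ltW hy) ya yb.
  by exists t => //; congr pair => /=; lra.
- left; left; left; have [t t01 [E1 E2]] := mid x1 x2 x (ltW hx) xa xb.
  by exists t => //; congr pair => /=; lra.
- left; right; have [t t01 [E1 E2]] := mid x1 x2 x (ltW hx) xa xb.
  by exists (1 - t); [exact: flip | congr pair => /=; lra].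
Qed.

Lemma frame_closed_curve : is_closed_curve frame.
Proof.
pose dx := (x2 - x1) / 2; pose dy := (y2 - y1) / 2.
pose g (t : R) : plane R :=
  (dx * sqx (8 * t + 0) + (x1 + x2) / 2, dy * sqy (8 * t + 0) + (y1 + y2) / 2).
have dx0 : 0 < dx by rewrite divr_gt0 // subr_gt0.
have dy0 : 0 < dy by rewrite divr_gt0 // subr_gt0.
have Ex1 : dx * -1 + (x1 + x2) / 2 = x1 by rewrite /dx; lra.
have Ex2 : dx * 1 + (x1 + x2) / 2 = x2 by rewrite /dx; lra.
have Ey1 : dy * -1 + (y1 + y2) / 2 = y1 by rewrite /dy; lra.
have Ey2 : dy * 1 + (y1 + y2) / 2 = y2 by rewrite /dy; lra.
have u01 (t : R) : t \in `[0, 1] -> 0 <= 8 * t + 0 <= 8.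
  by rewrite in_itv /= => /andP[? ?]; apply/andP; split; lra.
exists g; split.
- apply: continuous_subspaceT; apply: pair_cont => t; (apply: cvgD; last exact: cvg_cst); apply: cvgMr.
    by apply: (@continuous_comp _ _ _ (fun t : R => 8 * t + 0) (@sqx R)); [exact: affine_cont | exact: sqx_cont].
  by apply: (@continuous_comp _ _ _ (fun t : R => 8 * t + 0) (@sqy R)); [exact: affine_cont | exact: sqy_cont].
- move=> s t; rewrite !in_itv /= => /andP[s0 s1] /andP[t0 t1] [] /addIr/mulfI E1 /addIr/mulfI E2.
  have {}E1 := E1 (lt0r_neq0 dx0); have {}E2 := E2 (lt0r_neq0 dy0).
  suff: 8 * s + 0 = 8 * t + 0 by lra.
  by apply: sq_inj E1 E2; apply/andP; split; lra.
- rewrite /g mulr0 addr0 mulr1 addr0; have [-> ->] := sq0 R.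
  by have [-> ->] := sq8 R.
- apply/seteqP; split.
    move=> [x y] [[/= /andP[xa xb] /andP[ya yb]] fr].
    pose a := (x - (x1 + x2) / 2) / dx; pose b := (y - (y1 + y2) / 2) / dy.
    have Ea : dx * a + (x1 + x2) / 2 = x by rewrite /a mulrC divfK ?gt_eqF // subrK.
    have Eb : dy * b + (y1 + y2) / 2 = y by rewrite /b mulrC divfK ?gt_eqF // subrK.
    have a1 : -1 <= a by rewrite /a ler_pdivlMr // /dx; lra.
    have a2 : a <= 1 by rewrite /a ler_pdivrMr // /dx; lra.
    have b1 : -1 <= b by rewrite /b ler_pdivlMr // /dy; lra.
    have b2 : b <= 1 by rewrite /b ler_pdivrMr // /dy; lra.
    have fr' : a = -1 \/ a = 1 \/ b = -1 \/ b = 1.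
      case: fr => [E|[E|[E|E]]]; [left | right; left | right; right; left | right; right; right].
      - by apply: (mulfI (lt0r_neq0 dx0)); apply: (@addIr _ ((x1 + x2) / 2)); rewrite Ea Ex1.
      - by apply: (mulfI (lt0r_neq0 dx0)); apply: (@addIr _ ((x1 + x2) / 2)); rewrite Ea Ex2.
      - by apply: (mulfI (lt0r_neq0 dy0)); apply: (@addIr _ ((y1 + y2) / 2)); rewrite Eb Ey1.
      - by apply: (mulfI (lt0r_neq0 dy0)); apply: (@addIr _ ((y1 + y2) / 2)); rewrite Eb Ey2.
    have [u u8 [Xu Yu]] := sq_surj a1 a2 b1 b2 fr'; exists (u / 8).
      by rewrite /= in_itv /=; case/andP: u8 => ? ?; apply/andP; split; lra.
    rewrite /g (_ : 8 * (u / 8) + 0 = u); last by lra.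
    by rewrite Xu Yu Ea Eb.
  move=> _ [t /u01 t8 <-]; have := sq_frame t8; rewrite /frame /rect /g /=.
  move: (sqx _) (sqy _) => a b [a1 a2 b1 b2 E].
  have k1 : dx * -1 <= dx * a by rewrite ler_pM2l.
  have k2 : dx * a <= dx * 1 by rewrite ler_pM2l.
  have k3 : dy * -1 <= dy * b by rewrite ler_pM2l.
  have k4 : dy * b <= dy * 1 by rewrite ler_pM2l.
  split.
    split; apply/andP; split; [rewrite -[leLHS]Ex1 | rewrite -[leRHS]Ex2
      | rewrite -[leLHS]Ey1 | rewrite -[leRHS]Ey2]; by rewrite lerD2r.
  by case: E => [->|[->|[->|->]]]; auto.
Qed.

Lemma rect_region : simple_closed_region (rect x1 x2 y1 y2).
Proof.
split; first exact: rect_compact.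
- by rewrite rect_interior orect_closure.
- by rewrite rect_interior; exact: orect_connected.
- by rewrite rect_bnd; exact: frame_closed_curve.
Qed.
End Rect.

Lemma alternate_of_homeo A B p (U : set (plane R)) (h k : plane R -> plane R) :
  open U -> U p -> continuous h -> continuous k -> cancel h k -> cancel k h ->
  (forall z, U z -> (A z <-> (h z).2 = 0) /\ (B z <-> (h z).1 = 0)) ->
  alternate A B p.
Proof.
move=> oU Up hc kc hK kK H.
have hU : [set h x | x in U] = k @^-1` U.
  apply/seteqP; split=> [_ [x Ux <-]|z Uz]; first by rewrite /= hK.
  by exists (k z).
exists U, h, k; split=> //; first exact: continuous_subspaceT.
split; last exact: continuous_subspaceT.
by rewrite hU; apply: open_comp => // z _; exact: kc.
Qed.

(** An affine chart sends the line of slope [m] to one axis and the horizontal line to the other; it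
    is invertible since [m] is not 0. Exchanging the coordinates gives the opposite order of the
    curves. *)
Lemma alternate_line A B p (m : R) (U : set (plane R)) : m != 0 -> open U -> U p ->
  (forall z, U z -> (A z <-> z.2 - p.2 = m * (z.1 - p.1)) /\ (B z <-> z.2 = p.2)) ->
  alternate A B p /\ alternate B A p.
Proof.
move=> m0 oU Up H.
pose h1 (z : plane R) : R := z.2 - p.2.
pose h2 (z : plane R) : R := z.2 - p.2 - m * (z.1 - p.1).
pose k (a b : R) : plane R := ((a - b) / m + p.1, a + p.2).
have h1c : continuous h1.
  by move=> z; apply: cvgB; [exact: snd_cont | exact: cvg_cst].
have h2c : continuous h2.
  move=> z; apply: cvgB; first exact: h1c.
  by apply: cvgMr; apply: cvgB; [exact: fst_cont | exact: cvg_cst].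
have kc : continuous (fun z : plane R => k z.1 z.2).
  apply: pair_cont => z; last by apply: cvgD; [exact: fst_cont | exact: cvg_cst].
  apply: cvgD; last exact: cvg_cst.
  by apply: cvgMl; apply: cvgB; [exact: fst_cont | exact: snd_cont].
have kc' : continuous (fun z : plane R => k z.2 z.1).
  apply: pair_cont => z; last by apply: cvgD; [exact: snd_cont | exact: cvg_cst].
  apply: cvgD; last exact: cvg_cst.
  by apply: cvgMl; apply: cvgB; [exact: snd_cont | exact: fst_cont].
have kh z : k (h1 z) (h2 z) = z.
  by rewrite /k /h1 /h2 subKr mulrC mulKf // !subrK; case: z.
have hk1 a b : h1 (k a b) = a by rewrite /h1 /k /= addrK.
have hk2 a b : h2 (k a b) = b by rewrite /h2 /k /= !addrK mulrC divfK // subKr.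
have HU z : U z -> (A z <-> h2 z = 0) /\ (B z <-> h1 z = 0).
  move=> Uz; have [HA HB] := H z Uz; rewrite /h1 /h2; split.
    by rewrite HA; split=> E; lra.
  by rewrite HB; split=> E; lra.
split.
  apply: (@alternate_of_homeo _ _ _ U (fun z => (h1 z, h2 z)) (fun z => k z.1 z.2)) => //.
  - exact: pair_cont.
  - by move=> z; rewrite /= hk1 hk2; case: z.
apply: (@alternate_of_homeo _ _ _ U (fun z => (h2 z, h1 z)) (fun z => k z.2 z.1)) => //.
- exact: pair_cont.
- by move=> z; rewrite /= hk1 hk2; case: z.
- by move=> z Uz /=; have [? ?] := HU z Uz.
Qed.
End Plane.

(** * The strands, darts and edges of the layout *)

Section Chains.
Variable R : realType.
Implicit Types (s : seq (rat * rat)) (a b : rat * rat).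
Local Notation qp := (qpoint R).

Lemma chain_cons2 a b s : chain R [:: a, b & s] = segment (qp a) (qp b) `|` chain R (b :: s).
Proof.
apply/seteqP; split=> z.
  by case=> pq; rewrite /= inE => /predU1P[->|h] hz; [left | right; exists pq].
by case=> [h|[pq h hz]]; [exists (a, b); rewrite //= mem_head | exists pq; rewrite //= inE h orbT].
Qed.

Lemma chain1 a : chain R [:: a] = set0.
Proof. by apply/seteqP; split=> z // [pq]. Qed.

Lemma chain_cat s1 a b s2 : chain R (rcons s1 a ++ b :: s2) =
  chain R (rcons s1 a) `|` segment (qp a) (qp b) `|` chain R (b :: s2).
Proof.
elim: s1 => [|c [|d s1] IHs] /=; first by rewrite chain_cons2 chain1 set0U.
  by rewrite !chain_cons2 chain1 setU0 setUA.
by rewrite !chain_cons2 IHs !setUA.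
Qed.

Lemma chain_rev s : chain R (rev s) = chain R s.
Proof.
elim: s => [|a [|b s] IHs] //; rewrite chain_cons2 -IHs !rev_cons -[rcons (rcons _ _) a]cats1.
by rewrite chain_cat chain1 setU0 setUC segmentC.
Qed.

Lemma chain_mkseq (f : nat -> rat * rat) k : chain R (mkseq f k.+1) =
  [set z | exists2 i, (i < k)%N & segment (qp (f i)) (qp (f i.+1)) z].
Proof.
elim: k => [|k IHk]; first by rewrite chain1; apply/seteqP; split=> z // [].
have mkS j : mkseq f j.+1 = rcons (mkseq f j) (f j).
  by rewrite /mkseq iota0S map_cat cats1.
rewrite mkS mkS -cats1 chain_cat chain1 setU0 -mkS IHk.
apply/seteqP; split=> z.
  by case=> [[i ik h]|h]; [exists i => //; exact: ltnW | exists k].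
case=> i; rewrite ltnS leq_eqVlt => /predU1P[->|ik] h; first by right.
by left; exists i.
Qed.

Lemma qpointE (a b c d : nat) : qp (ipoint a b c d) = (a%:R - b%:R, c%:R - d%:R).
Proof. by rewrite /qpoint /ipoint /= !ratr_int !intrB -!pmulrn. Qed.
End Chains.

Section RealFacts.
Variable R : realType.
Implicit Types (S H k A B t a b x y : R).

Lemma convex_strict a b a' b' t : 0 <= t <= 1 -> a < a' -> b <= b' ->
  (1 - t) * a + t * b = (1 - t) * a' + t * b' -> t = 1 /\ b = b'.
Proof.
case/andP=> t0 t1 aa bb E.
have h1 : 0 <= (1 - t) * (a' - a) by rewrite mulr_ge0; lra.
have h2 : 0 <= t * (b' - b) by rewrite mulr_ge0; lra.
have /eqP : (1 - t) * (a' - a) = 0 by lra.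
rewrite mulf_eq0 => /orP[/eqP e|/eqP e]; last by lra.
have t1' : t = 1 by lra.
by split=> //; rewrite t1' in E; lra.
Qed.

(** The segment starts at height at least [S] in absolute value and has slope at most [2 * H]. Over
    a horizontal distance of [2 * k] it loses at most 4kH, too little to reach the strip of
    half-height [k]. *)
Lemma far_from_start S H k A B t : 1 <= k -> 1 <= H -> 16 * (k * H) + 16 <= S ->
  0 <= t <= 1 -> A <= -1 \/ 1 <= A -> `|A| <= H -> `|B| <= H ->
  `|S * ((1 - t) * A + t * B)| <= k -> 2 * k < t * S.
Proof.
move=> k1 H1 SH /andP[t0 t1] A1 AH BH.
have kH : k <= k * H by rewrite ler_peMr //; lra.
have S0 : 0 <= S by lra.
rewrite ltNge !ler_norml => /andP[h1 h2]; apply/negP=> tS.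
have T0 : 0 <= t * S by rewrite mulr_ge0.
move: AH BH; rewrite !ler_norml => /andP[a1 a2] /andP[b1 b2].
have b3 : t * S * H <= 2 * (k * H) by rewrite mulrA ler_wpM2r //; lra.
case: A1 => hA.
  have e1 : S * A <= S * -1 by rewrite ler_wpM2l.
  have e2 : t * S * (B - A) <= t * S * (2 * H) by rewrite ler_wpM2l //; lra.
  lra.
have e1 : S * 1 <= S * A by rewrite ler_wpM2l.
have e2 : t * S * (A - B) <= t * S * (2 * H) by rewrite ler_wpM2l //; lra.
lra.
Qed.

(** A segment that ends on the x-axis has slope at least 1 in absolute value, so it enters the strip
    of half-height [k] within horizontal distance [k] of its end. *)
Lemma near_end0 S k A t : 0 <= S -> t <= 1 -> A <= -1 \/ 1 <= A ->
  `|S * ((1 - t) * A + t * 0)| <= k -> (1 - t) * S <= k.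
Proof.
move=> S0 t1 A1; rewrite mulr0 addr0 ler_norml => /andP[h1 h2].
have T0 : 0 <= (1 - t) * S by rewrite mulr_ge0 //; lra.
case: A1 => hA.
  have e1 : (1 - t) * S * A <= (1 - t) * S * -1 by rewrite ler_wpM2l.
  lra.
have e1 : (1 - t) * S * 1 <= (1 - t) * S * A by rewrite ler_wpM2l.
lra.
Qed.

Lemma signed_eq k x y : 1 <= k -> x = k \/ x = - k -> y = k \/ y = - k ->
  0 < x * y -> x = y.
Proof.
move=> k1 hx hy; have kk : 0 < k * k by rewrite mulr_gt0; lra.
by case: hx => ->; case: hy => -> //; rewrite ?mulrN ?mulNr oppr_gt0; lra.
Qed.
End RealFacts.

Section Geometry.
Variables (R : realType) (n nd : nat) (ord da db : nat -> nat).
Local Notation lx := (lx n ord).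
Local Notation ly := (ly n nd ord da).
Local Notation lh := (lh nd).
Local Notation lt := (lt nd da).
Local Notation hgt := (hgt nd da).
Local Notation rng := (rng n ord da).
Implicit Types (b : bool) (p q i : nat) (z w : plane R).

Definition Sc : R := (lscale n nd)%:R.
Definition Hm : R := (lbase nd nd)%:R.

Lemma Hm1 : 1 <= Hm.
Proof. by rewrite /Hm ler1n; have := lbase_ge nd nd; lia. Qed.

Lemma Sc_big (k : nat) : (k <= n)%N -> 16 * (k%:R * Hm) + 16 <= Sc.
Proof.
move=> kn; rewrite /Sc /Hm -natrM -natrM -natrD ler_nat /lscale /lhalf.
have h : (k * lbase nd nd <= n * lbase nd nd.+1)%N by apply: leq_mul => //; apply: lbase_le.
by rewrite -(mulnA 8); move: h; move: (k * _)%N (n * _)%N => a b; lia.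
Qed.

Lemma Sc0 : 0 < Sc.
Proof. by have := Sc_big (leq0n n); rewrite mul0r mulr0 add0r; lra. Qed.

Hypothesis ncv : nc_ok nd (samev da).
Hypothesis nce : nc_ok nd (samee da db).
Hypothesis ordP : ord_ok n ord.
Hypothesis dan : forall p, (p < nd)%N -> (da p < n)%N.

(** The height over the abscissa [i] before scaling: shifted by the level of the vertex there,
    except that a returning strand bends to 0 at its own vertex. *)
Definition hval b p i : R :=
  if ~~ b && (i == lx (da p)) then 0 else (hgt b p)%:R - (ly i)%:R.
Definition sp b p i : plane R := (Sc * i%:R, Sc * hval b p i).
Definition line b p i (x : R) : R :=
  Sc * hval b p i + (hval b p i.+1 - hval b p i) * (x - Sc * i%:R).
Definition seg b p i : set (plane R) := [set z |
  Sc * i%:R <= z.1 <= Sc * i.+1%:R /\ z.2 = line b p i z.1].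
Definition strand b p : set (plane R) :=
  [set z | exists2 i, (i < rng b p)%N & seg b p i z].

Lemma val_nz b p i : (p < nd)%N -> (i < rng b p)%N -> hval b p i <= -1 \/ 1 <= hval b p i.
Proof.
move=> pn ir; rewrite /hval ifN; last first.
  by case: b ir => //= ir; rewrite ltn_eqF.
have := @hgt_ly n nd ord da b p i pn.
case: (ltngtP (hgt b p) (ly i)) => // h _.
  by left; move: h; rewrite -(ler_nat R) -natr1; lra.
by right; move: h; rewrite -(ler_nat R) -natr1; lra.
Qed.

Lemma val_end b p i : (p < nd)%N -> (i <= rng b p)%N ->
  [\/ hval b p i <= -1, 1 <= hval b p i | [/\ hval b p i = 0, b = false & i = lx (da p)]].
Proof.
move=> pn ir; have hg := @hgt_ly n nd ord da b p i pn.
rewrite /hval; case: ifP => [/andP[/negbTE-> /eqP->]|_]; first by constructor 3.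
case: (ltngtP (hgt b p) (ly i)) => // h.
  by constructor 1; move: h; rewrite -(ler_nat R) -natr1; lra.
by constructor 2; move: h; rewrite -(ler_nat R) -natr1; lra.
Qed.

Lemma val_le b p i : (p < nd)%N -> `|hval b p i| <= Hm.
Proof.
move=> pn; rewrite /hval; case: ifP => _; first by rewrite normr0; have := Hm1; lra.
have := @hgt_le nd da b p pn; have := ly_le n nd ord da i.
rewrite -!(ler_nat R) -/Hm => h1 h2.
have g1 : 0 <= (hgt b p)%:R :> R by [].
have g2 : 0 <= (ly i)%:R :> R by [].
by rewrite ler_norml; apply/andP; split; lra.
Qed.

(** At one abscissa all strands are shifted by the same amount, which keeps their order. Only
    strands that end there leave their place, moving up to the vertex, and by [hgt_end] they
    overtake no strand that goes on. *)
Lemma val_order b p b' q i : (p < nd)%N -> (q < nd)%N -> (hgt b p < hgt b' q)%N ->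
  (i <= rng b p)%N -> (i <= rng b' q)%N -> hval b p i < hval b' q i \/
  [/\ b = false, b' = false, da p = da q, i = lx (da p) & hval b p i = hval b' q i].
Proof.
move=> pn qn hh ip iq; rewrite /hval.
case: ifP => [/andP[/negbTE b0 /eqP iE]|ne]; case: ifP => [/andP[/negbTE b0' /eqP iE']|ne'].
- by right; split=> //; apply: (lx_inj ordP); rewrite ?dan // -iE.
- left; rewrite b0 in hh; case: (hgt_end ordP dan pn qn hh) => [[b'0 dq]|h].
    by rewrite b'0 dq iE eqxx in ne'.
  by rewrite subr_gt0 ltr_nat iE.
- left; rewrite subr_lt0 ltr_nat iE'; rewrite b0' in hh.
  exact: ltn_trans hh (lt_end ordP dan qn).
- by left; rewrite ltrD2r ltr_nat.
Qed.

Lemma line_start b p i : line b p i (Sc * i%:R) = Sc * hval b p i.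
Proof. by rewrite /line subrr mulr0 addr0. Qed.

Lemma line_end b p i : line b p i (Sc * i.+1%:R) = Sc * hval b p i.+1.
Proof. by rewrite /line -mulrBr -natr1 [_ + 1]addrC addrK mulr1; lra. Qed.

Lemma seg_segment b p i : segment (sp b p i) (sp b p i.+1) = seg b p i.
Proof.
have S0 := Sc0; have sE : Sc * i.+1%:R = Sc * i%:R + Sc by rewrite -natr1 mulrDr mulr1.
apply/seteqP; split=> [_ [t + <-]|[x y] [/= /andP[x1 x2] E]].
  rewrite /= in_itv /= => /andP[t0 t1]; rewrite /seg /line /sp /= sE.
  have h : 0 <= t * Sc by rewrite mulr_ge0 // ltW.
  have h' : t * Sc <= Sc by rewrite ler_piMl // ltW.
  by split; [apply/andP; split; lra | lra].
have Et : (x - Sc * i%:R) / Sc * Sc = x - Sc * i%:R by rewrite divfK // gt_eqF.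
exists ((x - Sc * i%:R) / Sc).
  by rewrite /= in_itv /= divr_ge0 ?ler_pdivrMr //=; lra.
rewrite E /line /sp /= sE; move: (_ / Sc) Et => t Et.
by rewrite -Et; congr pair; lra.
Qed.

Lemma segP b p i z : seg b p i z -> exists2 t, 0 <= t <= 1 &
  z = (Sc * (i%:R + t), Sc * ((1 - t) * hval b p i + t * hval b p i.+1)).
Proof.
rewrite -seg_segment => -[t + <-]; rewrite /= in_itv /= => t01; exists t => //.
by rewrite /sp /= -natr1; congr pair; lra.
Qed.

(* Over each abscissa the strands are in the order of their heights. *)
Lemma strand_meet b p b' q z : (p < nd)%N -> (q < nd)%N -> (b, p) <> (b', q) ->
  strand b p z -> strand b' q z ->
  [/\ b = false, b' = false, da p = da q & z = (Sc * (lx (da p))%:R, 0)].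
Proof.
move=> pn qn ne; wlog hh : b p b' q pn qn ne / (hgt b p < hgt b' q)%N => [H|].
  case: (ltngtP (hgt b p) (hgt b' q)) => h; first exact: H.
    have ne' : (b', q) <> (b, p) by move=> E; case: ne.
    move=> s1 s2; have [e1 e2 e3 e4] := H _ _ _ _ qn pn ne' h s2 s1.
    by split=> //; rewrite -e3.
  by have [E1 E2] := hgt_inj pn qn h; case: ne; rewrite E1 E2.
case=> i ip si [j jq sj]; have [t t01 Ez] := segP si; have [t' t01' Ez'] := segP sj.
have S0 := Sc0; case/andP: (t01) => t0 t1; case/andP: (t01') => t0' t1'.
have /(mulfI (lt0r_neq0 S0)) Ex : Sc * (i%:R + t) = Sc * (j%:R + t').
  by rewrite Ez in Ez'; case: Ez'.
have /(mulfI (lt0r_neq0 S0)) Ey : Sc * ((1 - t) * hval b p i + t * hval b p i.+1) =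
    Sc * ((1 - t') * hval b' q j + t' * hval b' q j.+1).
  by rewrite Ez in Ez'; case: Ez'.
case: (ltngtP i j) => ij.
- have ij' : i.+1%:R <= j%:R :> R by rewrite ler_nat.
  rewrite -natr1 in ij'; have t1e : t = 1 by lra.
  have t0e : t' = 0 by lra.
  have jE : j = i.+1 by apply/eqP; rewrite -(eqr_nat R) -natr1; apply/eqP; lra.
  rewrite t1e t0e jE subr0 subrr !mul0r !mul1r add0r addr0 in Ey.
  case: (val_order (i := i.+1) pn qn hh ip) => [|h|[_ b'0 dd ie _]]; first by rewrite -jE ltnW.
    by rewrite Ey ltxx in h.
  by move: jq; rewrite b'0 /rng -dd -ie jE ltnn.
- have ij' : j.+1%:R <= i%:R :> R by rewrite ler_nat.
  rewrite -natr1 in ij'; have t1e : t' = 1 by lra.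
  have t0e : t = 0 by lra.
  have jE : i = j.+1 by apply/eqP; rewrite -(eqr_nat R) -natr1; apply/eqP; lra.
  rewrite t1e t0e jE subr0 subrr !mul0r !mul1r add0r addr0 in Ey.
  case: (val_order (i := j.+1) pn qn hh _ jq) => [|h|[b0 _ dd ie _]]; first by rewrite -jE ltnW.
    by rewrite Ey ltxx in h.
  by move: ip; rewrite b0 /rng -ie jE ltnn.
- subst j; have tt' : t = t' by lra.
  subst t'; have strict : hval b p i < hval b' q i.
    case: (val_order (i := i) pn qn hh (ltnW ip) (ltnW jq)) => [//|[b0 _ _ ie _]].
    by move: ip; rewrite b0 /rng -ie ltnn.
  have weak := val_order (i := i.+1) pn qn hh ip jq.
  have wle : hval b p i.+1 <= hval b' q i.+1 by case: weak => [/ltW//|[_ _ _ _ ->]].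
  have [t1e Eq] := convex_strict t01 strict wle Ey.
  case: weak => [h|[b0 b'0 dd ie _]]; first by rewrite Eq ltxx in h.
  split=> //; rewrite Ez t1e -ie -natr1 subrr mul0r mul1r add0r; congr pair.
  by rewrite /hval b0 /= ie eqxx mulr0.
Qed.

Lemma strand_start b p z : (p < nd)%N -> strand b p z -> z.1 <= 0 -> z = (0, Sc * (hgt b p)%:R).
Proof.
move=> pn [i ir [/andP[x1 x2] E]] z0; have S0 := Sc0.
have i0 : i = 0%N.
  apply/eqP; rewrite -leqn0 -(ler_nat R) -(ler_pM2l S0) mulr0; exact: le_trans x1 z0.
subst i; rewrite mulr0 in x1; have zE : z.1 = 0 by lra.
have v0 : hval b p 0 = (hgt b p)%:R.
  by rewrite /hval ifN ?subr0 //; case: (b) => //=; have [] := lxP ordP (dan pn); case: (lx _).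
case: z E zE {x1 x2 z0} => x y /= -> ->; congr pair.
by have := line_start b p 0; rewrite mulr0 v0.
Qed.

Lemma strand_stop b p z : (p < nd)%N -> strand b p z -> Sc * n.+1%:R <= z.1 ->
  b = true /\ z = (Sc * n.+1%:R, Sc * (lh p)%:R).
Proof.
move=> pn [i ir [/andP[x1 x2] E]] zn; have S0 := Sc0.
have ni : (n.+1 <= i.+1)%N.
  by rewrite -(ler_nat R) -(ler_pM2l S0); exact: le_trans zn x2.
have rn := rng_le ordP dan b pn; have iE : i = n by lia.
have bt : b = true.
  by case: b ir {rn E} => //; rewrite /rng iE; have [_ h _] := lxP ordP (dan pn); lia.
split=> //; rewrite iE in x2 E; have zE : z.1 = Sc * n.+1%:R by lra.
case: z E zE {x1 x2 zn} => x y /= -> ->; congr pair.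
by rewrite line_end /hval bt /= lyS subr0.
Qed.

Lemma strand_arc b p : (p < nd)%N -> is_arc (strand b p) (sp b p 0) (sp b p (rng b p)).
Proof.
move=> pn; have S0 := Sc0.
suff H k : (0 < k)%N -> is_arc [set z | exists2 i, (i < k)%N & seg b p i z] (sp b p 0) (sp b p k).
  by apply: H; apply: rng_gt0.
have segarc i : is_arc (seg b p i) (sp b p i) (sp b p i.+1).
  rewrite -seg_segment; apply: segment_arc => -[/(mulfI (lt0r_neq0 S0))/eqP].
  by rewrite eqr_nat => /eqP; lia.
case: k => // k _; elim: k => [|k IHk].
  rewrite (_ : [set _ | _] = seg b p 0); first exact: segarc.
  by apply/seteqP; split=> z; [case=> -[] | exists 0%N].
rewrite (_ : [set _ | _] = [set z | exists2 i, (i < k.+1)%N & seg b p i z] `|` seg b p k.+1).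
  apply: (arc_glue IHk (segarc k.+1)) => z [[i ik [/andP[x1 x2] E]] [/andP[x3 x4] E']] /=.
  have x5 : Sc * i.+1%:R <= Sc * k.+1%:R by rewrite ler_pM2l // ler_nat.
  have zE : z.1 = Sc * k.+1%:R by lra.
  rewrite /sp -(line_start b p k.+1) -zE.
  by case: (z) E' => x y /= ->.
apply/seteqP; split=> z.
  by case=> i; rewrite ltnS leq_eqVlt => /predU1P[->|ik] s; [right | left; exists i].
by case=> [[i ik s]|s]; [exists i => //; exact: ltnW | exists k.+1].
Qed.

(** With the factor 2 the apex lies at the integer distance [lh p - lt p] from the line, as in
    [lleft]. *)
Definition ltent p : set (plane R) := tent Sc 0 (-2) (Sc * (lt p)%:R) (Sc * (lh p)%:R).
Definition rtent p q : set (plane R) := tent Sc (Sc * n.+1%:R) 2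
  (Sc * (lh (minn p q))%:R) (Sc * (lh (maxn p q))%:R).
Definition dcurve p := strand false p `|` ltent p `|` strand true p.
Definition ecrv p q := dcurve p `|` rtent p q `|` dcurve q.

Lemma tent_x S x0 (s a b : R) z : 0 < S -> tent S x0 s a b z ->
  exists2 m : R, 0 <= m & S * (z.1 - x0) = s * m /\ (m = 0 -> z.2 = a \/ z.2 = b).
Proof.
move=> S0 [/andP[h1 h2] E]; exists (Num.min (z.2 - a) (b - z.2)).
  by rewrite le_min; apply/andP; split; lra.
by split=> //; case: leP => _ h; [left | right]; lra.
Qed.

Lemma ltent_x p z : ltent p z -> z.1 <= 0 /\
  (z.1 = 0 -> z.2 = Sc * (lt p)%:R \/ z.2 = Sc * (lh p)%:R).
Proof.
have S0 := Sc0; case/(tent_x S0)=> m m0 []; rewrite subr0 => E H; split.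
  by rewrite -(ler_pM2l S0) mulr0 E; lra.
by move=> z0; apply: H; rewrite z0 mulr0 in E; lra.
Qed.

Lemma rtent_x p q z : rtent p q z -> Sc * n.+1%:R <= z.1 /\
  (z.1 = Sc * n.+1%:R -> z.2 = Sc * (lh p)%:R \/ z.2 = Sc * (lh q)%:R).
Proof.
have S0 := Sc0; case/(tent_x S0)=> m m0 [E H]; split.
  by rewrite -subr_ge0 -(ler_pM2l S0) mulr0 E; lra.
move=> z0; have m0' : m = 0 by rewrite z0 subrr mulr0 in E; lra.
by move: (H m0'); case: (leqP p q) => _ [|]; auto.
Qed.

Lemma natS_inj (a b : nat) : Sc * a%:R = Sc * b%:R -> a = b.
Proof.
by move/(mulfI (lt0r_neq0 Sc0))/eqP; rewrite eqr_nat => /eqP.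
Qed.

Lemma ltent_strand p b q z : (p < nd)%N -> (q < nd)%N -> ltent p z -> strand b q z ->
  p = q /\ z = (0, Sc * (hgt b q)%:R).
Proof.
move=> pn qn lz sz; have [z0 H] := ltent_x lz.
have zE := strand_start qn sz z0; split=> //; move: H; rewrite zE /= => /(_ erefl).
case=> /natS_inj E.
  by have [_ ->] := @hgt_inj nd da b q false p qn pn E.
by have [_ ->] := @hgt_inj nd da b q true p qn pn E.
Qed.

Lemma rtent_strand p q b r z : (p < nd)%N -> (q < nd)%N -> (r < nd)%N ->
  rtent p q z -> strand b r z ->
  [/\ b = true, r = p \/ r = q & z = (Sc * n.+1%:R, Sc * (lh r)%:R)].
Proof.
move=> pn qn rn tz sz; have [zn H] := rtent_x tz; have [bt zE] := strand_stop rn sz zn.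
split=> //; move: H; rewrite zE /= => /(_ erefl) [] /natS_inj E; [left | right];
by have [] := @hgt_inj nd da true r true _ rn _ E.
Qed.

Lemma ltent_ltent p q z : (p < nd)%N -> (q < nd)%N -> p <> q -> ltent p z -> ltent q z -> False.
Proof.
move=> pn qn; wlog pq : p q pn qn / (p < q)%N => [H ne h1 h2|].
  by case: (ltngtP p q) => // h; [apply: (H p q) | apply: (H q p) => // E; case: ne].
move=> _ h1 h2; have S0 := Sc0.
have mono (a b : nat) : (a < b)%N -> Sc * a%:R < Sc * b%:R by move=> ab; rewrite ltr_pM2l // ltr_nat.
suff E : ltent p `&` ltent q = set0 by have : (ltent p `&` ltent q) z by []; rewrite E.
apply: tent_disjoint; first by rewrite oppr_eq0.
by case: (left_nested ncv pn qn pq) => [h|[h h']]; [left | right; right; right; split]; apply: mono.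
Qed.

Lemma ltent_rtent p q r z : ltent r z -> rtent p q z -> False.
Proof.
move=> /ltent_x[h _] /rtent_x[h' _]; have : 0 < Sc * n.+1%:R by rewrite mulr_gt0 // Sc0.
by lra.
Qed.

Lemma rtent_rtent p q p' q' z : (p < nd)%N -> (q < nd)%N -> (p' < nd)%N -> (q' < nd)%N ->
  p <> q -> p' <> q' -> samee da db p q -> samee da db p' q' ->
  (forall r s : nat, r \in [:: p; q] -> s \in [:: p'; q'] -> r <> s /\ ~~ samee da db r s) ->
  rtent p q z -> rtent p' q' z -> False.
Proof.
move=> pn qn pn' qn' pq pq' s s' H h1 h2; have S0 := Sc0.
have mono (a b : nat) : (a < b)%N -> Sc * a%:R < Sc * b%:R by move=> ab; rewrite ltr_pM2l // ltr_nat.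
have seC (a b : nat) : samee da db a b = samee da db b a.
  by rewrite /samee [da a == _]eq_sym [db a == _]eq_sym [da a == _]eq_sym [db a == da b]eq_sym; congr (_ || _); rewrite andbC.
suff E : rtent p q `&` rtent p' q' = set0.
  by have : (rtent p q `&` rtent p' q') z by []; rewrite E.
have mem1 : minn p q \in [:: p; q] by rewrite !inE; lia.
have mem2 : maxn p q \in [:: p; q] by rewrite !inE; lia.
have mem1' : minn p' q' \in [:: p'; q'] by rewrite !inE; lia.
have mem2' : maxn p' q' \in [:: p'; q'] by rewrite !inE; lia.
have nb (a : nat) : a \in [:: p; q] -> (a < nd)%N by rewrite !inE => /orP[]/eqP->.
have nb' (a : nat) : a \in [:: p'; q'] -> (a < nd)%N by rewrite !inE => /orP[]/eqP->.
apply: tent_disjoint; first by rewrite pnatr_eq0.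
have s1 : samee da db (minn p q) (maxn p q).
  by case: (leqP p q) => _ //; rewrite seC.
have s1' : samee da db (minn p' q') (maxn p' q').
  by case: (leqP p' q') => _ //; rewrite seC.
have [ne1 ns1] := H _ _ mem1 mem1'; have [ne2 _] := H _ _ mem1 mem2'.
have [ne3 _] := H _ _ mem2 mem1'; have [ne4 _] := H _ _ mem2 mem2'.
have := @right_nested nd da db (minn p q) (maxn p q) (minn p' q') (maxn p' q') nce
  (nb _ mem1) (nb _ mem2) (nb' _ mem1') (nb' _ mem2').
have ltm : (minn p q < maxn p q)%N by move: pq; clear; lia.
have ltm' : (minn p' q' < maxn p' q')%N by move: pq'; clear; lia.
rewrite ltm ltm' s1 s1' ns1 seC ns1 => /(_ isT isT isT isT isT isT).
case; try by apply/eqP.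
- by move=> h; left; apply: mono.
- by move=> h; right; left; apply: mono.
- by case=> h h'; right; right; left; split; apply: mono.
- by case=> h h'; right; right; right; split; apply: mono.
Qed.

Lemma dcurve_cases p z : dcurve p z -> (exists b, strand b p z) \/ ltent p z.
Proof. by case=> [[h|h]|h]; [left; exists false | right | left; exists true]. Qed.

Lemma dcurve_meet p q z : (p < nd)%N -> (q < nd)%N -> p <> q -> dcurve p z -> dcurve q z ->
  da p = da q /\ z = (Sc * (lx (da p))%:R, 0).
Proof.
move=> pn qn pq /dcurve_cases[[b h]|h] /dcurve_cases[[b' h']|h'].
- by have [|_ _ ? ?] := strand_meet pn qn _ h h'; [case | split].
- by have [E _] := ltent_strand qn pn h' h; case: pq.
- by have [E _] := ltent_strand pn qn h h'; case: pq.
- by case: (ltent_ltent pn qn pq h h').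
Qed.

Lemma sp0 b p : sp b p 0 = (0, Sc * (hgt b p)%:R).
Proof. by rewrite /sp mulr0 /hval andbF subr0. Qed.

Lemma ecrv_arc p q : (p < nd)%N -> (q < nd)%N -> da p <> da q ->
  is_arc (ecrv p q) (Sc * (lx (da p))%:R, 0) (Sc * (lx (da q))%:R, 0).
Proof.
move=> pn qn dpq; have pq : p <> q by move=> E; rewrite E in dpq.
have S0 := Sc0.
have mono (a b : nat) : (a < b)%N -> Sc * a%:R < Sc * b%:R by move=> ab; rewrite ltr_pM2l // ltr_nat.
have spF r : (r < nd)%N -> sp false r (rng false r) = (Sc * (lx (da r))%:R, 0).
  by move=> rn; rewrite /sp /hval /rng /= eqxx mulr0.
have spT r : sp true r (rng true r) = (Sc * n.+1%:R, Sc * (lh r)%:R).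
  by rewrite /sp /hval /rng /= lyS subr0.
have darc r : (r < nd)%N -> is_arc (dcurve r) (Sc * (lx (da r))%:R, 0) (Sc * n.+1%:R, Sc * (lh r)%:R).
  move=> rn; have a1 := arc_rev (strand_arc false rn); rewrite spF // sp0 // in a1.
  have a2 : is_arc (ltent r) (0, Sc * (lt r)%:R) (0, Sc * (lh r)%:R).
    by apply: tent_arc => //; apply/mono/lt_lh.
  have a3 := strand_arc true rn; rewrite spT sp0 // in a3.
  apply: (arc_glue (arc_glue a1 a2 _) a3).
    by move=> z [h1 h2]; have [_ ->] := ltent_strand rn rn h2 h1.
  move=> z [[h1|h1] h2].
    by have [//|] := strand_meet rn rn _ h1 h2.
  by have [_ ->] := ltent_strand rn rn h1 h2.
have rarc : is_arc (rtent p q) (Sc * n.+1%:R, Sc * (lh p)%:R) (Sc * n.+1%:R, Sc * (lh q)%:R).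
  rewrite /rtent; case: (ltngtP p q) => // h.
  - by apply: tent_arc => //; apply: mono; rewrite lh_mono.
  - by apply: arc_rev; apply: tent_arc => //; apply: mono; rewrite lh_mono.
have rmeet r z : (r < nd)%N -> dcurve r z -> rtent p q z -> z = (Sc * n.+1%:R, Sc * (lh r)%:R).
  move=> rn /dcurve_cases[[b h]|h] h'; last by case: (ltent_rtent h h').
  by have [_ _ ->] := rtent_strand pn qn rn h' h.
apply: (arc_glue (arc_glue (darc p pn) rarc _) (arc_rev (darc q qn))).
  by move=> z [h1 h2]; rewrite (rmeet p z).
move=> z [[h1|h1] h2].
  by have [E _] := dcurve_meet pn qn pq h1 h2; case: dpq.
by rewrite (rmeet q z).
Qed.

Lemma qlpoint (h i : nat) :
  qpoint R (lpoint n nd ord da h i) = (Sc * i%:R, Sc * (h%:R - (ly i)%:R)).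
Proof. by rewrite qpointE subr0 !(natrM _ (lscale n nd)) -mulrBr. Qed.

Lemma qlvertex v : qpoint R (lvertex n nd ord v) = (Sc * (lx v)%:R, 0).
Proof. by rewrite qpointE subr0 subrr (natrM _ (lscale n nd)). Qed.

Lemma ScE : Sc = 2 * (lhalf n nd)%:R.
Proof. by rewrite /Sc /lscale natrM. Qed.

Lemma ltent_segments p : (p < nd)%N ->
  segment (0, Sc * (lt p)%:R) (qpoint R (lleft n nd da p)) `|`
  segment (qpoint R (lleft n nd da p)) (0, Sc * (lh p)%:R) = ltent p.
Proof.
move=> pn; have S0 := Sc0; have h := lt_lh da pn; have SE := ScE.
rewrite /ltent -(@tent_segments R Sc 0 (-2) _ _ (- ((lh p)%:R - (lt p)%:R))) //.
- rewrite qpointE (natrB _ (ltnW h)) (natrM _ (lhalf n nd)) natrD !subr0 !sub0r.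
  have -> : (lhalf n nd)%:R * ((lh p)%:R + (lt p)%:R) =
    (Sc * (lt p)%:R + Sc * (lh p)%:R) / 2 by rewrite SE; lra.
  by [].
- by rewrite ltr_pM2l // ltr_nat.
- by lra.
Qed.

Lemma rtent_segments p q : p <> q ->
  segment (Sc * n.+1%:R, Sc * (lh p)%:R) (qpoint R (lright n nd p q)) `|`
  segment (qpoint R (lright n nd p q)) (Sc * n.+1%:R, Sc * (lh q)%:R) = rtent p q.
Proof.
wlog pq : p q / (p < q)%N => [H|_].
  move=> ne; case: (ltngtP p q) => // h; first by apply: H.
  have := H q p h; rewrite /rtent minnC maxnC => <-; last by move=> E; case: ne.
  have -> : lright n nd q p = lright n nd p q.
    by rewrite /lright addnC [(lh p - _ + _)%N]addnC [(lh q + lh p)%N]addnC addnC.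
  by rewrite setUC segmentC [in X in _ `|` X = _]segmentC.
have S0 := Sc0; have SE := ScE; have h : (lh p < lh q)%N by rewrite lh_mono.
rewrite /rtent (minn_idPl (ltnW pq)) (maxn_idPr (ltnW pq)).
rewrite -(@tent_segments R Sc (Sc * n.+1%:R) 2 _ _ ((lh q)%:R - (lh p)%:R)) //.
- rewrite qpointE (eqP (ltnW h : (_ - _)%N == 0%N)) add0n natrD natrB ?(ltnW h) // (natrM _ (lhalf n nd)) (natrM _ (lscale n nd)) natrD !subr0.
  have -> : (lhalf n nd)%:R * ((lh p)%:R + (lh q)%:R) =
    (Sc * (lh p)%:R + Sc * (lh q)%:R) / 2 by rewrite SE; lra.
  by [].
- by rewrite ltr_pM2l // ltr_nat.
- by lra.
Qed.

Lemma dcurve_chain p : (p < nd)%N -> chain R (ldart n nd ord da p) = dcurve p.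
Proof.
move=> pn; have S0 := Sc0.
(* The vertex that heads [ldart] is treated as the last point of the returning strand, which is then
   listed backwards. *)
pose g i := if i == lx (da p) then lvertex n nd ord (da p) else lpoint n nd ord da (lt p) i.
have qg i : qpoint R (g i) = sp false p i.
  rewrite /g /sp /hval /=; case: eqP => [->|_]; last exact: qlpoint.
  by rewrite qlvertex mulr0.
have qh i : qpoint R (lpoint n nd ord da (lh p) i) = sp true p i by exact: qlpoint.
have mkS (f : nat -> rat * rat) j : mkseq f j.+1 = rcons (mkseq f j) (f j).
  by rewrite /mkseq iota0S map_cat cats1.
have E1 : lvertex n nd ord (da p) :: rev (ltstrand n nd ord da p) = rev (mkseq g (lx (da p)).+1).
  have gL : g (lx (da p)) = lvertex n nd ord (da p) by rewrite /g eqxx.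
  rewrite mkS rev_rcons gL; congr (_ :: rev _).
  apply/eq_in_map => i; rewrite mem_iota /= => il.
  by rewrite /g ltn_eqF.
have E2 : rev (mkseq g (lx (da p)).+1) = rcons (rev (mkseq (g \o S) (lx (da p)))) (g 0%N).
  have mkS0 (f : nat -> rat * rat) j : mkseq f j.+1 = f 0%N :: mkseq (f \o S) j.
    rewrite /mkseq /=; congr (_ :: _).
    by rewrite -[1%N]addn0 iotaDl -map_comp; apply: eq_map => i /=; rewrite add1n.
  by rewrite mkS0 rev_cons.
have E3 : chain R (lleft n nd da p :: lhstrand n nd ord da p) =
    segment (qpoint R (lleft n nd da p)) (sp true p 0) `|` chain R (lhstrand n nd ord da p).
  by rewrite -qh; exact: chain_cons2.
have E4 : chain R (mkseq g (lx (da p)).+1) = strand false p.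
  rewrite chain_mkseq; apply/seteqP; split=> z [i ir] h; exists i => //; move: h; by rewrite !qg seg_segment.
have E5 : chain R (lhstrand n nd ord da p) = strand true p.
  rewrite chain_mkseq; apply/seteqP; split=> z [i ir] h; exists i => //; move: h; by rewrite !qh seg_segment.
rewrite /ldart -cat_cons E1 E2 chain_cat -E2 chain_rev E3 E4 E5 qg !sp0 /dcurve -ltent_segments //.
by rewrite !setUA.
Qed.

Lemma ecrv_chain u v (p := ldpos nd da db u v) (q := ldpos nd da db v u) :
  (p < nd)%N -> (q < nd)%N -> p <> q -> chain R (ledge n nd ord da db u v) = ecrv p q.
Proof.
move=> pn qn pq; rewrite /ledge -/p -/q.
have mkS (f : nat -> rat * rat) j : mkseq f j.+1 = rcons (mkseq f j) (f j).
  by rewrite /mkseq iota0S map_cat cats1.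
have E r : exists s, ldart n nd ord da r = rcons s (lpoint n nd ord da (lh r) n.+1).
  by rewrite /ldart /lhstrand mkS -rcons_cons -rcons_cat -rcons_cons; eexists.
have [s Es] := E p; have [t Et] := E q.
rewrite Es chain_cat -Es dcurve_chain // Et rev_rcons chain_cons2 -rev_rcons -Et chain_rev dcurve_chain //.
by rewrite !qlpoint lyS !subr0 /ecrv -rtent_segments // !setUA.
Qed.
Definition vpoint v : plane R := (Sc * (lx v)%:R, 0).

Lemma Sc_step (i j : nat) : (i < j)%N -> Sc * i%:R + Sc <= Sc * j%:R.
Proof.
move=> ij; have -> : Sc * i%:R + Sc = Sc * i.+1%:R by rewrite -natr1 mulrDr mulr1.
by rewrite ler_pM2l ?Sc0 // ler_nat.
Qed.

Lemma Sc_le (i j : nat) : (i <= j)%N -> Sc * i%:R <= Sc * j%:R.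
Proof. by move=> ij; rewrite ler_pM2l ?Sc0 // ler_nat. Qed.

Lemma Sc_card (k : nat) : (k <= n)%N -> 16 * k%:R + 16 <= Sc.
Proof.
move=> /Sc_big; apply: le_trans; rewrite lerD2r ler_pM2l ?ltr0n //.
by rewrite ler_peMr // Hm1.
Qed.

Lemma strand_vertex b p v : (p < nd)%N -> (v < n)%N -> strand b p (vpoint v) -> v = da p.
Proof.
move=> pn vn [i ir [/= /andP[x1 x2] E]].
have S0 := Sc0; apply: (lx_inj ordP) => //; first exact: dan.
have i1 : (i <= lx v)%N by move: x1; rewrite ler_pM2l // ler_nat.
have i2 : (lx v <= i.+1)%N by move: x2; rewrite ler_pM2l // ler_nat.
have V0 : hval b p (lx v) = 0.
  apply: (mulfI (lt0r_neq0 S0)); rewrite mulr0.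
  have [E'|E'] : lx v = i \/ lx v = i.+1 by move: i1 i2; clear; lia.
    by rewrite E' line_start -E' in E; rewrite -E.
  by rewrite E' line_end -E' in E; rewrite -E.
by case: (@val_end b p (lx v) pn (leq_trans i2 ir)) => [h|h|[]//]; exfalso; rewrite V0 in h; lra.
Qed.

Lemma vpoint_x v : (v < n)%N -> Sc <= (vpoint v).1 /\ (vpoint v).1 + Sc <= Sc * n.+1%:R.
Proof.
move=> vn; have [l0 ln _] := lxP ordP vn; split=> /=; last exact: Sc_step.
by have := Sc_step l0; rewrite mulr0 add0r.
Qed.

Lemma dcurve_vertex p v : (p < nd)%N -> (v < n)%N -> dcurve p (vpoint v) -> v = da p.
Proof.
move=> pn vn /dcurve_cases[[b]|/ltent_x[h _]]; first exact: strand_vertex.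
by exfalso; have [h1 _] := vpoint_x vn; have := Sc0; lra.
Qed.

Lemma ecrv_vertex p q v : (p < nd)%N -> (q < nd)%N -> (v < n)%N ->
  ecrv p q (vpoint v) -> v = da p \/ v = da q.
Proof.
move=> pn qn vn [[h|/rtent_x[h _]]|h].
- by left; apply: dcurve_vertex h.
- by exfalso; have [_ h1] := vpoint_x vn; have := Sc0; lra.
- by right; apply: dcurve_vertex h.
Qed.

Lemma ecrv_meet p q p' q' z : (p < nd)%N -> (q < nd)%N -> (p' < nd)%N -> (q' < nd)%N ->
  p <> q -> p' <> q' -> samee da db p q -> samee da db p' q' ->
  (forall r s : nat, r \in [:: p; q] -> s \in [:: p'; q'] -> r <> s /\ ~~ samee da db r s) ->
  ecrv p q z -> ecrv p' q' z ->
  exists v, [/\ z = vpoint v, v = da p \/ v = da q & v = da p' \/ v = da q'].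
Proof.
move=> pn qn pn' qn' pq pq' s s' H.
have cases r1 r2 : ecrv r1 r2 z -> (exists2 r, r \in [:: r1; r2] & dcurve r z) \/ rtent r1 r2 z.
  case=> [[h|h]|h]; last 1 [by left; exists r2; rewrite ?inE ?eqxx ?orbT] || idtac.
  - by left; exists r1; rewrite ?inE ?eqxx.
  - by right.
have nb r : r \in [:: p; q] -> (r < nd)%N by rewrite !inE => /orP[]/eqP->.
have nb' r : r \in [:: p'; q'] -> (r < nd)%N by rewrite !inE => /orP[]/eqP->.
have rd r1 r2 r : (r1 < nd)%N -> (r2 < nd)%N -> (r < nd)%N -> dcurve r z -> rtent r1 r2 z -> r = r1 \/ r = r2.
  move=> h1 h2 h3 /dcurve_cases[[b h]|h] h'; last by case: (ltent_rtent h h').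
  by have [] := rtent_strand h1 h2 h3 h' h.
case/cases=> [[r rm rz]|rz] /cases[[r' rm' rz']|rz'].
- have [ne _] := H r r' rm rm'; have [E ->] := dcurve_meet (nb r rm) (nb' r' rm') ne rz rz'.
  exists (da r); split=> //; first by move: rm; rewrite !inE => /orP[]/eqP->; auto.
  by rewrite E; move: rm'; rewrite !inE => /orP[]/eqP->; auto.
- have [E|E] := rd _ _ _ pn' qn' (nb _ rm) rz rz'; have [] := H r r rm; rewrite // E !inE eqxx ?orbT //.
- have [E|E] := rd _ _ _ pn qn (nb' _ rm') rz' rz; have [] // := H r' r'; rewrite // E !inE eqxx ?orbT //.
- by case: (rtent_rtent pn qn pn' qn' pq pq' s s' H rz rz').
Qed.

(** * The cluster rectangles *)

Section Region.
Variables (a k b : nat).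
Hypotheses (a1 : (0 < a)%N) (k1 : (0 < k)%N) (akb : (a + k = b.+1)%N) (bn : (b <= n)%N).

Definition rx1 : R := Sc * a%:R - 2 * k%:R.
Definition rx2 : R := Sc * b%:R + 2 * k%:R.
Definition rreg : set (plane R) := rect rx1 rx2 (- k%:R) k%:R.
Definition rfrm : set (plane R) := frame rx1 rx2 (- k%:R) k%:R.

Lemma kn : (k <= n)%N.
Proof. by move: a1 akb bn; clear; lia. Qed.

Lemma k1R : 1 <= k%:R :> R.
Proof. by rewrite ler1n. Qed.

Lemma rx12 : rx1 < rx2.
Proof.
have h : Sc * a%:R <= Sc * b%:R by apply: Sc_le; move: k1 akb; clear; lia.
by rewrite /rx1 /rx2; have := k1R; lra.
Qed.

Lemma ry12 : - k%:R < k%:R :> R.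
Proof. by have := k1R; lra. Qed.

Lemma rreg_vertex v : (v < n)%N -> rreg (vpoint v) <-> (a <= lx v <= b)%N.
Proof.
move=> vn; have S0 := Sc0; have Sk := Sc_card kn; have k1' := k1R.
rewrite /rreg /rect /= /rx1 /rx2; split.
  case=> /andP[h1 h2] _; apply/andP; split; rewrite leqNgt; apply/negP => /Sc_step; lra.
by case/andP=> /Sc_le h1 /Sc_le h2; split; apply/andP; split; lra.
Qed.

Local Ltac shrink := clear - ncv nce ordP dan a1 k1 akb bn R.

(** Inside the strip, a strand is either within [k] of the vertex where it ends or more than [2 * k]
    from the abscissae of its gap. The vertical sides, [2 * k] beyond the outer vertices, fall in
    between and are missed. As strands reach their vertices from the left, the gap to the right of
    the last vertex of the cluster contributes nothing, and [k] gaps remain. *)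
Lemma seg_frame b' p i z : (p < nd)%N -> (i < rng b' p)%N -> seg b' p i z -> rfrm z ->
  [/\ (a <= i.+1 <= b)%N, rx1 < z.1 < rx2, Sc * i%:R < z.1 < Sc * i.+1%:R,
      z.2 = k%:R \/ z.2 = - k%:R & hval b' p i.+1 - hval b' p i != 0].
Proof.
move=> pn ir zs [[/andP[z1 z2] /andP[z3 z4]] zf].
have S0 := Sc0; have Sk := Sc_card kn; have k1' := k1R; have Sb := Sc_big kn; have H1 := Hm1.
have [t t01 zE] := segP zs; case/andP: (t01) => t0 t1.
have A0 := val_nz pn ir; have AH := @val_le b' p i pn; have BH := @val_le b' p i.+1 pn.
have z1E : z.1 = Sc * i%:R + t * Sc by rewrite zE /=; lra.
have z2E : z.2 = Sc * ((1 - t) * hval b' p i + t * hval b' p i.+1) by rewrite zE.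
have zk : `|Sc * ((1 - t) * hval b' p i + t * hval b' p i.+1)| <= k%:R.
  by rewrite -z2E ler_norml z3 z4.
(* A strand never has the value 0 at the left end of a gap, so [z] is more than [2 * k] to the right
   of it. *)
have f1 := far_from_start k1' H1 Sb t01 A0 AH BH zk.
have siE : Sc * i.+1%:R = Sc * i%:R + Sc by rewrite -natr1 mulrDr mulr1.
have ib : (i < b)%N.
  by rewrite ltnNge; apply/negP => /Sc_le; move: z2 z1E f1; rewrite /rx2; shrink; lra.
have := Sc_le ib; rewrite siE => ib'.
have tS : t * Sc <= Sc by rewrite ler_piMl // ltW.
(* If the strand does not end at [i.+1], the same estimate from the right end applies and even
   [a <= i] holds. If it ends there, [z] is within [k] of the vertex, inside the margin of
   [2 * k]. *)
have main : [/\ (a <= i.+1)%N, rx1 < z.1 & t < 1].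
  case: (val_end pn ir) => [B0|B0|[B0 _ _]]; [have B1 : hval b' p i.+1 <= -1 \/ 1 <= hval b' p i.+1 by left | have B1 : hval b' p i.+1 <= -1 \/ 1 <= hval b' p i.+1 by right | ].
  1,2: have t01' : 0 <= 1 - t <= 1 by move: t0 t1; shrink=> ? ?; apply/andP; split; lra.
  1,2: have zk' : `|Sc * ((1 - (1 - t)) * hval b' p i.+1 + (1 - t) * hval b' p i)| <= k%:R
    by rewrite subKr addrC.
  1,2: have f2 := far_from_start k1' H1 Sb t01' B1 BH AH zk'.
  1,2: have ai : (a <= i)%N by rewrite leqNgt; apply/negP => /Sc_le; rewrite siE; move: z1 z1E f2; rewrite /rx1; shrink; lra.
  1,2: split; [exact: leqW | by rewrite /rx1; move: (Sc_le ai) z1E f1 k1'; shrink; lra | ].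
  1,2: by rewrite -subr_gt0 -(pmulr_lgt0 _ S0); move: f2 k1'; shrink; lra.
  have f2 : (1 - t) * Sc <= k%:R by apply: (near_end0 (ltW S0) t1 A0); rewrite -B0.
  have ai : (a <= i.+1)%N.
    by rewrite leqNgt; apply/negP => /Sc_step; rewrite siE; move: z1 z1E tS Sk k1'; rewrite /rx1; shrink; lra.
  have zx : rx1 < z.1 by rewrite /rx1; move: (Sc_le ai) z1E f2 k1'; rewrite siE; shrink; lra.
  split=> //; rewrite lt_neqAle t1 andbT; apply/eqP => t1E.
  have z20 : z.2 = 0 by rewrite z2E t1E B0 subrr mul0r mulr0 addr0 mulr0.
  move: zf; rewrite z20 z1E t1E mul1r; move: zx ib' k1'; rewrite /rx2 z1E t1E mul1r; shrink.
  by move=> h1 h2 h3 [h|[h|[h|h]]]; lra.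
have [ai zx tl] := main.
have tS' : t * Sc < Sc by rewrite gtr_pMl.
have zx2 : z.1 < rx2 by rewrite /rx2; move: z1E ib' tS' k1'; shrink; lra.
split.
- by rewrite ai ib.
- by rewrite zx zx2.
- by move: z1E f1 k1' tS'; shrink=> ? ? ? ?; apply/andP; split; lra.
- move: zf zx zx2; shrink=> zf zx zx2.
  by case: zf => [h|[h|[h|h]]]; [lra | lra | right | left].
- apply/negP => /eqP E; have E' : hval b' p i.+1 = hval b' p i by apply/eqP; rewrite -subr_eq0 E.
  move: z2E; rewrite E' -mulrDl subrK mul1r => z2E; case: A0 => h.
    by have : Sc * hval b' p i <= Sc * -1 by [rewrite ler_pM2l]; move: z2E z3 Sk k1'; shrink; lra.
  by have : Sc * 1 <= Sc * hval b' p i by [rewrite ler_pM2l]; move: z2E z4 Sk k1'; shrink; lra.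
Qed.

Lemma ecrv_frame p q z : (p < nd)%N -> (q < nd)%N -> ecrv p q z -> rfrm z ->
  exists b' r i, [/\ r = p \/ r = q, (i < rng b' r)%N & seg b' r i z].
Proof.
move=> pn qn ez [[/andP[z1 z2] _] _].
have S0 := Sc0; have Sk := Sc_card kn; have k1' := k1R.
have zpos : 0 < z.1 by have := Sc_step a1; rewrite mulr0 /rx1 in z1 *; lra.
have zn : z.1 < Sc * n.+1%:R.
  by have := Sc_step (bn : (b < n.+1)%N); rewrite /rx2 in z2; lra.
have dc r : dcurve r z -> exists b' i, (i < rng b' r)%N /\ seg b' r i z.
  by case/dcurve_cases=> [[b' [i ir zs]]|/ltent_x[h _]]; [exists b', i | lra].
case: ez => [[/dc[b' [i [h1 h2]]]|/rtent_x[h _]]|/dc[b' [i [h1 h2]]]].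
- by exists b', p, i; split; auto.
- lra.
- by exists b', q, i; split; auto.
Qed.

Lemma ecrv_frame_y p q z : (p < nd)%N -> (q < nd)%N -> ecrv p q z -> rfrm z -> z.2 <> 0.
Proof.
move=> pn qn ez zf; have [b' [r [i [rE ir zs]]]] := ecrv_frame pn qn ez zf.
have rn : (r < nd)%N by case: rE => ->.
by have [_ _ _ h _] := seg_frame rn ir zs zf; have := k1R; case: h => ->; lra.
Qed.

Definition crosspt b' p i (s : bool) : plane R :=
  let y := if s then k%:R else - k%:R in
  (Sc * i%:R + (y - Sc * hval b' p i) / (hval b' p i.+1 - hval b' p i), y).

(** Two darts, two strands each, [k] gaps and two horizontal sides give [8 * k] candidates, each the
    solution of a linear equation. *)
Lemma crossings_seq p q : (p < nd)%N -> (q < nd)%N ->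
  exists2 s : seq (plane R), (size s <= 8 * k)%N & ecrv p q `&` rfrm `<=` [set z | z \in s].
Proof.
move=> pn qn; pose B := [:: true; false].
pose L := [seq (crosspt c.1.1 c.1.2 c.2 false, crosspt c.1.1 c.1.2 c.2 true) | c <-
  [seq (x, i) | x <- [seq (b', r) | b' <- B, r <- [:: p; q]], i <- iota a.-1 k]].
exists (unzip1 L ++ unzip2 L).
  by rewrite size_cat !size_map !size_allpairs size_iota /=; move: k; clear; lia.
move=> z [ez zf]; have [b' [r [i [rE ir zs]]]] := ecrv_frame pn qn ez zf.
have rn : (r < nd)%N by case: rE => ->.
have [/andP[ai ib] _ _ yk m0] := seg_frame rn ir zs zf.
have inL : ((b', r), i) \in [seq (x, i) | x <- [seq (b', r) | b' <- B, r <- [:: p; q]], i <- iota a.-1 k].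
  apply/allpairsP; exists ((b', r), i); split=> //=.
    by case: (b'); case: rE => ->; rewrite !inE eqxx ?orbT.
  by rewrite mem_iota; move: a1 ai ib akb; clear; lia.
have zE s : z.2 = (if s then k%:R else - k%:R) -> z = crosspt b' r i s.
  move=> E; rewrite /crosspt -E; case: zs => _ /=; rewrite /line => El.
  have -> : z.2 - Sc * hval b' r i = (z.1 - Sc * i%:R) * (hval b' r i.+1 - hval b' r i) by lra.
  by rewrite mulfK // addrC subrK; case: (z).
rewrite /= mem_cat; apply/orP; case: yk => E; [right | left]; apply/mapP.
  by exists (crosspt b' r i false, crosspt b' r i true); [apply/mapP; exists ((b', r), i) | exact: zE].
by exists (crosspt b' r i false, crosspt b' r i true); [apply/mapP; exists ((b', r), i) | exact: zE].
Qed.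

Lemma line_cont b' r i : continuous (fun w : plane R => w.2 - line b' r i w.1).
Proof.
move=> w; apply: cvgB; first exact: snd_cont.
apply: cvgD; first exact: cvg_cst.
apply: cvgM; first exact: cvg_cst.
by apply: cvgB; [exact: fst_cont | exact: cvg_cst].
Qed.

Lemma open_neq0 (f : plane R -> R) : continuous f -> open [set w | f w != 0].
Proof.
move=> fc; have -> : [set w | f w != 0] = [set w | [set x : R | x != 0] (f w)] by [].
by apply: open_preim => //; exact: open_neq.
Qed.

Lemma ecrv_alternate p q z : (p < nd)%N -> (q < nd)%N -> p <> q -> ecrv p q z -> rfrm z ->
  alternate (ecrv p q) rfrm z /\ alternate rfrm (ecrv p q) z.
Proof.
move=> pn qn pq ez zf; have [b' [r [i [rE ir zs]]]] := ecrv_frame pn qn ez zf.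
have rn : (r < nd)%N by case: rE => ->.
have [/andP[ai ib] zx zi yk m0] := seg_frame rn ir zs zf.
have S0 := Sc0; have k1' := k1R.
(* [U] stays inside the gap, inside the width of the rectangle and on the side of the x-axis of [z],
   and avoids the lines of the other strands present over this gap. There the edge is one line and
   the frame one horizontal line. *)
pose O c s : set (plane R) := if ((c, s) == (b', r)) || (rng c s <= i)%N then setT
  else [set w | w.2 - line c s i w.1 != 0].
pose U : set (plane R) := [set w | `]Sc * i%:R, Sc * i.+1%:R[%classic w.1] `&`
  [set w | `]rx1, rx2[%classic w.1] `&` [set w | `]0, +oo[%classic (w.2 * z.2)] `&`
  (O true p `&` O false p `&` (O true q `&` O false q)).
have Oo c s : open (O c s).
  by rewrite /O; case: ifP => _; [exact: openT | exact/open_neq0/line_cont].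
have Uo : open U.
  do ![apply: openI]; try exact: Oo; apply: open_preim; try exact: interval_open;
    try exact: fst_cont.
  by move=> w; apply: cvgM; [exact: snd_cont | exact: cvg_cst].
have zO c s : s = p \/ s = q -> O c s z.
  move=> sE; rewrite /O; case: ifPn => // /norP[ne]; rewrite -ltnNge => ic.
  apply/negP; rewrite subr_eq0 => /eqP E.
  have sn : (s < nd)%N by case: sE => ->.
  have zst : strand c s z by exists i => //; split=> //; case/andP: zi => ? ?; rewrite !ltW.
  have zst' : strand b' r z by exists i.
  have [|_ _ _ zE] := strand_meet sn rn _ zst zst'; first by move=> h; rewrite h eqxx in ne.
  by move: yk; rewrite zE /=; case; lra.
have yy : 0 < z.2 * z.2.
  by case: yk => ->; rewrite ?mulrNN mulr_gt0 //; move: k1'; shrink; lra.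
have Uz : U z by do ![split]; rewrite /= ?in_itv /= ?yy //; apply: zO; auto.
apply: (alternate_line m0 Uo Uz) => w [] [] [] wi wx wy [] [] O1 O2 [] O3 O4.
rewrite /= !in_itv /= in wi wx wy; rewrite andbT in wy.
have [_ zl] := zs; have ll : line b' r i w.1 - z.2 = (hval b' r i.+1 - hval b' r i) * (w.1 - z.1).
  by rewrite zl /line; lra.
split; split.
- move=> ew; have wE c s : s = p \/ s = q -> strand c s w -> w.2 = line b' r i w.1.
    move=> sE [j jr [/andP[j1 j2] jE]].
    have ji : j = i.
      case/andP: wi => wi1 wi2; apply/eqP; rewrite eqn_leq; apply/andP; split.
        by rewrite -ltnS -(ltr_nat R) -(ltr_pM2l S0); exact: le_lt_trans j1 wi2.
      by rewrite -ltnS -(ltr_nat R) -(ltr_pM2l S0); exact: lt_le_trans wi1 j2.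
    subst j; have Ocs : O c s w by case: (c); case: sE => ->.
    move: Ocs; rewrite /O; case: ifPn => [/orP[/eqP[<- <-]//|]|_ /=]; first by rewrite leqNgt jr.
    by rewrite jE subrr eqxx.
  have wn : 0 < w.1 < Sc * n.+1%:R.
    case/andP: wi => wi1 wi2; have := Sc_le (leq0n i); rewrite mulr0 => h0.
    have h1 : Sc * i.+1%:R <= Sc * n.+1%:R by apply: Sc_le; move: ib bn; clear; lia.
    by move: h0 h1 wi1 wi2; shrink=> ? ? ? ?; apply/andP; split; lra.
  rewrite -ll; congr (_ - _).
  case/andP: wn => w0 w1.
  by case: ew => [[/dcurve_cases[[c h]|/ltent_x[h _]]|/rtent_x[h _]]|/dcurve_cases[[c h]|/ltent_x[h _]]];
    [apply: wE h; left | move: h w0; shrink; lra | move: h w1; shrink; lra |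
     apply: wE h; right | move: h w0; shrink; lra].
- rewrite -ll => E; have wl : w.2 = line b' r i w.1 by lra.
  have ws : strand b' r w by exists i => //; split=> //; case/andP: wi => ? ?; rewrite !ltW.
  have wd : dcurve r w by case: (b') ws => ws; [right | left; left].
  by case: rE => rE; rewrite rE in wd; [left; left | right].
- case=> _ wf; case/andP: wx => wx1 wx2.
  have {}wf : w.2 = k%:R \/ w.2 = - k%:R.
    move: wf wx1 wx2; shrink=> wf wx1 wx2.
    by case: wf => [h|[h|[h|h]]]; [lra | lra | right | left].
  exact: (signed_eq k1' wf yk wy).
- move=> wE; case/andP: wx => wx1 wx2; split; last by case: yk => h; rewrite wE h; auto.
  rewrite /rect /= wE; move: k1' wx1 wx2 yk; shrink=> k1' wx1 wx2 yk.
  by case: yk => ->; split; apply/andP; split; lra.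
Qed.
End Region.

Section TwoRegions.
Variables (a k b a' k' b' : nat).
Hypotheses (a1 : (0 < a)%N) (k1 : (0 < k)%N) (akb : (a + k = b.+1)%N) (bn : (b <= n)%N).
Hypotheses (a1' : (0 < a')%N) (k1' : (0 < k')%N) (akb' : (a' + k' = b'.+1)%N) (bn' : (b' <= n)%N).

Lemma rreg_nested : (a' <= a)%N -> (b <= b')%N -> rreg a k b `<=` rreg a' k' b'.
Proof.
move=> aa bb z [/andP[z1 z2] /andP[z3 z4]]; have kk : (k <= k')%N by move: aa bb akb akb'; clear; lia.
move: kk; rewrite -(ler_nat R) => kk; rewrite /rx1 /rx2 in z1 z2.
by have := Sc_le aa; have := Sc_le bb; split; apply/andP; split; rewrite /rx1 /rx2; lra.
Qed.

Lemma rfrm_nested z : (a' <= a)%N -> (b <= b')%N -> (k < k')%N -> rfrm a k b z -> rfrm a' k' b' z -> False.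
Proof.
move=> aa bb; rewrite -(ltr_nat R) => kk [[/andP[z1 z2] /andP[z3 z4]] _] [_ zf].
rewrite /rx1 /rx2 in z1 z2 zf; have := Sc_le aa; have := Sc_le bb.
by case: zf => [h|[h|[h|h]]]; lra.
Qed.

Lemma rreg_disjoint z : (b < a')%N -> rreg a k b z -> rreg a' k' b' z -> False.
Proof.
move=> ba [/andP[z1 z2] _] [/andP[z3 z4] _]; rewrite /rx1 /rx2 in z1 z2 z3 z4.
have Sk := Sc_card (kn a1 akb bn); have Sk' := Sc_card (kn a1' akb' bn').
by have := Sc_step ba; have := ler0n R k; have := ler0n R k'; lra.
Qed.
End TwoRegions.
End Geometry.

(** * The drawing of a certificate *)

Section Drawn.
Variables (R : realType) (C : clustered_graph) (c : seq nat).
Local Notation n := (nv C).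
Local Notation m := (ni C).
Local Notation x := (cg_input C).
Local Notation nd := (c_nd c).
Local Notation ord := (c_ord c).
Local Notation da := (c_da x c).
Local Notation db := (c_db x c).
Hypothesis ck : check x c.
Local Notation ra := (ra c).
Local Notation rk := (rk c).
Local Notation rb := (rb c).
Local Notation dpos := (@dpos C c).
Let ck_ncv := ck_ncv ck.
Let ck_nce := ck_nce ck.
Let ck_ord := ck_ord ck.
Let ck_da := ck_da ck.
Implicit Types (u v : 'I_n) (mu nu : 'I_m) (e f : 'I_n * 'I_n).

Definition the_drawing : drawing R C := Drawing
  (fun v => vpoint R n nd ord v)
  (fun e => ecrv n nd ord da (dpos e.1 e.2) (dpos e.2 e.1))
  (fun mu => rreg n nd (ra mu) (rk mu) (rb mu)).
Local Notation D := the_drawing.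

Definition the_pl : pl_drawing n m := PLDrawing
  (fun v => lvertex n nd ord v) (fun u v => ledge n nd ord da db u v)
  (fun mu => lregion n nd ord (in_inc x mu)).

(** The clause on the height serves to exclude triple points: edges meet boundaries only off the
    x-axis. *)
Lemma edges_meet e f z : e \in edges (@adj C) -> f \in edges (@adj C) -> e <> f ->
  ecurve D e z -> ecurve D f z -> z.2 = 0 /\
  ([set pos D e.1; pos D e.2] `&` [set pos D f.1; pos D f.2]) z.
Proof.
move=> ee ff ef; have [p1 p2 [p3 p3'] [p4 p4'] p5] := edge_darts ck ee.
have [q1 q2 [q3 q3'] [q4 q4'] q5] := edge_darts ck ff.
have e12 : (e.1 < e.2)%N by move: ee; rewrite inE => /andP[].
have f12 : (f.1 < f.2)%N by move: ff; rewrite inE => /andP[].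
have ne : ~ (e.1 = f.1 :> nat /\ e.2 = f.2 :> nat).
  by case=> /val_inj h /val_inj h'; apply: ef; case: (e) (f) h h' => ? ? [? ?] /= -> ->.
have ne' : ~ (e.1 = f.2 :> nat /\ e.2 = f.1 :> nat).
  by case=> h h'; move: e12 f12; rewrite h h'; lia.
move=> h1 h2.
have [|||v [-> hv hv']] := ecrv_meet ck_ncv ck_nce ck_ord ck_da p1 p2 q1 q2 p5 q5 _ _ _ h1 h2.
- by rewrite /samee p3 p3' p4 p4' !eqxx orbT.
- by rewrite /samee q3 q3' q4 q4' !eqxx orbT.
- have ns r s : r \in [:: dpos e.1 e.2; dpos e.2 e.1] -> s \in [:: dpos f.1 f.2; dpos f.2 f.1] -> ~~ samee da db r s.
    move=> rm sm; apply/negP; rewrite /samee; move: rm sm ne ne'; rewrite !inE.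
    by move=> /orP[]/eqP-> /orP[]/eqP->; rewrite ?(p3, p3', p4, p4', q3, q3', q4, q4') => h h' /orP[]/andP[/eqP k1 /eqP k2]; by [apply: h | apply: h'].
  move=> r s rm sm; split; last exact: ns.
  by move=> E; have := ns r s rm sm; rewrite E /samee !eqxx.
split=> //; rewrite /= in hv hv' *; rewrite p3 p4 in hv; rewrite q3 q4 in hv'.
split=> /=; [case: hv => -> | case: hv' => ->]; auto.
Qed.

Lemma bnd_region mu : bnd (region D mu) = rfrm n nd (ra mu) (rk mu) (rb mu).
Proof.
apply: rect_bnd; last exact/ry12/(rk_gt0 ck).
by apply: rx12; [exact: (rk_gt0 ck) | exact: rabk].
Qed.

Lemma frames_meet mu nu z : mu <> nu -> bnd (region D mu) z -> bnd (region D nu) z -> False.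
Proof.
rewrite !bnd_region.
have dj (k l : 'I_m) : (rb k < ra l)%N -> rfrm n nd (ra k) (rk k) (rb k) z ->
    rfrm n nd (ra l) (rk l) (rb l) z -> False.
  move=> h [h1 _] [h2 _]; apply: (rreg_disjoint _ _ _ _ _ _ h h1 h2);
  by [exact: ra_gt0 | exact: rabk | exact: (rb_le ck)].
have ns (k l : 'I_m) : k <> l -> ancestor l k -> rfrm n nd (ra k) (rk k) (rb k) z ->
    rfrm n nd (ra l) (rk l) (rb l) z -> False.
  move=> kl anc; have [h1 h2] := interval_sub ck (cluster_sub anc).
  have h3 : (rk k < rk l)%N.
    (* A cluster is determined by its vertices, so a proper descendant is strictly smaller; nested
       frames thus have different half-heights and do not touch. *)
    by rewrite !(rkE ck); apply: cluster_proper => //; [exact: cluster_inj | apply/eqP].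
  exact: (rfrm_nested h1 h2 h3).
move=> ne h1 h2; case: (cluster_laminar (@par C) mu nu) => [h|h|/(interval_disjoint ck)[h|h]].
- exact: (ns mu nu).
- by apply: (ns nu mu) => // E; case: ne.
- exact: (dj mu nu).
- exact: (dj nu mu).
Qed.

Lemma edge_frame_y e mu z : e \in edges (@adj C) -> ecurve D e z -> bnd (region D mu) z -> z.2 <> 0.
Proof.
move=> /(edge_darts ck)[p1 p2 _ _ _]; rewrite bnd_region.
exact: (ecrv_frame_y (ra_gt0 c mu) (rk_gt0 ck mu) (rabk c mu) (rb_le ck mu) p1 p2).
Qed.

Lemma edge_frame_seq e mu : e \in edges (@adj C) -> exists2 s : seq (plane R),
  (size s <= 8 * #|cluster_of mu|)%N & ecurve D e `&` bnd (region D mu) `<=` [set` s].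
Proof.
move=> /(edge_darts ck)[p1 p2 _ _ _]; rewrite bnd_region -(rkE ck).
exact: (@crossings_seq R n nd ord da (ra mu) (rk mu) (rb mu)
  (ra_gt0 c mu) (rk_gt0 ck mu) (rabk c mu) (rb_le ck mu) _ _ p1 p2).
Qed.

Lemma edge_frame_alternate e mu z : e \in edges (@adj C) -> ecurve D e z -> bnd (region D mu) z ->
  alternate (ecurve D e) (bnd (region D mu)) z /\ alternate (bnd (region D mu)) (ecurve D e) z.
Proof.
move=> /(edge_darts ck)[p1 p2 _ _ p3]; rewrite bnd_region.
exact: (ecrv_alternate ck_ord ck_da (ra_gt0 c mu) (rk_gt0 ck mu) (rabk c mu) (rb_le ck mu) p1 p2 p3).
Qed.

Lemma no_edge_crossing e f : e \in edges (@adj C) -> f \in edges (@adj C) -> e <> f ->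
  crossings D (inl e) (inl f) = set0.
Proof.
move=> ee ff ef; apply/seteqP; split=> // z [[h1 h2]]; apply.
by have [] := edges_meet ee ff ef h1 h2.
Qed.

Lemma finite_sub_seq (T : choiceType) (A : set T) (s : seq T) : A `<=` [set` s] -> finite_set A.
Proof. by move=> /sub_finite_set; apply; exact: finite_seq. Qed.

Lemma the_drawing_ok : is_drawing D.
Proof.
split.
- split.
  + move=> u v [] /(mulfI (lt0r_neq0 (Sc0 R n nd)))/eqP.
    by rewrite eqr_nat => /eqP E; apply/val_inj; exact: (lx_inj ck_ord _ _ E).
  + move=> e ee; have [p1 p2 [p3 _] [p4 _] p5] := edge_darts ck ee.
    have := @ecrv_arc R _ _ _ _ _ ck_ncv ck_nce ck_ord ck_da _ _ p1 p2.
    rewrite p3 p4; apply; move: ee; rewrite inE => /andP[+ _] E.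
    by rewrite E ltnn.
  + move=> e v ee; have [p1 p2 [p3 _] [p4 _] p5] := edge_darts ck ee.
    move=> h; have := ecrv_vertex ck_ord ck_da p1 p2 (ltn_ord v) h.
    by rewrite p3 p4; case=> /val_inj ->; auto.
- move=> mu; apply: rect_region; last exact/ry12/(rk_gt0 ck).
  by apply: rx12; [exact: (rk_gt0 ck) | exact: rabk].
- move=> mu v; rewrite (cluster_interval ck).
  exact: (@rreg_vertex R n nd ord (ra mu) (rk mu) (rb mu)
    (ra_gt0 c mu) (rk_gt0 ck mu) (rabk c mu) (rb_le ck mu) v (ltn_ord v)).
- move=> mu nu /cluster_sub/(interval_sub ck)[h1 h2].
  by apply: rreg_nested h1 h2; exact: rabk.
- move=> [e|mu] [f|nu] ck1 ck2 ne.
  + apply: (@sub_finite_set _ _ [set pos D e.1; pos D e.2]); last exact: finite_set2.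
    move=> z [h1 h2]; have ef : e <> f by move=> E; rewrite E eqxx in ne.
    by have [_ []] := edges_meet ck1 ck2 ef h1 h2.
  + by have [s _ /finite_sub_seq] := edge_frame_seq nu ck1.
  + by have [s _ /finite_sub_seq] := edge_frame_seq mu ck2; rewrite setIC.
  + apply: (@sub_finite_set _ _ set0) => // z [h1 h2].
    by apply: (frames_meet _ h1 h2) => E; rewrite E eqxx in ne.
- move=> [e|mu] [f|nu] ck1 ck2 ne z.
  + by rewrite no_edge_crossing // => E; rewrite E eqxx in ne.
  + by case=> [[h1 h2] _]; have [] := edge_frame_alternate ck1 h1 h2.
  + by case=> [[h1 h2] _]; have [] := edge_frame_alternate ck2 h2 h1.
  + by case=> [[h1 h2] _]; case: (@frames_meet mu nu z) => // E; rewrite E eqxx in ne.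
(* Two edges meet only on the x-axis, an edge and a boundary only off it, and two boundaries
   nowhere; so no third curve passes through a crossing. *)
- have ee e f g z : e \in edges (@adj C) -> f \in edges (@adj C) -> e <> f ->
      ecurve D e z -> ecurve D f z -> ~ bnd (region D g) z.
    move=> h1 h2 h3 h4 h5 h6; have [z0 _] := edges_meet h1 h2 h3 h4 h5.
    exact: (edge_frame_y h1 h4 h6 z0).
  have inlN (a b : 'I_n * 'I_n) : inl a != inl b :> 'I_n * 'I_n + 'I_m -> a <> b by move=> h E; rewrite E eqxx in h.
  have inrN (a b : 'I_m) : inr a != inr b :> 'I_n * 'I_n + 'I_m -> a <> b by move=> h E; rewrite E eqxx in h.
  move=> [e|mu] [f|nu] [g|la] k1 k2 k3 n1 n2 n3 z.
  + by rewrite no_edge_crossing //; exact: inlN.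
  + by rewrite no_edge_crossing //; exact: inlN.
  + by case=> [[h1 h2] _] h3; apply: (ee e g nu z) => //; exact: inlN.
  + by case=> [[h1 h2] _] h3; apply: (@frames_meet nu la z) => //; exact: inrN.
  + by case=> [[h1 h2] _] h3; apply: (ee f g mu z) => //; exact: inlN.
  + by case=> [[h1 h2] _] h3; apply: (@frames_meet mu la z) => //; exact: inrN.
  + by case=> [[h1 h2] _] h3; apply: (@frames_meet mu nu z) => //; exact: inrN.
  + by case=> [[h1 h2] _] h3; apply: (@frames_meet mu nu z) => //; exact: inrN.
Qed.

Lemma the_represents : pl_represents the_pl D.
Proof.
split.
- by move=> v; rewrite qlvertex.
- move=> e /(edge_darts ck)[p1 p2 _ _ p3]; by rewrite ecrv_chain.
- move=> mu; rewrite bnd_region /polygon /= !chain_cons2 chain1 setU0 /rfrm.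
  rewrite -frame_segments; last exact/ry12/(rk_gt0 ck); last first.
    by apply: rx12; [exact: (rk_gt0 ck) | exact: rabk].
  rewrite !qpointE -/(ra mu) -/(rk mu) rabk subSS !subn0 natrD.
  rewrite !(natrM _ (lscale n nd)) !(natrM _ 2 (rk mu)) !sub0r !subr0 !setUA.
  by [].
Qed.

Lemma the_code : pl_code the_pl = pickle (build x c).
Proof.
have mkE (T : Type) (g : nat -> T) (k : nat) : [seq g (nat_of_ord i) | i <- enum 'I_k] = mkseq g k.
  by rewrite (map_comp g (@nat_of_ord k)) val_enum_ord.
rewrite /pl_code /build /in_n /in_m /=; congr (pickle (_, _, _)).
- exact: mkE.
- rewrite (mkE _ (fun i => [seq ledge n nd ord da db i (nat_of_ord j) | j <- enum 'I_n])).
  by congr flatten; apply: eq_map => i; rewrite mkE.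
- exact: (mkE _ (fun i => lregion n nd ord (in_inc x i))).
Qed.

Lemma no_edge_edge : edge_edge_crossings D = 0%N.
Proof.
rewrite /edge_edge_crossings big1 // => e ee; rewrite big1 // => f /andP[ff ef].
rewrite no_edge_crossing //; last by move=> E; rewrite E ltnn in ef.
by rewrite /ncard fset_set0.
Qed.

Lemma no_region_region : region_region_crossings D = 0%N.
Proof.
rewrite /region_region_crossings big1 // => mu _; rewrite big1 // => nu /and3P[_ h1 h2].
(* Incomparable clusters have disjoint rectangles, so the difference is a whole rectangle, which has
   one component. *)
have dis : region D mu `\` region D nu = region D mu.
  apply/seteqP; split=> [z []//|z h]; split=> // h'.
  case: (cluster_laminar (@par C) mu nu) => [h3|h3|/(interval_disjoint ck)[h3|h3]].
  - by rewrite /ancestor h3 in h2.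
  - by rewrite /ancestor h3 in h1.
  - apply: (rreg_disjoint _ _ _ _ _ _ h3 h h');
    by [exact: ra_gt0 | exact: rabk | exact: (rb_le ck)].
  - apply: (rreg_disjoint _ _ _ _ _ _ h3 h' h);
    by [exact: ra_gt0 | exact: rabk | exact: (rb_le ck)].
have con : connected (region D mu).
  apply: rect_connected; last exact/ry12/(rk_gt0 ck).
  by apply: rx12; [exact: (rk_gt0 ck) | exact: rabk].
have [v vmu] := cluster_neq0 (@par_root C) (@par_child C) mu.
have Dv : region D mu (pos D v) by apply/(drawing_cluster the_drawing_ok).
rewrite dis (_ : components _ = [set region D mu]); first by rewrite /ncard fset_set1 finmap.cardfs1.
apply/seteqP; split=> [_ [z Dz <-] /=|_ ->]; first exact: connected_component_id.
by exists (pos D v); last exact: connected_component_id.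
Qed.

Lemma ncard_sub_seq (T : choiceType) (A : set T) (s : seq T) :
  A `<=` [set` s] -> (ncard A <= size s)%N.
Proof.
move=> As; have fA := finite_sub_seq As; rewrite /ncard.
apply: uniq_leq_size; first exact: finmap.fset_uniq.
by move=> z; rewrite in_fset_set // inE => /As.
Qed.

(** Halving the at most [8 * #|cluster_of mu|] crossings of an edge with a boundary leaves the
    factor 4. *)
Lemma edge_region_bound :
  (edge_region_crossings D <= #|edges (@adj C)| * (4 * \sum_(mu < m) #|cluster_of mu|))%N.
Proof.
rewrite /edge_region_crossings -sum_nat_const; apply: leq_sum => e ee.
rewrite big_distrr /=; apply: leq_sum => mu _.
have [s ss sub] := edge_frame_seq mu ee.
have : (ncard (crossings D (inl e) (inr mu)) <= 8 * #|cluster_of mu|)%N.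
  by apply: leq_trans ss; apply: ncard_sub_seq => z [] /sub.
by move/half_leq; rewrite -[8%N]/(2 * 4)%N -mulnA mul2n doubleK.
Qed.
End Drawn.

Lemma card_edges (C : clustered_graph) wd : dart_order (nadj (@adj C)) wd ->
  (#|edges (@adj C)| <= 4 * nv C)%N.
Proof.
move=> wdP; pose es := [seq (val e.1, val e.2) | e <- enum (edges (@adj C))].
have -> : #|edges (@adj C)| = size es by rewrite size_map -cardE.
apply: (@edges_size (nv C) (nadj (@adj C)) wd es wdP).
- by case: wdP => _ mwd _ _ d; rewrite mwd => /nadjP[u [v [-> _ _]]].
- by move=> u v; apply/idP/idP => /nadjP[y [z [-> -> h]]]; rewrite nadjE adj_sym.
- rewrite map_inj_uniq ?enum_uniq // => -[u v] [u' v'] [] /val_inj -> /val_inj ->.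
  by [].
- by move=> e /mapP[[u v]]; rewrite mem_enum inE /= => /andP[h1 h2] -> /=; rewrite h1 nadjE.
Qed.

Theorem theorem2 (R : realType) :
  exists (alg : recfun) (c : nat), forall C : clustered_graph,
    planar R (@adj C) ->
    exists (P : pl_drawing (nv C) (ni C)) (D : drawing R C) (beta : nat),
      [/\ reval alg [:: cg_code C] (pl_code P),
          pl_represents P D,
          abc_drawing D 0 beta 0,
          (beta <= c * nv C ^ 3)%N
        & flat C -> (beta <= c * nv C ^ 2)%N].
Proof.
(* At most 4n edges, a factor 4 from the halved crossings, and a sum of cluster sizes of at most n(n
   + 1) <= 2n^2, or 2n if flat: the constant is 4 * 4 * 2 in both cases. *)
have [alg algP] := build_search; exists alg, 32%N => C plC.
have [wd wdP] := planar_dart_order (@adj_sym C) (@adj_irr C) plC.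
have ex : exists c, check (cg_input C) c.
  apply: (certificate (a := nadj (@adj C))) wdP; first by move=> u v; rewrite nadjE.
  by move=> u v /nadjP[y [_ [-> _ _]]].
have [c [ck ev]] := algP _ ex.
exists (the_pl C c), (the_drawing R C c), (edge_region_crossings (the_drawing R C c)).
have Ebound := edge_region_bound R ck; have Ecard := card_edges wdP.
split.
- by rewrite the_code.
- exact: the_represents.
- by split=> //; [exact: the_drawing_ok | exact: no_edge_edge | exact: no_region_region].
- apply: leq_trans Ebound _.
  have h := sum_clusters (clusters_at (@cluster_inj C)).
  have h' : (\sum_(mu < ni C) #|cluster_of mu| <= nv C * (nv C).+1)%N by exact: h.
  apply: leq_trans (leq_mul Ecard (leq_mul (leqnn 4) h')) _.
  by rewrite !expnS expn0; case: (nv C) => [|k]; nia.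
- move=> flC; apply: leq_trans Ebound _.
  have h' : (\sum_(mu < ni C) #|cluster_of mu| <= nv C * 2)%N.
    by apply: sum_clusters => v; apply: clusters_at_flat => //; exact: par_root.
  apply: leq_trans (leq_mul Ecard (leq_mul (leqnn 4) h')) _.
  by rewrite !expnS expn0; nia.
Qed.
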